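(* Let $K\ge2$ be fixed, let $B=B_n\to\infty$ as $n\to\infty$, and put $M_n=KB_n$. In each case below suppose the uniform analytic cgf assumption stated in the context holds for the given block rule. (a) (MC-blocks.) Let $\kappa_2(\theta)=\sigma^2(\theta)=\operatorname{Var}\{V_{k,1}(\theta)\}$ and let $\kappa_3(\theta)$ be the third cumulant of $V_{k,1}(\theta)$. If $\beta_n^2/M_n\to0$, then $$\|\pi^{(0)}_{n,M_n}-\pi_n\|_{\mathrm{TV}}=\frac{\beta_n^2}{4M_n}\,\mathbb{E}_{\pi_n}\big|\kappa_2-\mathbb{E}_{\pi_n}\kappa_2\big|+o\!\left(\frac{\beta_n^2}{M_n}\right).$$ If $\beta_n^3/M_n^2\to0$, then $$\|\pi_{n,M_n}-\pi_n\|_{\mathrm{TV}}=\frac{\beta_n^3}{6M_n^2}\,\mathbb{E}_{\pi_n}\big|\kappa_3-\mathbb{E}_{\pi_n}\kappa_3\big|+o\!\left(\frac{\beta_n^3}{M_n^2}\right).$$ When $\beta_n\asymp n$, $M_n/n^2\to\infty$ is sufficient for $\|\pi^{(0)}_{n,M_n}-\pi_n\|_{\mathrm{TV}}\to0$, and $M_n/n^{3/2}\to\infty$ is sufficient for $\|\pi_{n,M_n}-\pi_n\|_{\mathrm{TV}}\to0$. (b) (RQ-blocks.) Suppose that $$\|v_{B_n}\|_{\infty,n}\le C B_n^{-\alpha}\{\log(2+B_n)\}^{d-1}$$ for constants $C<\infty$, $\alpha>0$ and fixed randomized-input dimension $d$ (an integer $d\ge 1$). Define $$\delta^{\mathrm{RQ}}_{n,M_n}=\beta_n^2M_n^{-\alpha}\{\log(2+M_n)\}^{d-1}.$$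 If $\delta^{\mathrm{RQ}}_{n,M_n}\to0$, then $$\|\pi^{(0)}_{n,M_n}-\pi_n\|_{\mathrm{TV}}=\frac{\beta_n^2}{4K}\mathbb{E}_{\pi_n}\big|v_{B_n}-\mathbb{E}_{\pi_n}v_{B_n}\big|+O\{(\delta^{\mathrm{RQ}}_{n,M_n})^{3/2}\}=O(\delta^{\mathrm{RQ}}_{n,M_n}),$$ $$\|\pi_{n,M_n}-\pi_n\|_{\mathrm{TV}}=\frac{\beta_n^3}{6K^2}\mathbb{E}_{\pi_n}\big|\chi_{3,B_n}-\mathbb{E}_{\pi_n}\chi_{3,B_n}\big|+O\{(\delta^{\mathrm{RQ}}_{n,M_n})^{2}\}=O\{(\delta^{\mathrm{RQ}}_{n,M_n})^{3/2}\}.$$ When $\beta_n\asymp n$, the condition $\delta^{\mathrm{RQ}}_{n,M_n}\to0$ is equivalent to $$\frac{M_n}{n^{2/\alpha}\{\log(2+M_n)\}^{(d-1)/\alpha}}\to\infty.$$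
   Context: Setting. For each $n$ there is a prior density $\pi_0$ on a parameter space, a loss $\ell_n(\theta)=\int L(\theta,x)\,P(dx)$ ($L,P$ may depend on $n$; this is suppressed), an inverse temperature $\beta_n>0$, and the intended posterior, a probability density $\pi_n(\theta)\propto\exp\{-\beta_n\ell_n(\theta)\}\pi_0(\theta)$. For a block size $B$, the $K$ random input blocks $\xi_k=(\xi_{k,1},\dots,\xi_{k,B})$, $k=1,\dots,K$, are i.i.d. given $\theta$, and $\widehat\ell^{(k)}(\theta)=B^{-1}\sum_{b=1}^BL(\theta,\xi_{k,b})$ satisfies $\mathbb{E}\,\widehat\ell^{(k)}(\theta)=\ell_n(\theta)$. MC-blocks: the $\xi_{k,b}$ are i.i.d. from $P$ also within each block. RQ-blocks: the $B$ points within a block (randomized quasi-Monte Carlo points, $d$-dimensional) may be dependent; different blocks are independent. Block quantities. $X_k(\theta)=\widehat\ell^{(k)}(\theta)-\ell_n(\theta)$ is the block error; $V_{k,b}(\theta)=L(\theta,\xi_{k,b})-\ell_n(\theta)$; $A_B=K^{-1}\sum_kX_k$; $S^2_{K,B}=(K-1)^{-1}\sum_k(X_k-A_B)^2$; $\sigma^2(\theta)=\operatorname{Var}\{V_{k,1}(\theta)\}$; $v_B(\theta)=\operatorname{Var}\{X_1(\theta)\}$; $\chi_{j,B}(\theta)$ is the $j$-th cumulant of $X_1(\theta)$. Standardized cgfs. For MC-blocks set $q_B(\theta)=\sigma(\theta)/B$ and $\varphi_{B,\theta}(t)=\log\mathbb{E}\exp\{tV_{k,1}(\theta)/\sigma(\theta)\}$.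 For RQ-blocks set $q_B(\theta)=\sqrt{v_B(\theta)}$ and $\varphi_{B,\theta}(t)=\log\mathbb{E}\exp\{tX_1(\theta)/\sqrt{v_B(\theta)}\}$. (States with $v_B(\theta)=0$ are degenerate: there $X_k(\theta)=0$ a.s., all cumulants vanish, and the condition on $\varphi_{B,\theta}$ is not imposed.) Uniform analytic cgf assumption. There are constants $\eta>0$, $C_\varphi<\infty$ and sets $\mathcal{O}_n$ with $\pi_n(\mathcal{O}_n)=1$ such that for all $n$, $B$, $\theta\in\mathcal{O}_n$, $\varphi_{B,\theta}$ extends analytically to a neighbourhood of $\{t\in\mathbb{C}:|t|\le\eta\}$ and $\sup_{n,B}\sup_{\theta\in\mathcal{O}_n}\sup_{|t|\le\eta}|\varphi_{B,\theta}(t)|\le C_\varphi$. For MC-blocks also $\sup_{n,\theta\in\mathcal{O}_n}\sigma(\theta)<\infty$. Bessel factor. For $s^2\ge0$, with $\nu=(K-3)/2$ and $z=\beta\sqrt{(K-1)s^2/K}$, $F_\beta(s^2,K)=\Gamma(\nu+1)(z/2)^{-\nu}J_\nu(z)$ if $z>0$ and $F_\beta(s^2,K)=1$ if $z=0$ ($J_\nu$ the Bessel function of the first kind). Targets. With $M=KB$, let $u_{n,M}(\theta)=\mathbb{E}\exp\{-\beta_nA_B(\theta)\}$ and $w_{n,M}(\theta)=\mathbb{E}[\exp\{-\beta_nA_B(\theta)\}F_{\beta_n}(S^2_{K,B}(\theta),K)]$. The uncorrected and corrected posteriors are $\pi^{(0)}_{n,M}=\pi_n u_{n,M}/\mathbb{E}_{\pi_n}u_{n,M}$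 and $\pi_{n,M}=\pi_n w_{n,M}/\mathbb{E}_{\pi_n}w_{n,M}$ (the latter when $w_{n,M}>0$ $\pi_n$-a.e.); asymptotic statements are as $n\to\infty$ and concern all sufficiently large $n$. Norms. $\|g\|_{\infty,n}=\operatorname{ess\,sup}_{\theta\sim\pi_n}|g(\theta)|$; $\|p-q\|_{\mathrm{TV}}=\frac12\int|p-q|$. $\beta_n\asymp n$ means $c\,n\le\beta_n\le C'n$ for constants $0<c\le C'<\infty$. *)

(* Defs.v *)
From HB Require Import structures.
From mathcomp Require Import all_boot all_order all_algebra complex.
From mathcomp Require Import all_classical all_reals all_analysis.
From mathcomp Require Import measurable_realfun ess_sup_inf.

Set Implicit Arguments.
Unset Strict Implicit.
Unset Printing Implicit Defensive.

Import Order.TTheory GRing.Theory Num.Theory.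
Import numFieldNormedType.Exports.

Local Open Scope classical_set_scope.
Local Open Scope ring_scope.

Section density_measure.
Context d (T : measurableType d) (R : realType).
Variables (mu : {measure set T -> \bar R}) (f : T -> R).
Hypotheses (mf : measurable_fun setT f) (f0 : forall x, 0 <= f x).

Definition density_measure of measurable_fun setT f & (forall x, 0 <= f x) :
  set T -> \bar R := fun A => (\int[mu]_(x in A) (f x)%:E)%E.

Local Notation nu := (density_measure mf f0).

Let nu0 : nu set0 = 0%E.
Proof. exact: integral_set0. Qed.

Let nu_ge0 A : (0 <= nu A)%E.
Proof. by apply: integral_ge0 => x _; rewrite lee_fin. Qed.

Let nu_sigma_additive : semi_sigma_additive nu.
Proof.
apply: (@semi_sigma_additive_nng_induced _ _ _ mu (EFin \o f)).
  exact/measurable_EFinP.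
by move=> x; rewrite lee_fin.
Qed.

HB.instance Definition _ :=
  isMeasure.Build d T R nu nu0 nu_ge0 nu_sigma_additive.

End density_measure.

Section probability_notions.
Context d (W : measurableType d) (R : realType).
Implicit Types (P : probability W R) (X : W -> R).

(* As the A k may be equal to setT, this contains the product rule for all
   subfamilies of Y 0, ..., Y N.-1. *)
Definition mutually_independent d' (T : measurableType d') P (N : nat)
    (Y : nat -> W -> T) : Prop :=
  forall A : nat -> set T, (forall k, measurable (A k)) ->
    P (\big[setI/setT]_(k < N) (Y k @^-1` A k)) =
    (\prod_(k < N) P (Y k @^-1` A k))%E.

Definition identically_distributed d' (T : measurableType d') P (N : nat)
    (Y : nat -> W -> T) : Prop :=
  forall (k : nat) (A : set T), (k < N)%N -> measurable A ->
    P (Y k @^-1` A) = P (Y 0%N @^-1` A).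

Definition cgf P X (t : R) : R := ln (fine ('M_P X t)).

Definition cumulant P (j : nat) X : R := derive1n j (cgf P X) 0.

(* Complex differentiability on an open set is expressed with the complex field
   seen as a normed module over itself. The real points of the disc are required
   to be in the domain of finiteness of the moment generating function. *)
Definition cgf_extends_bounded P X (eta C : R) : Prop :=
  exists (U : set (R[i]^o)) (g : R[i]^o -> R[i]^o),
    [/\ open U /\ (forall z : R[i], `|z| <= (eta%:C)%C -> U z),
        forall z : R[i]^o, U z -> derivable g z 1,
        forall t : R, `|t| <= eta ->
          ('M_P X t < +oo)%E /\ g (t%:C)%C = ((cgf P X t)%:C)%C &
        forall z : R[i], `|z| <= (eta%:C)%C -> `|g z : R[i]| <= (C%:C)%C].

End probability_notions.

Section bessel.
Context (R : realType).

(* Euler integral, meant for 0 < x. *)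
Definition Gamma (x : R) : R :=
  \int[lebesgue_measure]_(t in `]0, +oo[) (t `^ (x - 1) * expR (- t)).

(* Meant for -1 < nu and 0 < z. *)
Definition besselJ (nu z : R) : R :=
  limn (series (fun m : nat =>
    (-1) ^+ m / (m`!%:R * Gamma (m%:R + nu + 1)) * (z / 2) `^ (2 * m%:R + nu))).

Definition bessel_factor (beta s2 : R) (K : nat) : R :=
  let nu := (K%:R - 3) / 2 in
  let z := beta * Num.sqrt ((K%:R - 1) * s2 / K%:R) in
  if z == 0 then 1 else Gamma (nu + 1) * (z / 2) `^ (- nu) * besselJ nu z.

End bessel.

Definition expected_loss d d' (T : measurableType d) (X : measurableType d')
    (R : realType) (P : probability X R) (L : T -> X -> R) (theta : T) : R :=
  \int[P]_x L theta x.

(* Everything may depend on n; densities are taken with respect to the reference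
   measure mu n. The prior need not be normalized, only the posterior is. *)
Record model (R : realType) := Model {
  dTheta : measure_display;
  Theta : nat -> measurableType dTheta;
  mu : forall n, {measure set (Theta n) -> \bar R};
  prior : forall n, Theta n -> R;
  prior_measurable : forall n, measurable_fun setT (@prior n);
  prior_ge0 : forall n theta, 0 <= @prior n theta;
  dInput : measure_display;
  Input : nat -> measurableType dInput;
  inputP : forall n, probability (Input n) R;
  L : forall n, Theta n -> Input n -> R;
  L_measurable : forall n,
    measurable_fun setT (fun p : Theta n * Input n => L p.1 p.2);
  L_integrable : forall n (theta : Theta n),
    (inputP n).-integrable setT (fun x => (L theta x)%:E);
  beta : nat -> R;
  beta_gt0 : forall n, 0 < beta n;
  normalizable : forall n,
    (0 < \int[mu n]_theta
       (expR (- beta n * expected_loss (inputP n) (@L n) theta)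
        * prior theta)%:E < +oo)%E }.

Section posterior.
Context (R : realType) (S : model R) (n : nat).
Implicit Types (theta : Theta S n) (g p q : Theta S n -> R).

Definition loss theta : R := expected_loss (inputP S n) (@L R S n) theta.

Definition post_dens theta : R :=
  expR (- beta S n * loss theta) * prior theta /
  \int[mu S n]_t (expR (- beta S n * loss t) * prior t).

Lemma measurable_loss : measurable_fun setT loss.
Proof.
pose f (p : Theta S n * Input S n) : \bar R := (L p.1 p.2)%:E.
have mf : measurable_fun setT f.
  by apply/measurable_EFinP; exact: (@L_measurable R S n).
have -> : loss = fun theta => fine
    (\int[inputP S n]_x f^\+ (theta, x) - \int[inputP S n]_x f^\- (theta, x))%E.
  apply/funext => theta; rewrite /loss /expected_loss /Rintegral integralE.
  by congr (fine (_ - _)%E); apply: eq_integral => x _; rewrite !unlock.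
apply: measurableT_comp => //; apply: emeasurable_funB.
- apply: (@measurable_fun_fubini_tonelli_F _ _ _ _ _ (inputP S n) f^\+%E) => //.
  exact: measurable_funepos.
- apply: (@measurable_fun_fubini_tonelli_F _ _ _ _ _ (inputP S n) f^\-%E) => //.
  exact: measurable_funeneg.
Qed.

Lemma measurable_post_dens : measurable_fun setT post_dens.
Proof.
apply: measurable_funM => //; apply: measurable_funM => //.
- apply: measurableT_comp => //; apply: measurable_funM => //.
  exact: measurable_loss.
- exact: prior_measurable.
Qed.

Lemma post_dens_ge0 theta : 0 <= post_dens theta.
Proof.
rewrite /post_dens divr_ge0 ?mulr_ge0 ?expR_ge0 ?prior_ge0//.
by apply: Rintegral_ge0 => t _; rewrite mulr_ge0 ?expR_ge0 ?prior_ge0.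
Qed.

Definition post : {measure set (Theta S n) -> \bar R} :=
  density_measure (mu S n) measurable_post_dens post_dens_ge0.

Definition post_mean g : R := \int[post]_theta g theta.

Definition post_norm g : \bar R := ess_sup post (fun theta => `|g theta|%:E).

Definition tv p q : R := 2^-1 * \int[mu S n]_theta `|p theta - q theta|.

Definition reweighted g theta : R := post_dens theta * g theta / post_mean g.

(* The target proportional to post_dens * g is well defined. An expectation that
   diverges is sent to 0 by fine, hence is excluded here. *)
Definition proper_weight g : Prop :=
  {ae post, forall theta, 0 < g theta} /\ 0 < post_mean g.

End posterior.

(* Omega n B carries K blocks of B inputs for the problem of index n, and
   Pr n B theta is their joint law given theta. Blocks and points are numbered
   from 0; only xi n B k b with k < K, b < B and 0 < B is meaningful. The points
   of one block may be dependent, so this already describes RQ-blocks. *)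
Record block_rule (R : realType) (S : model R) (K : nat) := BlockRule {
  dOmega : measure_display;
  Omega : nat -> nat -> measurableType dOmega;
  Pr : forall n B, Theta S n -> pprobability (Omega n B) R;
  Pr_measurable : forall n B, measurable_fun setT (@Pr n B);
  xi : forall n B, nat -> nat -> Omega n B -> Input S n;
  xi_measurable : forall n B k b, measurable_fun setT (@xi n B k b);
  blocks_independent : forall n B (theta : Theta S n), (0 < B)%N ->
    mutually_independent (@Pr n B theta) K
      (fun k w => [tuple @xi n B k b w | b < B]);
  blocks_identically_distributed :
    forall n B (theta : Theta S n), (0 < B)%N ->
    identically_distributed (@Pr n B theta) K
      (fun k w => [tuple @xi n B k b w | b < B]);
  block_loss_integrable :
    forall n B (theta : Theta S n) k, (0 < B)%N -> (k < K)%N ->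
    (@Pr n B theta).-integrable setT
      (fun w => (B%:R^-1 * \sum_(b < B) L theta (@xi n B k b w))%:E);
  block_loss_unbiased :
    forall n B (theta : Theta S n) k, (0 < B)%N -> (k < K)%N ->
    ('E_(@Pr n B theta)
       [(fun w => B%:R^-1 * \sum_(b < B) L theta (@xi n B k b w))%R]
     = (loss theta)%:E)%E }.

Section block_quantities.
Context (R : realType) (S : model R) (K : nat) (D : block_rule S K).
Context (n B : nat).
Implicit Types (theta : Theta S n) (w : Omega D n B).

Definition block_loss k theta w : R :=
  B%:R^-1 * \sum_(b < B) L theta (xi k b w).

Definition block_err k theta w : R := block_loss k theta w - loss theta.

Definition point_err k b theta w : R := L theta (xi k b w) - loss theta.

Definition mean_err theta w : R := K%:R^-1 * \sum_(k < K) block_err k theta w.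

Definition sample_var theta w : R :=
  (K%:R - 1)^-1 * \sum_(k < K) (block_err k theta w - mean_err theta w) ^+ 2.

Definition sigma2 theta : R := fine ('V_(Pr D B theta)[point_err 0 0 theta])%E.

Definition block_var theta : R := fine ('V_(Pr D B theta)[block_err 0 theta])%E.

Definition kappa j theta : R :=
  cumulant (Pr D B theta) j (point_err 0 0 theta).

Definition chi j theta : R := cumulant (Pr D B theta) j (block_err 0 theta).

Definition weight_u theta : R :=
  fine ('E_(Pr D B theta)
    [(fun w => expR (- beta S n * mean_err theta w))%R])%E.

Definition weight_w theta : R :=
  fine ('E_(Pr D B theta)
    [(fun w => expR (- beta S n * mean_err theta w)
               * bessel_factor (beta S n) (sample_var theta w) K)%R])%E.

Definition uncorrected : Theta S n -> R := reweighted weight_u.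

Definition corrected : Theta S n -> R := reweighted weight_w.

End block_quantities.

Section assumptions.
Context (R : realType) (S : model R) (K : nat) (D : block_rule S K).

(* Only within a block: independence across blocks is part of block_rule. *)
Definition MC_blocks : Prop :=
  forall n B (theta : Theta S n) (k : nat), (0 < B)%N -> (k < K)%N ->
    mutually_independent (Pr D B theta) B (fun b => @xi R S K D n B k b) /\
    forall (b : nat) (A : set (Input S n)), (b < B)%N -> measurable A ->
      Pr D B theta (@xi R S K D n B k b @^-1` A) = inputP S n A.

(* Y is the error whose standardization Y / sd(Y) has the cgf varphi. Finiteness
   of its variance, implicit in the standardization, has to be required as fine
   sends an infinite variance to 0. *)
Definition uniform_analytic_cgf_on (O : forall n, set (Theta S n))
    (Y : forall n B, Theta S n -> Omega D n B -> R) : Prop :=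
  (forall n, measurable (O n) /\ post S n (O n) = 1%E) /\
  exists (eta C : R), 0 < eta /\
    forall n B (theta : Theta S n), (0 < B)%N -> O n theta ->
      ('V_(Pr D B theta)[Y n B theta] < +oo)%E /\
      (block_var D B theta != 0 ->
       cgf_extends_bounded (Pr D B theta)
         (fun w => Y n B theta w /
            Num.sqrt (fine ('V_(Pr D B theta)[Y n B theta])%E))
         eta C).

Definition MC_cgf_assumption : Prop :=
  exists O : forall n, set (Theta S n),
    uniform_analytic_cgf_on O (fun n B => @point_err R S K D n B 0 0) /\
    exists Csigma : R, forall n B (theta : Theta S n), (0 < B)%N ->
      O n theta -> Num.sqrt (sigma2 D B theta) <= Csigma.

Definition RQ_cgf_assumption : Prop :=
  exists O : forall n, set (Theta S n),
    uniform_analytic_cgf_on O (fun n B => @block_err R S K D n B 0).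

End assumptions.

Definition order_n (R : realType) (b : nat -> R) : Prop :=
  exists c C : R, 0 < c <= C /\
    forall n : nat, (0 < n)%N -> c * n%:R <= b n <= C * n%:R.

Definition delta_RQ (R : realType) (alpha : R) (d : nat) (b : R) (M : nat) : R :=
  b ^+ 2 * M%:R `^ (- alpha) * ln (2 + M%:R) ^+ d.-1.

(* Main.v *)
(** Exponential moments of a standardized error, bounded through the values of
    its cgf at eta and -eta, give Taylor expansions of its complex mgf that are
    uniform in the state.  The Bessel factor F_beta(s^2, K) is the average of
    cos(beta/sqrt K * sum_k u_k X_k) over the unit sphere of the hyperplane
    sum_k u_k = 0, so the corrected weight is the average over that sphere of
    the real part of prod_k E exp(zeta_k X_k), with
    zeta_k = - (beta/K) (1 - i sqrt K u_k).  Since sum_k zeta_k^2 = 0 the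
    variance drops out, and the cubes leave the third cumulant as main term.
    Both weights are thus 1 + main term + error, uniformly in the state; and a
    reweighting by 1 + a moves a density by E|a - E a| / 2 in total variation, up
    to a quadratic error. *)

(* The corrected target must be expanded under [beta^3 / M^2 -> 0] alone, where [beta^2 / M] may
   diverge, so the variance is not a small perturbation. Each factor [E exp(z_k Y)] is therefore
   multiplied by [exp(- E Y^2 z_k^2 / 2)]: these Gaussian factors have product 1, and the corrected
   factor differs from 1 only at third order. Both block rules fit one scheme: a block error is [s]
   times a sum of [N] independent copies of a standardized [Y], with [N = B], [s = sigma / B] for
   MC-blocks and [N = 1], [s = sqrt v_B] for RQ-blocks. With [q = beta s / K], every error is
   controlled by the quantities [N q^j]. No surface measure appears. The Bessel series is the cosine
   series integrated term by term, so only even moments of linear forms on the sphere matter, and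
   these come by induction on [K] from polar angles. Cumulants are iterated derivatives, whose
   measurability in [theta] is not evident. They are replaced by third moments on a set of full
   posterior mass, and integrals of functions not known to be measurable are compared through that
   set. *)
Require Import Defs.
From HB Require Import structures.
From mathcomp Require Import all_boot all_order all_algebra.
From mathcomp Require Import complex.
From mathcomp Require Import all_classical all_reals all_analysis.
From mathcomp Require Import measurable_realfun ess_sup_inf.
From mathcomp Require Import ring lra.
Import Order.TTheory GRing.Theory Num.Theory.
Import numFieldNormedType.Exports.
Local Open Scope classical_set_scope.
Local Open Scope ring_scope.
Set Implicit Arguments.
Unset Strict Implicit.
Unset Printing Implicit Defensive.

(** * Complex exponential *)

Section exp_series.
Context {R : realType}.
Implicit Types (x s l : R) (u : R ^nat).

Lemma exp_partial_le s n : 0 <= s -> \sum_(0 <= k < n) s ^+ k / k`!%:R <= expR s.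
Proof.
move=> s0; apply: (@nondecreasing_cvgn_le _ (series (exp_coeff s))).
  apply/nondecreasing_seqP => k; rewrite /series /= big_nat_recr//= lerDl.
  by rewrite divr_ge0 ?exprn_ge0.
exact: is_cvg_series_exp_coeff.
Qed.

Lemma exprn_le_exp s n : 0 <= s -> s ^+ n <= n`!%:R * expR s.
Proof.
move=> s0; rewrite mulrC -ler_pdivrMr ?ltr0n ?fact_gt0//.
apply: le_trans (exp_partial_le n.+1 s0).
rewrite big_nat_recr//= lerDr sumr_ge0// => i _.
by rewrite divr_ge0 ?exprn_ge0.
Qed.

(** Since [n! k! <= (n + k)!], the tail of the exponential series from index [n] is at most
    [s^n / n!] times the whole series. Domination of the coefficients makes this serve exp, cos and
    sin alike. *)
Lemma exp_tail_le u l s n : 0 <= s -> (forall k, `|u k| <= s ^+ k / k`!%:R) ->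
  series u @ \oo --> l ->
  `|l - \sum_(0 <= k < n) u k| <= s ^+ n / n`!%:R * expR s.
Proof.
move=> s0 us ul.
have ulN : (fun N => `|series u N - \sum_(0 <= k < n) u k|) @ \oo -->
    `|l - \sum_(0 <= k < n) u k|.
  by apply: cvg_norm; apply: cvgB => //; exact: cvg_cst.
rewrite -(cvg_lim (@Rhausdorff R) ulN).
apply: limr_le; first by apply/cvg_ex; eexists; exact: ulN.
near=> N.
have nN : (n <= N)%N by near: N; exact: nbhs_infty_ge.
rewrite /series/= (big_cat_nat (leq0n n) nN)//= [X in X - _]addrC addrK.
rewrite (le_trans (ler_norm_sum _ _ _))//.
have sn : 0 <= s ^+ n / n`!%:R by rewrite divr_ge0 ?exprn_ge0.
apply: le_trans (ler_wpM2l sn (exp_partial_le (N - n) s0)).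
rewrite mulr_sumr -{1}[n]add0n big_addn; apply: ler_sum => k _.
apply: (le_trans (us _)); rewrite mulrACA -exprD addnC -invfM -natrM.
apply: ler_wpM2l; first by rewrite exprn_ge0.
rewrite lef_pV2 ?posrE ?ltr0n ?muln_gt0 ?fact_gt0// ler_nat.
by rewrite -(bin_fact (leq_addr k n)) addKn leq_pmull// bin_gt0 leq_addr.
Unshelve. all: by end_near. Qed.

Lemma exp_tail_drop_fact x n : `|x| ^+ n / n`!%:R * expR `|x| <= `|x| ^+ n * expR `|x|.
Proof.
by rewrite ler_wpM2r ?expR_ge0// ler_piMr ?exprn_ge0// invf_le1 ?ltr0n ?ler1n fact_gt0.
Qed.

Lemma expR_tail x n :
  `|expR x - \sum_(0 <= k < n) x ^+ k / k`!%:R| <= `|x| ^+ n * expR `|x|.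
Proof.
apply: le_trans (exp_tail_drop_fact _ _).
apply: exp_tail_le => //; first by move=> k; rewrite normrM normrX normfV normr_nat.
exact: is_cvg_series_exp_coeff.
Qed.

(** The factorial is kept here: [sphere_average_cos] needs a bound that tends to 0 with [n] for
    every fixed argument. *)
Lemma cos_tail x n :
  `|cos x - \sum_(0 <= k < n) cos_coeff x k| <= `|x| ^+ n / n`!%:R * expR `|x|.
Proof.
apply: exp_tail_le => //; last by rewrite unlock; exact: is_cvg_series_cos_coeff.
move=> k; rewrite /cos_coeff /= !normrM !normrX normfV normrN1 !normr_nat expr1n.
by case: odd; rewrite ?mul0r ?mulr1 ?mul1r// divr_ge0 ?exprn_ge0.
Qed.

Lemma sin_tail x n :
  `|sin x - \sum_(0 <= k < n) sin_coeff x k| <= `|x| ^+ n * expR `|x|.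
Proof.
apply: le_trans (exp_tail_drop_fact _ _).
apply: exp_tail_le => //; last by rewrite unlock; exact: is_cvg_series_sin_coeff.
move=> k; rewrite /sin_coeff /= !normrM !normrX normfV normrN1 !normr_nat expr1n.
by case: odd; rewrite ?mul0r ?mulr1 ?mul1r// divr_ge0 ?exprn_ge0.
Qed.

End exp_series.

Section complex_l1_norm.
Context {R : realType}.
Implicit Types z w : R[i].

(* Any submultiplicative real-valued norm would do; this one is the easiest to
   integrate coordinatewise. *)
Definition n1 z : R := `|complex.Re z| + `|complex.Im z|.

Lemma n1_ge0 z : 0 <= n1 z. Proof. exact: addr_ge0. Qed.

Lemma n1D z w : n1 (z + w) <= n1 z + n1 w.
Proof.
case: z w => [a b] [c d]; rewrite /n1/= addrACA.
by rewrite lerD// ler_normD.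
Qed.

Lemma n1N z : n1 (- z) = n1 z.
Proof. by case: z => a b; rewrite /n1/= !normrN. Qed.

Lemma n1M z w : n1 (z * w) <= n1 z * n1 w.
Proof.
case: z w => [a b] [c d]; rewrite /n1/= mulrDl !mulrDr -!normrM.
have := ler_normB (a * c) (b * d); have := ler_normD (a * d) (b * c); lra.
Qed.

Lemma n1_real (x : R) : n1 x%:C%C = `|x|.
Proof. by rewrite /n1/= normr0 addr0. Qed.

Lemma n1_0 : n1 0 = 0. Proof. by rewrite /n1/= normr0 addr0. Qed.

Lemma n1_1 : n1 1 = 1. Proof. by rewrite /n1/= normr1 normr0 addr0. Qed.

Lemma Re_le_n1 z : `|complex.Re z| <= n1 z. Proof. by rewrite lerDl. Qed.

Lemma n1_sum (I : Type) (s : seq I) (F : I -> R[i]) :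
  n1 (\sum_(i <- s) F i) <= \sum_(i <- s) n1 (F i).
Proof.
elim/big_rec2 : _ => [|i y z _ h]; first by rewrite n1_0.
by rewrite (le_trans (n1D _ _))// lerD2l.
Qed.

Lemma n1X z n : n1 (z ^+ n) <= n1 z ^+ n.
Proof.
elim: n => [|n ih]; first by rewrite !expr0 n1_1.
by rewrite !exprS (le_trans (n1M _ _))// ler_wpM2l ?n1_ge0.
Qed.

(** Both remainders are polynomials in the [r i] with nonnegative coefficients, hence dominated by
    the same polynomials in the norms. The second inequality feeds the induction for the first. *)
Lemma n1_prod1D_sub (I : Type) (s : seq I) (r : I -> R[i]) :
  n1 (\prod_(i <- s) (1 + r i) - 1 - \sum_(i <- s) r i) <=
  \prod_(i <- s) (1 + n1 (r i)) - 1 - \sum_(i <- s) n1 (r i) /\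
  n1 (\prod_(i <- s) (1 + r i) - 1) <= \prod_(i <- s) (1 + n1 (r i)) - 1.
Proof.
elim: s => [|i s [ih1 ih2]]; first by rewrite !big_nil subrr subr0 n1_0 subrr subr0.
rewrite !big_cons; set P := \prod_(j <- s) _ in ih1 ih2 *.
set Q := \prod_(j <- s) _ in ih1 ih2 *.
set S := \sum_(j <- s) r j in ih1 *; set T := \sum_(j <- s) _ in ih1 *.
have h := le_trans (n1M (r i) (P - 1)) (ler_wpM2l (n1_ge0 _) ih2).
split.
  have -> : (1 + r i) * P - 1 - (r i + S) = (P - 1 - S) + r i * (P - 1) by ring.
  by rewrite (le_trans (n1D _ _))//; move: ih1 h; lra.
have -> : (1 + r i) * P - 1 = (P - 1) + (r i + r i * (P - 1)) by ring.
rewrite (le_trans (n1D _ _))//; have := n1D (r i) (r i * (P - 1)); move: ih2 h; lra.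
Qed.

(** The powers are absorbed by viewing the whole as one product over [K * N] indices. The product of
    the [1 + n1 (r k)] is at most [exp s] with [s] their total, and [exp s - 1 - s <= s^2 exp s]. *)
Lemma n1_prodX_expand (K N : nat) (r : 'I_K -> R[i]) (a : R) :
  N%:R * \sum_(k < K) n1 (r k) <= a ->
  n1 (\prod_(k < K) (1 + r k) ^+ N - 1 - N%:R * \sum_(k < K) r k) <=
  a ^+ 2 * expR a.
Proof.
move=> ra.
have sumE (V : nmodType) (F : 'I_K -> V) :
    \sum_(p : 'I_K * 'I_N) F p.1 = (\sum_(k < K) F k) *+ N.
  rewrite -(pair_bigA _ (fun k (_ : 'I_N) => F k))/=.
  by rewrite -sumrMnl; apply: eq_bigr => k _; rewrite sumr_const card_ord.
have -> : \prod_(k < K) (1 + r k) ^+ N = \prod_(p : 'I_K * 'I_N) (1 + r p.1).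
  rewrite -(pair_bigA _ (fun k (_ : 'I_N) => 1 + r k))/=.
  by apply: eq_bigr => k _; rewrite prodr_const card_ord.
rewrite mulr_natl -(sumE _ r).
have [h _] := n1_prod1D_sub (index_enum ('I_K * 'I_N)%type) (fun p => r p.1).
apply: (le_trans h); rewrite (sumE _ (fun k => n1 (r k))) -mulr_natl.
set s := N%:R * _ in ra *.
have s0 : 0 <= s by rewrite mulr_ge0 ?sumr_ge0// => k _; exact: n1_ge0.
have : \prod_(p : 'I_K * 'I_N) (1 + n1 (r p.1)) <= expR s.
  rewrite /s mulr_natl -(sumE _ (fun k => n1 (r k))) expR_sum; apply: ler_prod => p _.
  by rewrite expR_ge1Dx addr_ge0 ?n1_ge0.
have := le_trans (ler_norm _) (expR_tail s 2).
rewrite !big_nat_recr//= big_nil ger0_norm// factS fact0 add0r expr0 expr1.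
have : s ^+ 2 * expR s <= a ^+ 2 * expR a.
  by rewrite ler_pM ?exprn_ge0 ?expR_ge0 ?ler_expR// lerXn2r ?nnegrE// (le_trans s0).
by rewrite !divr1; lra.
Qed.

Definition cexp z : R[i] :=
  ((expR (complex.Re z))%:C * (cos (complex.Im z) +i* sin (complex.Im z)))%C.

Lemma cexpE (a b : R) :
  cexp (a +i* b)%C = (expR a * cos b +i* (expR a * sin b))%C.
Proof. by rewrite /cexp/=; simpc. Qed.

Lemma cexpD z w : cexp (z + w) = cexp z * cexp w.
Proof.
case: z w => [a b] [c d]; rewrite (_ : _ + _ = (a + c) +i* (b + d))%C//.
rewrite !cexpE expRD cosD sinD; simpc; congr (_ +i* _)%C; ring.
Qed.

Lemma cexp0 : cexp 0 = 1.
Proof. by rewrite (cexpE 0 0) expR0 cos0 sin0 mulr1 mulr0. Qed.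

Lemma cexp_sum (I : Type) (s : seq I) (F : I -> R[i]) :
  cexp (\sum_(i <- s) F i) = \prod_(i <- s) cexp (F i).
Proof. by elim/big_rec2 : _ => [|i y z _ <-]; rewrite ?cexp0 ?cexpD. Qed.

Lemma n1_cexp_le z : n1 (cexp z) <= 2 * expR (complex.Re z).
Proof.
case: z => [a b]; rewrite cexpE /n1/= !normrM (ger0_norm (expR_ge0 _)).
have := cos_max b; have := sin_max b; have := expR_ge0 a; nra.
Qed.

(** Multiplies the real expansions of [exp a] and of [cos b], [sin b]. Each tail is at most
    [s^4 exp s] and is multiplied by a factor at most [exp s], whence the rate [2 * n1 z]. Real and
    imaginary part cost 3 units each, so 10 is generous. *)
Lemma cexp_taylor z :
  n1 (cexp z - (1 + z + z ^+ 2 / 2 + z ^+ 3 / 6)) <=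
  10 * n1 z ^+ 4 * expR (2 * n1 z).
Proof.
case: z => a b; rewrite cexpE; set z := (a +i* b)%C.
set s := n1 z.
have sE : s = `|a| + `|b| by [].
have s0 : 0 <= s by rewrite sE addr_ge0.
have [xs ys] : `|a| <= s /\ `|b| <= s by rewrite sE lerDl lerDr.
have mon i j : `|a ^+ i * b ^+ j| <= s ^+ (i + j).
  by rewrite normrM !normrX exprD ler_pM ?exprn_ge0// lerXn2r// nnegrE.
set G := expR s.
have G1 : 1 + s + s ^+ 2 / 2 + s ^+ 3 / 6 <= G.
  have := exp_partial_le 4 s0; rewrite !big_nat_recr//= big_nil !factS fact0.
  by rewrite !mul1n !muln1 add0r expr0 expr1 !divr1.
have s20 := exprn_ge0 2 s0; have s30 := exprn_ge0 3 s0.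
have s40 := exprn_ge0 4 s0.
set T := s ^+ 4 * G.
have tl (f x : R) : `|x| <= s -> `|f| <= `|x| ^+ 4 * expR `|x| -> `|f| <= T.
  move=> xs' /le_trans; apply; rewrite ler_pM ?exprn_ge0 ?expR_ge0 ?ler_expR//.
  by rewrite lerXn2r// nnegrE.
pose p := 1 + a + a ^+ 2 / 2 + a ^+ 3 / 6.
pose c := 1 - b ^+ 2 / 2; pose d := b - b ^+ 3 / 6.
have eP : `|expR a - p| <= T.
  apply: (tl _ a) => //; have := expR_tail a 4.
  rewrite !big_nat_recr//= big_nil !factS fact0 !mul1n !muln1.
  by rewrite add0r expr0 expr1 !divr1.
have eC : `|cos b - c| <= T.
  apply: (tl _ b) => //; have := le_trans (cos_tail b 4) (exp_tail_drop_fact b 4).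
  rewrite !big_nat_recr//= big_nil /cos_coeff /= !factS fact0 !mul1n.
  by congr (`|_ - _| <= _); rewrite /c; field.
have eS : `|sin b - d| <= T.
  apply: (tl _ b) => //; have := sin_tail b 4.
  rewrite !big_nat_recr//= big_nil /sin_coeff /= !factS fact0 !mul1n.
  by congr (`|_ - _| <= _); rewrite /d; field.
have eE : `|expR a| <= G.
  by rewrite ger0_norm ?expR_ge0// ler_expR (le_trans (ler_norm _)).
have G0 : 0 <= G by exact: expR_ge0.
have T0 : 0 <= T by exact: mulr_ge0.
have cG : `|c| <= G.
  by have := mon 0%N 2%N; rewrite /c !expr0 mul1r => /ler_normlP[]; rewrite ler_norml; lra.
have dG : `|d| <= G.
  have := mon 0%N 3%N; rewrite /d !expr0 mul1r => /ler_normlP[].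
  by move: ys => /ler_normlP[]; rewrite ler_norml; lra.
have prod (u v U V : R) : `|u| <= U -> `|v| <= V -> `|u * v| <= U * V.
  by move=> uU vV; rewrite normrM ler_pM.
have TG1 : s ^+ 4 <= T by rewrite /T ler_peMr//; lra.
have TG2 : s ^+ 5 / 2 <= T.
  rewrite (_ : _ / 2 = s ^+ 4 * (s / 2)); last by field.
  by rewrite /T ler_wpM2l//; lra.
have TG3 : s ^+ 6 / 2 <= T.
  rewrite (_ : _ / 2 = s ^+ 4 * (s ^+ 2 / 2)); last by field.
  by rewrite /T ler_wpM2l//; lra.
(* The product of the two Taylor polynomials is the cubic part of the complex series plus monomials
   of degree 4 to 6, each absorbed by [T] through [TG1], [TG2], [TG3]. *)
have re : `|expR a * cos b - (1 + a + (a ^+ 2 - b ^+ 2) / 2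
      + (a ^+ 3 - 3 * a * b ^+ 2) / 6)| <= 3 * (T * G).
  rewrite (_ : _ - _ = expR a * (cos b - c) + (expR a - p) * c +
    (- (a ^+ 2 * b ^+ 2) / 4 - (a ^+ 3 * b ^+ 2) / 12)); last first.
    by rewrite /p /c; field.
  have := prod _ _ _ _ eE eC; have := prod _ _ _ _ eP cG.
  have := mon 2%N 2%N; have := mon 3%N 2%N.
  have : T <= T * G by rewrite ler_peMr//; lra.
  by rewrite !ler_norml; lra.
have im : `|expR a * sin b - (b + a * b + (3 * a ^+ 2 * b - b ^+ 3) / 6)| <= 3 * (T * G).
  rewrite (_ : _ - _ = expR a * (sin b - d) + (expR a - p) * d +
    (a ^+ 3 * b ^+ 1 / 6 - (a ^+ 1 * b ^+ 3) / 6 - (a ^+ 2 * b ^+ 3) / 12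
      - (a ^+ 3 * b ^+ 3) / 36)); last first.
    by rewrite /p /d; field.
  have := prod _ _ _ _ eE eS; have := prod _ _ _ _ eP dG.
  have := mon 3%N 1%N; have := mon 1%N 3%N; have := mon 2%N 3%N; have := mon 3%N 3%N.
  have : T <= T * G by rewrite ler_peMr//; lra.
  by rewrite !ler_norml; lra.
rewrite expRM_natl.
have -> : 10 * s ^+ 4 * G ^+ 2 = 10 * (T * G) by rewrite /T; ring.
have TG0 : 0 <= T * G by exact: mulr_ge0.
have -> : (expR a * cos b +i* (expR a * sin b))%C -
   (1 + z + z ^+ 2 / 2 + z ^+ 3 / 6) =
  ((expR a * cos b - (1 + a + (a ^+ 2 - b ^+ 2) / 2
      + (a ^+ 3 - 3 * a * b ^+ 2) / 6)) +i*
   (expR a * sin b - (b + a * b + (3 * a ^+ 2 * b - b ^+ 3) / 6)))%C.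
  have half : (2 : R[i])^-1 = (2^-1 : R)%:C%C by rewrite fmorphV rmorph_nat.
  have sixth : (6 : R[i])^-1 = (6^-1 : R)%:C%C by rewrite fmorphV rmorph_nat.
  rewrite half sixth /z !exprS !expr0 !mulr1; simpc.
  by congr (_ +i* _)%C; field.
by move: re im; rewrite /n1/=; lra.
Qed.

End complex_l1_norm.

(** * Gamma function *)

Lemma integrable_scale d (T : measurableType d) (R : realType)
    (mu : {measure set T -> \bar R}) (D : set T) (f : T -> R) (r : R) :
  measurable D -> mu.-integrable D (EFin \o f) ->
  mu.-integrable D (EFin \o (fun x => r * f x)).
Proof. by move=> mD; exact: integrableZl. Qed.

Section gamma.
Context {R : realType}.
Implicit Types x t a b : R.
Notation mu := (@lebesgue_measure R).

Let gint x t : R := t `^ (x - 1) * expR (- t).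

Let gint_ge0 x t : 0 <= gint x t.
Proof. by rewrite mulr_ge0 ?powR_ge0 ?expR_ge0. Qed.

Let measurable_gint x D : measurable_fun D (gint x).
Proof.
apply: measurable_funS (measurableT) (@subsetT _ D) _.
apply: measurable_funM; first exact: measurable_powR.
by apply: measurableT_comp => //; exact: measurable_funN.
Qed.

Let eGamma x : \bar R := (\int[mu]_(t in `]0%R, +oo[) (gint x t)%:E)%E.

Let eGamma_ge0 x : (0 <= eGamma x)%E.
Proof. by apply: integral_ge0 => t _; rewrite lee_fin. Qed.

Let is_derive_gint x t : 0 < t ->
  is_derive t 1 (gint (x + 1)) (x * gint x t - gint (x + 1) t).
Proof.
move=> t0; rewrite /gint addrK.
have h1 := is_derive1_powR x t0.
have h2 : is_derive t 1 (fun t => expR (- t)) (- expR (- t)).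
  have hN : is_derive t 1 (fun t : R => - t) (-1) by apply: is_deriveN.
  have := @is_derive1_comp R expR (fun t => - t) t _ _ (is_derive_expR _) hN.
  by rewrite mulrN1.
have h := is_deriveM h1 h2.
apply: is_derive_eq; rewrite /GRing.scale/=; ring.
Qed.

Let cont_gint x a b : 0 < a -> {within `[a, b], continuous (gint x)}.
Proof.
move=> a0; apply: derivable_within_continuous => t; rewrite in_itv/= => /andP[at_ _].
have := is_derive_gint (x - 1) (lt_le_trans a0 at_); rewrite subrK => h.
exact: ex_derive.
Qed.

Let I x a b := \int[mu]_(t in `[a, b]) gint x t.

Let integrable_gint x a b : 0 < a ->
  mu.-integrable `[a, b] (EFin \o gint x).
Proof.
by move=> a0; apply: continuous_compact_integrable; [exact: segment_compact|exact: cont_gint].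
Qed.

(** Integration by parts on a compact interval away from 0, where the integrand is smooth; the
    recurrence of Gamma is its limit. *)
Let gammaD1_itv x a b : 0 < a -> a < b ->
  I (x + 1) a b = x * I x a b - (gint (x + 1) b - gint (x + 1) a).
Proof.
move=> a0 ab.
have d t : 0 < t -> derivable (gint (x + 1)) t 1.
  by move=> t0; have h := is_derive_gint x t0; exact: ex_derive.
have c t : 0 < t -> gint (x + 1) s @[s --> t] --> gint (x + 1) t.
  by move=> /d/derivable1_diffP/differentiable_continuous.
have := @continuous_FTC2 R (fun t => x * gint x t - gint (x + 1) t)
  (gint (x + 1)) a b ab.
have iZ : mu.-integrable `[a, b] (EFin \o (fun t => x * gint x t)).
  by apply: integrable_scale => //; exact: integrable_gint.
have iG y : mu.-integrable `[a, b] (EFin \o gint y) by exact: integrable_gint.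
have -> : (\int[mu]_(t in `[a, b]) (x * gint x t - gint (x + 1) t)%:E)%E =
    (x * I x a b - I (x + 1) a b)%:E.
  rewrite /I -RintegralZl// -RintegralB//.
  rewrite /Rintegral fineK// integrable_fin_num//.
  exact: (integrableB _ iZ (iG _)).
rewrite -EFinB => h; have [<-] : (x * I x a b - I (x + 1) a b)%:E = (gint (x + 1) b - gint (x + 1) a)%:E.
  apply: h.
  - move=> t; apply: cvgB; last exact: cont_gint.
    by apply: cvgMr; exact: cont_gint.
  - split.
    + by move=> t; rewrite in_itv/= => /andP[at_ _]; apply: d; exact: lt_trans at_.
    + exact/cvg_at_right_filter/c.
    + exact/cvg_at_left_filter/c/(lt_trans a0).
  - move=> t; rewrite in_itv/= => /andP[at_ _].
    by have h' := is_derive_gint x (lt_trans a0 at_); rewrite derive1E derive_val.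
by rewrite subKr.
Qed.

Let an n : R := n.+1%:R^-1.
(** With [n + 2] instead of [n + 1] the interval from [an n] to [bn n] is nondegenerate for [n = 0]
    as well. *)
Let bn n : R := n.+2%:R.

Let eGamma_cvg x : (fun n => (I x (an n) (bn n))%:E) @ \oo --> eGamma x.
Proof.
have U : [set` `]0%R, +oo[] = \bigcup_n [set` `[an n, bn n]] :> set R.
  apply/seteqP; split => t /=.
    rewrite in_itv/= andbT => t0.
    exists (maxn (Num.trunc t^-1) (Num.trunc t)) => //=.
    rewrite in_itv/=; apply/andP; split.
      rewrite /an invf_ple ?posrE ?ltr0n//; apply: (le_trans (ltW (truncnS_gt _))).
      by rewrite ler_nat ltnS leq_maxl.
    apply: (le_trans (ltW (truncnS_gt _))).
    rewrite /bn ler_nat ltnS; apply: leq_trans (leqnSn _); exact: leq_maxr.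
  move=> [n _ /=]; rewrite !in_itv/= andbT => /andP[+ _].
  by apply: lt_le_trans; rewrite invr_gt0 ltr0n.
rewrite /eGamma U.
have an0 n : 0 < an n by rewrite invr_gt0 ltr0n.
have -> : (fun n => (I x (an n) (bn n))%:E) =
    (fun n => \int[mu]_(t in `[an n, bn n]) (gint x t)%:E)%E.
  by apply/funext => n; rewrite /I /Rintegral fineK// integrable_fin_num//; exact: integrable_gint.
apply: ge0_nondecreasing_set_cvg_integral => //.
- move=> m n mn; rewrite subsetEset => t /=; rewrite !in_itv/= => /andP[mt tm].
  apply/andP; split; last by rewrite (le_trans tm)// ler_nat.
  by apply: le_trans mt; rewrite lef_pV2 ?posrE ?ltr0n// ler_nat.
- by move=> n; apply/measurable_EFinP; exact: measurable_gint.
- by move=> n t _; rewrite lee_fin.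
Qed.

Let bdry_cvg x : 0 < x ->
  (fun n => gint (x + 1) (bn n) - gint (x + 1) (an n)) @ \oo --> (0 : R).
Proof.
move=> x0; rewrite -[X in _ --> X](subrr (0 : R)); apply: cvgB.
  (* [N] exceeds [x], so [t^x <= t^N] for [t >= 1]; the bound [t^(N+1) <= (N+1)! exp t] then leaves
     a spare factor [1 / t], comparable with the harmonic sequence. *)
  pose N := (Num.trunc x).+1.
  apply: (@squeeze_cvgr _ _ _ _ (fun=> 0) (fun n => (N.+1)`!%:R * harmonic n)).
  - near=> n; rewrite gint_ge0/= /gint addrK.
    have b0 : 0 < bn n by rewrite ltr0n.
    have b1 : 1 <= bn n by rewrite ler1n.
    apply: (@le_trans _ _ (bn n ^+ N * expR (- bn n))).
      apply: ler_wpM2r; first exact: expR_ge0.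
      rewrite -(powR_mulrn N (ltW b0)); apply: (ler_powR b1).
      exact/ltW/truncnS_gt.
    rewrite expRN ler_pdivrMr ?expR_gt0// -mulrA.
    apply: (@le_trans _ _ (N.+1`!%:R * expR (bn n) / bn n)).
      by rewrite ler_pdivlMr// -exprSr exprn_le_exp// ltW.
    rewrite -mulrA ler_wpM2l//; rewrite mulrC ler_wpM2r ?expR_ge0//.
    by rewrite /harmonic/= lef_pV2 ?posrE ?ltr0n// ler_nat.
  - exact: cvg_cst.
  - rewrite -[X in _ --> X](mulr0 (N.+1`!%:R : R)); apply: cvgMr; exact: cvg_harmonic.
have h : (fun n => an n `^ x) @ \oo --> (0 : R).
  apply: cvg_comp (powR_cvg0 x0) => A; rewrite /at_right/= /within/= => /(@cvg_harmonic R _).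
  move=> h.
  have {}h : nbhs \oo (fun n : nat => 0 < an n -> A (an n)) := h.
  by apply: filterS h => n; apply; rewrite invr_gt0 ltr0n.
apply: (@squeeze_cvgr _ _ _ _ (fun=> 0) (fun n => an n `^ x)) => //; last exact: cvg_cst.
near=> n; rewrite gint_ge0/= /gint addrK ler_piMr ?powR_ge0//.
by rewrite -expR0 ler_expR oppr_le0 invr_ge0.
Unshelve. all: by end_near. Qed.

(** Proved in the extended reals, before the integrals are known to be finite, because finiteness is
    deduced from it. *)
Let eGammaD1 x : 0 < x -> eGamma (x + 1) = (x%:E * eGamma x)%E.
Proof.
move=> x0; rewrite -(cvg_lim (@ereal_hausdorff R) (@eGamma_cvg (x + 1))).
apply: cvg_lim; first exact: ereal_hausdorff.
have anbn n : an n < bn n.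
  by rewrite (@le_lt_trans _ _ 1)// ?ltr1n// invf_le1 ?ltr0n// ler1n.
have -> : (fun n => (I (x + 1) (an n) (bn n))%:E) =
    (fun n => x%:E * (I x (an n) (bn n))%:E +
      (- (gint (x + 1) (bn n) - gint (x + 1) (an n)))%:E)%E.
  apply/funext => n; rewrite gammaD1_itv// ?EFinB//; last by rewrite invr_gt0 ltr0n.
rewrite -[X in _ --> X]adde0; apply: cvgeD.
- exact: fin_num_adde_defl.
- by apply: cvgeZl => //; exact: eGamma_cvg.
- apply: cvg_EFin; first exact: nearW.
  by rewrite -[X in _ --> X]oppr0; apply: cvgN; exact: bdry_cvg.
Qed.

Let eGamma1 : eGamma 1 = 1%E.
Proof.
have := @integral_exponential_pdf R 1 ltr01; rewrite /exponential_pdf => <-.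
rewrite /eGamma integral_itv_obnd_cbnd; last by apply/measurable_EFinP; exact: measurable_gint.
rewrite integral_mkcond restrict_EFin; apply: eq_integral => t _ /=.
congr (_%:E); rewrite /patch; case: ifP => //.
rewrite inE/= in_itv/= andbT => t0.
by rewrite /gint subrr mul1r mulN1r; case: ltgtP t0 => // [t0|<-] _; rewrite powRr0 mul1r.
Qed.

(** At positive integers the recurrence propagates finiteness from the value at 1. In general
    [t^x <= 1 + t^N] bounds the integral at [x + 1] by two such values, and the recurrence leads
    back from [x + 1] to [x]. *)
Let eGamma_lty x : 0 < x -> (eGamma x < +oo)%E.
Proof.
move=> x0.
have gnat n : (eGamma n.+1%:R < +oo)%E.
  elim: n => [|n ih]; first by rewrite eGamma1 ltry.
  by rewrite -natr1 eGammaD1// lte_mul_pinfty.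
suff : (eGamma (x + 1) < +oo)%E.
  rewrite eGammaD1//; case: (eGamma x) (eGamma_ge0 x) => [r _ _| |]//=; first exact: ltry.
  by rewrite mulry gtr0_sg// mul1e.
pose N := (Num.trunc x).+1.
apply: (@le_lt_trans _ _ (eGamma 1 + eGamma N.+1%:R)%E); last by rewrite lte_add_pinfty// eGamma1 ltry.
have m (D : set R) y : measurable_fun D (fun t => (gint y t)%:E).
  by apply/measurable_EFinP; exact: measurable_gint.
rewrite /eGamma -ge0_integralD//; try by [move=> t _; rewrite lee_fin]; try exact: m.
apply: ge0_le_integral => //.
- by move=> t _; rewrite lee_fin.
- exact: m.
- by apply: emeasurable_funD; exact: m.
move=> t /=; rewrite in_itv/= andbT => t0.
rewrite lee_fin /gint -mulrDl ler_wpM2r ?expR_ge0// addrK subrr powRr0 -natr1 addrK.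
have [t1|t1] := leP 1 t.
  by rewrite ler_wpDl// ler_powR// ltW// truncnS_gt.
rewrite ler_wpDr ?powR_ge0//.
rewrite -[leRHS](congr1 (@^~ x) (powR1 R)).
rewrite ge0_ler_powR ?nnegrE ?ltW//.
Qed.

(** A vanishing integral would force the positive integrand to vanish almost everywhere, making the
    interval from 0 to 1 null. *)
Let eGamma_gt0 x : (0 < eGamma x)%E.
Proof.
rewrite lt_neqAle eGamma_ge0 andbT eq_sym; apply/eqP => g0.
have := @ae_eq_integral_abs _ _ R mu [set` `]0%R, +oo[] (measurable_itv _) (fun t => (gint x t)%:E).
case; first by apply/measurable_EFinP; exact: measurable_gint.
move=> + _; case.
  by rewrite -[RHS]g0; apply: eq_integral => t _; rewrite gee0_abs// lee_fin.
move=> A [mA A0 sA].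
have : (mu `]0%R, 1%R[ <= 0)%E.
  rewrite -A0; apply: le_measure; rewrite ?inE// => t /=; rewrite in_itv/= => /andP[t0 _].
  apply: sA => /=; rewrite in_itv/= t0 /= => /(_ isT)/eqP; rewrite eqe.
  by rewrite mulf_eq0 !gt_eqF ?expR_gt0 ?powR_gt0.
by rewrite lebesgue_measure_itv/= lte_fin ltr01 oppr0 adde0 lee_fin ler10.
Qed.

Lemma Gamma_gt0 x : 0 < x -> 0 < Gamma x.
Proof. by move=> x0; rewrite /Gamma fine_gt0// eGamma_gt0 eGamma_lty. Qed.

Lemma GammaD1 x : 0 < x -> Gamma (x + 1) = x * Gamma x.
Proof.
move=> x0; have := congr1 fine (eGammaD1 x0).
by rewrite fineM// ge0_fin_numE// eGamma_lty.
Qed.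

Lemma Gamma_natD x m : 0 < x ->
  Gamma (m%:R + x) = \prod_(i < m) (x + i%:R) * Gamma x.
Proof.
move=> x0; elim: m => [|m ih]; first by rewrite big_ord0 mul1r add0r.
rewrite -natr1 addrAC GammaD1; last by rewrite ltr_wpDl.
by rewrite ih big_ord_recr/= mulrA [m%:R + x]addrC [_ * \prod_(i < m) _]mulrC.
Qed.

End gamma.

(** * Spherical averages and the Bessel factor *)

Section bounded_measurable.
Context d (T : measurableType d) (R : realType).
Implicit Types f g : T -> R.

Definition bounded_measurable f :=
  measurable_fun setT f /\ exists M : R, forall x, `|f x| <= M.

Lemma bounded_measurable_cst r : bounded_measurable (fun=> r).
Proof. by split; [exact: measurable_cst|exists `|r|]. Qed.

Lemma bounded_measurableM f g : bounded_measurable f -> bounded_measurable g ->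
  bounded_measurable (fun x => f x * g x).
Proof.
move=> [mf [M fM]] [mg [N gN]]; split; first exact: measurable_funM.
by exists (M * N) => x; rewrite normrM ler_pM.
Qed.

Lemma bounded_measurableD f g : bounded_measurable f -> bounded_measurable g ->
  bounded_measurable (fun x => f x + g x).
Proof.
move=> [mf [M fM]] [mg [N gN]]; split; first exact: measurable_funD.
by exists (M + N) => x; rewrite (le_trans (ler_normD _ _))// lerD.
Qed.

Lemma bounded_measurableB f g : bounded_measurable f -> bounded_measurable g ->
  bounded_measurable (fun x => f x - g x).
Proof.
move=> [mf [M fM]] [mg [N gN]]; split; first exact: measurable_funB.
by exists (M + N) => x; rewrite (le_trans (ler_normB _ _))// lerD.
Qed.

Lemma bounded_measurable_norm f : bounded_measurable f ->
  bounded_measurable (fun x => `|f x|).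
Proof.
move=> [mf [M fM]]; split; first exact: measurableT_comp.
by exists M => x; rewrite normr_id.
Qed.

Lemma bounded_measurableX f n : bounded_measurable f ->
  bounded_measurable (fun x => f x ^+ n).
Proof.
move=> [mf [M fM]]; split; first exact: measurable_funX.
by exists (M ^+ n) => x; rewrite normrX lerXn2r// nnegrE// (le_trans _ (fM x)).
Qed.

Lemma bounded_measurable_sum (I : Type) (s : seq I) (h : I -> T -> R) :
  (forall i, bounded_measurable (h i)) ->
  bounded_measurable (fun x => \sum_(i <- s) h i x).
Proof.
move=> hh; elim: s => [|i s ih].
  under eq_fun do rewrite big_nil; exact: bounded_measurable_cst.
by under eq_fun do rewrite big_cons; exact: bounded_measurableD.
Qed.

Lemma bounded_measurable_integrable (mu : {finite_measure set T -> \bar R}) f :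
  bounded_measurable f -> mu.-integrable setT (EFin \o f).
Proof.
move=> [mf [M fM]]; apply: measurable_bounded_integrable => //.
  by rewrite ltey_eq fin_num_measure.
exists M; split; first by rewrite num_real.
by move=> x Mx y _ /=; exact: le_trans (fM y) (ltW Mx).
Qed.

End bounded_measurable.

Lemma bounded_measurable_comp d d' (T : measurableType d) (T' : measurableType d')
    (R : realType) (h : T -> T') (f : T' -> R) :
  measurable_fun setT h -> bounded_measurable f ->
  bounded_measurable (fun x => f (h x)).
Proof.
by move=> mh [mf [M fM]]; split; [exact: measurableT_comp|exists M => x].
Qed.

Section Rintegral_facts.
Context d (T : measurableType d) (R : realType) (mu : {measure set T -> \bar R}).

Lemma Rintegral_sum (I : Type) (s : seq I) (h : I -> T -> R) :
  (forall i, mu.-integrable setT (EFin \o h i)) ->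
  \int[mu]_x (\sum_(i <- s) h i x) = \sum_(i <- s) \int[mu]_x h i x.
Proof.
move=> hh; have hs (t : seq I) :
    mu.-integrable setT (EFin \o (fun x => \sum_(i <- t) h i x)).
  under [EFin \o _]eq_fun do rewrite /= -sumEFin.
  by apply: integrable_sum => // i _; exact: hh.
elim: s => [|i s ih].
  under eq_Rintegral do rewrite big_nil.
  by rewrite /Rintegral integral0 big_nil.
under eq_Rintegral do rewrite big_cons.
by rewrite RintegralD// ih big_cons.
Qed.

End Rintegral_facts.

Section Rintegral_product.
Context d1 d2 (T1 : measurableType d1) (T2 : measurableType d2) (R : realType).
Variables (m1 : subprobability T1 R) (m2 : subprobability T2 R).

(** Subprobabilities are the class of measures carried through the induction on [K] in
    [sphere_average_step]. *)
Lemma Rintegral_product (f : T1 -> R) (g : T2 -> R) :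
  bounded_measurable f -> bounded_measurable g ->
  \int[product_subprobability (m1, m2)]_z (f z.1 * g z.2) =
  (\int[m1]_x f x) * (\int[m2]_y g y).
Proof.
move=> bf bg.
have bfg : bounded_measurable (fun z : T1 * T2 => f z.1 * g z.2).
  by apply: bounded_measurableM; apply: bounded_measurable_comp.
have ifg := bounded_measurable_integrable (product_subprobability (m1, m2)) bfg.
have fi := bounded_measurable_integrable m1 bf.
have gi := bounded_measurable_integrable m2 bg.
rewrite /Rintegral -(@integral12_prod_meas1 _ _ _ _ _ m1 m2 (fun z => (f z.1 * g z.2)%:E) ifg).
rewrite -fineM ?integrable_fin_num//; congr fine.
rewrite -[X in (_ * X)%E]fineK ?integrable_fin_num// muleC -integralZl//.
apply: eq_integral => x _; rewrite muleC fineK ?integrable_fin_num//.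
rewrite -integralZl//; exact: eq_integral.
Qed.

End Rintegral_product.

Section trig_moments.
Context {R : realType}.
Notation mu := (@lebesgue_measure R).

Definition uniform_angle : subprobability _ R := uniform_prob (@pi_gt0 R).

Let Q := uniform_angle.

Lemma bounded_measurable_cos : bounded_measurable (@cos R).
Proof.
split; first by apply: continuous_measurable_fun; exact: continuous_cos.
by exists 1 => x; exact: cos_max.
Qed.

Lemma bounded_measurable_abs_sin : bounded_measurable (fun x : R => `|sin x|).
Proof.
split; first by apply: measurableT_comp => //; apply: continuous_measurable_fun; exact: continuous_sin.
by exists 1 => x; rewrite normr_id; exact: sin_max.
Qed.

(** The absolute value changes nothing on the interval from 0 to [pi], which carries the measure,
    but it makes the weights built from [sin] nonnegative at every real number, as [sphere_average]
    demands. *)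
Definition trig_moment (a b : nat) : R := \int[Q]_x (cos x ^+ a * `|sin x| ^+ b).

Let J := trig_moment.
Let F (a b : nat) (x : R) := cos x ^+ a * sin x ^+ b.

Let F_cont a b : continuous (F a b).
Proof.
by move=> x; apply: cvgM; apply: (continuous_comp _ (@exprn_continuous R _ _));
  [exact: continuous_cos|exact: continuous_sin].
Qed.

Let trig_momentE a b : J a b = pi^-1 * \int[mu]_(x in `[0, pi]) F a b x.
Proof.
have bJ : bounded_measurable (fun x : R => cos x ^+ a * `|sin x| ^+ b).
  by apply: bounded_measurableM; apply: bounded_measurableX;
    [exact: bounded_measurable_cos|exact: bounded_measurable_abs_sin].
have iQ := bounded_measurable_integrable Q bJ.
(* Adding 1 makes the integrand nonnegative, the setting of [integral_uniform]. *)
have -> : J a b = \int[Q]_x (1 + cos x ^+ a * `|sin x| ^+ b) - 1.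
  rewrite RintegralD//; last first.
    by apply: bounded_measurable_integrable; exact: bounded_measurable_cst.
  have QT : Q setT = 1%E by exact: probability_setT.
  rewrite Rintegral_cst// (_ : fine _ = 1); last exact: (congr1 fine QT).
  by rewrite mulr1 addrAC subrr add0r.
rewrite /Rintegral integral_uniform; last 2 first.
- apply/measurable_EFinP; apply: measurable_funD => //; exact: bJ.1.
- move=> x; rewrite lee_fin -lerBlDl sub0r.
  have : `|cos x ^+ a * `|sin x| ^+ b| <= 1.
    rewrite normrM !normrX normr_id mulr_ile1// exprn_ile1// ?cos_max ?sin_max//.
  by rewrite ler_norml => /andP[].
have iF : mu.-integrable `[0, pi] (EFin \o F a b).
  apply: continuous_compact_integrable; first exact: segment_compact.
  exact/continuous_subspaceT/F_cont.
rewrite subr0 (_ : (\int[mu]_(x in _) _)%E = (\int[mu]_(x in `[0%R, pi]) (1 + F a b x)%:E)%E); last first.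
  apply: eq_integral => x; rewrite inE/= in_itv/= => /andP[x0 xpi].
  by rewrite /F ger0_norm// sin_ge0_pi// x0 xpi.
have i1 : mu.-integrable `[0, pi] (EFin \o (fun=> 1 : R)).
  apply: continuous_compact_integrable; first exact: segment_compact.
  exact/continuous_subspaceT/cst_continuous.
rewrite fineM//; last first.
  by rewrite integrable_fin_num//; exact: (integrableD _ i1 iF).
have -> : fine (\int[mu]_(x in `[0%R, pi]) (1 + F a b x)%:E)%E =
    \int[mu]_(x in `[0, pi]) 1 + \int[mu]_(x in `[0, pi]) F a b x.
  by rewrite -RintegralD.
rewrite Rintegral_cst//= lebesgue_measure_itv/= lte_fin pi_gt0 oppr0 adde0/= mul1r.
by rewrite mulrDr mulVf ?gt_eqF ?pi_gt0// addrAC subrr add0r.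
Qed.

Let trig_ftc (g f : R -> R) : continuous f ->
  (forall x : R, is_derive x 1 g (f x)) ->
  \int[mu]_(x in `[0, pi]) f x = g pi - g 0.
Proof.
move=> cf dg; rewrite /Rintegral (@continuous_FTC2 _ f g)//.
- exact: pi_gt0.
- exact: continuous_subspaceT.
- have cg x : {for x, continuous g}.
    by apply/differentiable_continuous/derivable1_diffP; have := dg x => ?; exact: ex_derive.
  split; first by move=> x _; have := dg x => ?; exact: ex_derive.
    exact/cvg_at_right_filter/cg.
  exact/cvg_at_left_filter/cg.
- by move=> x _; have := dg x => ?; rewrite derive1E derive_val.
Qed.

Let is_derive_F a b (x : R) :
  is_derive x 1 (F a.+1 b.+1) (b.+1%:R * F a.+2 b x - a.+1%:R * F a b.+2 x).
Proof.
have -> : F a.+1 b.+1 = (@cos R) ^+ a.+1 * (@sin R) ^+ b.+1.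
  by apply/funext => y; rewrite /F !fctE.
have h := is_deriveM (is_deriveX a.+1 (is_derive_cos x)) (is_deriveX b.+1 (is_derive_sin x)).
apply: is_derive_eq; rewrite /F !fctE /GRing.scale/= !exprS; ring.
Qed.

Let is_derive_sinX b (x : R) :
  is_derive x 1 (fun x : R => sin x ^+ b.+1) (b.+1%:R * F 1 b x).
Proof.
have -> : (fun x : R => sin x ^+ b.+1) = (@sin R) ^+ b.+1.
  by apply/funext => y; rewrite !fctE.
have h := is_deriveX b.+1 (is_derive_sin x).
by apply: is_derive_eq; rewrite /F /GRing.scale/= expr1 -mulrA [cos x * _]mulrC.
Qed.

Let intF a b : mu.-integrable `[0, pi] (EFin \o F a b).
Proof.
apply: continuous_compact_integrable; first exact: segment_compact.
exact/continuous_subspaceT/F_cont.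
Qed.

Let contZF (r : R) a b : continuous (fun x => r * F a b x).
Proof. by move=> x; apply: cvgMr; exact: F_cont. Qed.

Lemma trig_moment10 b : J 1 b = 0.
Proof.
have := @trig_ftc _ _ (@contZF b.+1%:R 1%N b) (@is_derive_sinX b).
rewrite RintegralZl// sinpi sin0 subrr => /eqP.
by rewrite mulf_eq0 pnatr_eq0/= trig_momentE => /eqP ->; rewrite mulr0.
Qed.

(** The function [cos^(a+1) sin^(b+1)] vanishes at 0 and at [pi], so its derivative integrates to
    0. *)
Let trig_moment_ibp a b : b.+1%:R * J a.+2 b = a.+1%:R * J a b.+2.
Proof.
have c : continuous (fun x => b.+1%:R * F a.+2 b x - a.+1%:R * F a b.+2 x).
  by move=> x; apply: cvgB; exact: (@contZF).
have := @trig_ftc _ _ c (@is_derive_F a b).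
have iZ (r : R) i j : mu.-integrable `[0, pi] (EFin \o (fun x => r * F i j x)).
  exact: integrable_scale.
rewrite RintegralB// !RintegralZl// /F sinpi sin0 !exprS !mul0r !mulr0 subrr => h.
by apply/eqP; rewrite -subr_eq0 !trig_momentE !(mulrCA _ pi^-1) -mulrBr h mulr0.
Qed.

(** Combines the integration by parts with [sin^2 = 1 - cos^2], which expresses the moment with two
    more sines through the two moments that occur here. *)
Lemma trig_momentSS a b : (a + b + 2)%:R * J a.+2 b = a.+1%:R * J a b.
Proof.
have h : J a b.+2 = J a b - J a.+2 b.
  rewrite !trig_momentE -mulrBr -RintegralB//; congr (_ * _).
  apply: eq_Rintegral => x _; rewrite /F !exprS.
  have := cos2Dsin2 x; move: (cos x) (sin x) => c s h.
  have -> : s ^+ 2 = 1 - c ^+ 2 -> s * (s * s ^+ b) = (1 - c ^+ 2) * s ^+ b.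
    by move=> <-; ring.
  - ring.
  - by rewrite -h addrC addKr.
have := trig_moment_ibp a b; rewrite h !natrD -!natr1; lra.
Qed.

Lemma trig_moment0SS b : b.+2%:R * J 0 b.+2 = b.+1%:R * J 0 b.
Proof.
have := trig_momentSS 0 b; have := trig_moment_ibp 0 b.
rewrite add0n mul1r natrD -!natr1 => h1 h2.
by rewrite -h1 -addrA mulrCA; congr (_ * _); move: h2; rewrite !add0r mul1r.
Qed.

Lemma trig_moment0_gt0 b : 0 < J 0 b.
Proof.
have J0 : 0 < J 0 0.
  rewrite trig_momentE (_ : \int[mu]_(x in _) _ = \int[mu]_(x in `[0, pi]) (cst 1 x)).
    rewrite Rintegral_cst//= lebesgue_measure_itv/= lte_fin pi_gt0 oppr0 adde0/=.
    by rewrite mul1r mulVf// gt_eqF// pi_gt0.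
  by apply: eq_Rintegral => x _; rewrite /F !expr0 mulr1.
have J1 : 0 < J 0 1.
  have dc (x : R) : is_derive x 1 (fun x : R => - cos x) (F 0 1 x).
    have h := is_deriveN (is_derive_cos x).
    by apply: is_derive_eq; rewrite /F expr0 mul1r expr1 opprK.
  rewrite trig_momentE (trig_ftc (@F_cont 0%N 1%N) dc).
  by rewrite cospi cos0 opprK mulr_gt0// ?invr_gt0 ?pi_gt0.
suff : 0 < J 0 b /\ 0 < J 0 b.+1 by case.
elim: b => // b [ih1 ih2]; split => //.
by rewrite -(pmulr_rgt0 _ (ltr0Sn _ b.+1)) trig_moment0SS mulr_gt0.
Qed.

End trig_moments.

Section sphere_moments.
Context {R : realType}.

(** The double factorial [(2m - 1)!!]. *)
Definition odd_fact (m : nat) : nat := (\prod_(i < m) i.*2.+1)%N.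

Lemma fact_double m : (m.*2`! = odd_fact m * (2 ^ m * m`!))%N.
Proof.
elim: m => [|m ih]; first by rewrite /odd_fact big_ord0.
rewrite doubleS !factS ih /odd_fact big_ord_recr/= expnS -/(odd_fact m).
by rewrite -[in LHS]doubleS -mul2n; ring.
Qed.

(** Follows from [(2m)! = (2m - 1)!! 2^m m!], as the powers of two cancel. It turns the even terms
    of a binomial expansion of exponent [2m] into those of an expansion of exponent [m]. *)
Lemma bin_double_odd_fact m j : (j <= m)%N ->
  ('C(m.*2, j.*2) * (odd_fact (m - j) * odd_fact j) = 'C(m, j) * odd_fact m)%N.
Proof.
move=> jm.
have := bin_fact jm.
have : (j.*2 <= m.*2)%N by rewrite leq_double.
move=> /bin_fact; rewrite -doubleB !fact_double => h2 h3.
apply/eqP; rewrite -(eqn_pmul2r (_ : 0 < 2 ^ m * (j`! * (m - j)`!))%N); last first.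
  by rewrite !muln_gt0 expn_gt0 !fact_gt0.
apply/eqP; transitivity (odd_fact m * (2 ^ m * m`!))%N; last first.
  by rewrite -h3; ring.
rewrite -h2 (_ : (2 ^ m = 2 ^ j * 2 ^ (m - j))%N); last by rewrite -expnD subnKC.
by ring.
Qed.

(** The moment of order [2m] of one coordinate under the uniform law on the unit sphere of [R^n]. *)
Definition sphere_moment (n m : nat) : R :=
  (odd_fact m)%:R / \prod_(i < m) (n + i.*2)%:R.

Let prod_neq0 (k i : nat) : \prod_(l < i) (k.+1 + l.*2)%:R != 0 :> R.
Proof. by apply/prodf_neq0 => l _; rewrite pnatr_eq0. Qed.

Lemma trig_moment_even (n i : nat) :
  trig_moment i.*2 n = (odd_fact i)%:R / \prod_(l < i) (n.+2 + l.*2)%:R * trig_moment 0 n :> R.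
Proof.
elim: i => [|i ih]; first by rewrite /odd_fact !big_ord0 divr1 mul1r.
have := @trig_momentSS R i.*2 n; rewrite ih => h.
have i0 : (i.*2 + n + 2)%:R != 0 :> R by rewrite pnatr_eq0 addn2.
apply: (mulfI i0); rewrite doubleS h /odd_fact !big_ord_recr/= -/(odd_fact i) natrM invfM.
have -> : (n.+2 + i.*2 = i.*2 + n + 2)%N by rewrite !addn2 addnC !addnS.
move: (prod_neq0 n.+1 i) i0; move: (\prod_(l < i) (n.+2 + l.*2)%:R) ((_ + 2)%:R) => p c p0 c0.
by field; rewrite c0 p0.
Qed.

Lemma trig_moment_odd (n i : nat) : trig_moment i.*2.+1 n = 0 :> R.
Proof.
elim: i => [|i ih]; first exact: trig_moment10.
have := @trig_momentSS R i.*2.+1 n; rewrite ih mulr0 doubleS => /eqP.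
by rewrite mulf_eq0 pnatr_eq0 addn2/= => /eqP.
Qed.

Lemma trig_moment0_double (n j : nat) :
  trig_moment 0 (n + j.*2) = \prod_(l < j) (n.+1 + l.*2)%:R / \prod_(l < j) (n.+2 + l.*2)%:R
    * trig_moment 0 n :> R.
Proof.
elim: j => [|j ih]; first by rewrite !big_ord0 divr1 mul1r addn0.
have := @trig_moment0SS R (n + j.*2); rewrite ih doubleS !addnS => h.
have j0 : (n + j.*2).+2%:R != 0 :> R by rewrite pnatr_eq0.
apply: (mulfI j0); rewrite h !big_ord_recr/= invfM !addSn.
move: (prod_neq0 n.+1 j) j0; move: (\prod_(l < j) (n.+2 + l.*2)%:R) (_.+2%:R) => p c p0 c0.
by field; rewrite c0 p0.
Qed.

(** Slicing a sphere by the polar angle gives its moments from those of the sphere one dimension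
    lower; this is the identity for one term of the binomial expansion, [trig_moment 0 n]
    normalizing the law of the angle. *)
Lemma sphere_moment_step (n m j : nat) : (j <= m)%N ->
  'C(m.*2, j.*2)%:R * (sphere_moment n.+1 j *
    (trig_moment (m - j).*2 (n + j.*2) / trig_moment 0 n)) =
  'C(m, j)%:R * sphere_moment n.+2 m :> R.
Proof.
move=> jm; rewrite trig_moment_even trig_moment0_double /sphere_moment.
have J0 : trig_moment 0 n != 0 :> R by rewrite gt_eqF// trig_moment0_gt0.
have -> : \prod_(l < m) (n.+2 + l.*2)%:R =
    \prod_(l < j) (n.+2 + l.*2)%:R * \prod_(l < m - j) ((n + j.*2).+2 + l.*2)%:R :> R.
  have -> : \prod_(l < m) (n.+2 + l.*2)%:R = \prod_(l < j + (m - j)) (n.+2 + l.*2)%:R :> R.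
    by rewrite subnKC.
  rewrite big_split_ord/=; congr (_ * _).
  by apply: eq_bigr => l _; rewrite doubleD !addSn addnA.
have := congr1 (fun k => k%:R : R) (bin_double_odd_fact jm); rewrite !natrM => h.
rewrite [RHS]mulrA -h; move: (prod_neq0 n j) (prod_neq0 n.+1 j) (prod_neq0 (n + j.*2).+1 (m - j)).
set a := \prod_(l < j) _; set b := \prod_(l < j) _; set c := \prod_(l < _) _.
by move=> a0 b0 c0; field; rewrite a0 b0 c0 J0.
Qed.

Lemma sum_even_only (F : nat -> R) m : (forall i, F i.*2.+1 = 0) ->
  \sum_(i < m.*2.+1) F i = \sum_(j < m.+1) F j.*2.
Proof.
move=> F0; elim: m => [|m ih]; first by rewrite !big_ord_recl !big_ord0.
by rewrite doubleS big_ord_recr [in LHS]big_ord_recr [in RHS]big_ord_recr/= ih F0 addr0.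
Qed.

(** The squared length of the projection of [x] onto the hyperplane [sum_k x_k = 0]. *)
Definition centered_ss (K : nat) (x : nat -> R) : R :=
  \sum_(k < K) x k ^+ 2 - (\sum_(k < K) x k) ^+ 2 / K%:R.

(* A weighted average over the unit sphere of the hyperplane sum_k u_k = 0 of R^K
   with the moments of the uniform one. *)
Definition sphere_average d (T : measurableType d) (P : subprobability T R) (K : nat)
    (om : T -> R) (U : nat -> T -> R) : Prop :=
  [/\ bounded_measurable om /\ (forall k, bounded_measurable (U k)),
    forall t, 0 <= om t,
    forall t, \sum_(k < K) U k t = 0,
    forall t, \sum_(k < K) U k t ^+ 2 = 1 &
    forall (x : nat -> R) m, \int[P]_t (om t * (\sum_(k < K) U k t * x k) ^+ m.*2) =
      sphere_moment K.-1 m * centered_ss K x ^+ m].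

(** The hyperplane is a line and its unit sphere the two points [(1, -1) / sqrt 2] and its opposite.
    Even moments do not distinguish them, so one point suffices; the underlying probability is
    arbitrary. *)
Lemma sphere_average2 : exists d (T : measurableType d) (P : subprobability T R) om U,
  sphere_average P 2 om U.
Proof.
pose s : R := Num.sqrt 2^-1.
have s2 : s ^+ 2 = 2^-1 by rewrite sqr_sqrtr.
exists _, _, (@uniform_angle R), (fun=> 1), (fun k _ => if k == 0%N then s else - s).
split=> //.
- by split=> *; exact: bounded_measurable_cst.
- by move=> t; rewrite !big_ord_recl big_ord0/= addr0 subrr.
- by move=> t; rewrite !big_ord_recl big_ord0/= sqrrN s2; field.
move=> x m; rewrite Rintegral_cst// (_ : fine _ = 1); last first.
  exact: (congr1 fine (@probability_setT _ _ _ (uniform_prob (@pi_gt0 R)))).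
rewrite mulr1/= mul1r !big_ord_recl !big_ord0/= /sphere_moment.
have -> : (odd_fact m)%:R / \prod_(i < m) (1 + i.*2)%:R = 1 :> R.
  by rewrite /odd_fact natr_prod divff//; apply/prodf_neq0 => i _; rewrite pnatr_eq0.
rewrite mul1r /centered_ss !big_ord_recl !big_ord0/= -mul2n exprM; congr (_ ^+ _).
by rewrite mulNr !addr0 -mulrBr exprMn s2; field.
Qed.

(** Polar coordinates: [e] is the unit vector of the new hyperplane orthogonal to the old one, and a
    new point is [cos phi * e + sin phi * u] with [u] on the old sphere. The angle has density
    proportional to [sin^n], as on the unit sphere of a space of dimension [n + 2]. *)
Lemma sphere_average_step n : (exists d (T : measurableType d) (P : subprobability T R) om U,
  sphere_average P n.+2 om U) ->
  exists d (T : measurableType d) (P : subprobability T R) om U,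
  sphere_average P n.+3 om U.
Proof.
move=> [d [T [P [om [U [[bom bU] om0 U0 U1 Um]]]]]].
pose N := n.+2.
pose r : R := Num.sqrt (N%:R * N.+1%:R).
have r2 : r ^+ 2 = N%:R * N.+1%:R by rewrite sqr_sqrtr// mulr_ge0.
have rn0 : r != 0 by rewrite -sqrf_eq0 r2 mulf_eq0 !pnatr_eq0.
pose e (k : nat) : R := (if (k < N)%N then 1 else - N%:R) / r.
pose U' k (z : T * measurableTypeR R) := cos z.2 * e k + `|sin z.2| * (if (k < N)%N then U k z.1 else 0).
pose om' (z : T * measurableTypeR R) := om z.1 * (`|sin z.2| ^+ n / trig_moment 0 n).
have b2 (f : measurableTypeR R -> R) : bounded_measurable f -> bounded_measurable (fun z : T * R => f z.2).
  by move=> bf; exact: bounded_measurable_comp.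
have b1 (f : T -> R) : bounded_measurable f -> bounded_measurable (fun z : T * R => f z.1).
  by move=> bf; exact: bounded_measurable_comp.
have bcos := @bounded_measurable_cos R; have bsin := @bounded_measurable_abs_sin R.
have eN (x : nat -> R) : \sum_(k < N.+1) e k * x k = (\sum_(k < N) x k - N%:R * x N) / r.
  rewrite big_ord_recr/= /e ltnn mulrDl mulr_suml; congr (_ + _); last by ring.
  by apply: eq_bigr => k _; rewrite ltn_ord mul1r mulrC.
have UN (x : nat -> R) z : \sum_(k < N.+1) U' k z * x k =
    cos z.2 * (\sum_(k < N.+1) e k * x k) + `|sin z.2| * (\sum_(k < N) U k z.1 * x k).
  rewrite mulr_sumr [in X in _ + X]mulr_sumr.
  have -> : \sum_(k < N) `|sin z.2| * (U k z.1 * x k) =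
      \sum_(k < N.+1) `|sin z.2| * ((if (k < N)%N then U k z.1 else 0) * x k).
    rewrite [RHS]big_ord_recr/= ltnn mul0r mulr0 addr0.
    by apply: eq_bigr => k _; rewrite ltn_ord.
  by rewrite -big_split/=; apply: eq_bigr => k _; rewrite /U'; ring.
exists _, _, (product_subprobability (P, uniform_angle)), om', U'; split.
- split=> [|k].
    apply: bounded_measurableM; first exact: b1.
    apply: (b2 (fun x : R => `|sin x| ^+ n / trig_moment 0 n)).
    apply: bounded_measurableM; last exact: bounded_measurable_cst.
    exact: bounded_measurableX.
  apply: bounded_measurableD; apply: bounded_measurableM; [exact: (b2 (@cos R))|exact: bounded_measurable_cst|
    exact: (b2 (fun x : R => `|sin x|))|].
  by case: (k < N)%N; [exact: (b1 (U k))|exact: bounded_measurable_cst].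
- move=> z; rewrite /om' mulr_ge0// divr_ge0 ?exprn_ge0//.
  exact/ltW/trig_moment0_gt0.
- move=> z; have := UN (fun=> 1) z; rewrite (eN (fun=> 1)).
  under eq_bigr do rewrite mulr1; move=> ->.
  under [X in _ + _ * X]eq_bigr do rewrite mulr1.
  by rewrite U0 sumr_const card_ord mulr1 subrr mul0r !mulr0 addr0.
- move=> z; have := UN (U' ^~ z) z; under eq_bigr do rewrite -expr2; move=> ->.
  have eU : \sum_(k < N.+1) e k * U' k z = cos z.2.
    have := UN e z; under eq_bigr do rewrite mulrC; move=> ->.
    have -> : \sum_(k < N) U k z.1 * e k = 0.
      transitivity ((\sum_(k < N) U k z.1) / r); last by rewrite U0 mul0r.
      by rewrite mulr_suml; apply: eq_bigr => k _; rewrite /e ltn_ord mul1r.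
    rewrite mulr0 addr0 (eN e) /e ltnn.
    have -> : \sum_(k < N) (if (k < N)%N then 1 else - N%:R) / r = N%:R / r.
      transitivity (\sum_(k < N) r^-1); last by rewrite sumr_const card_ord mulr_natl.
      by apply: eq_bigr => k _; rewrite ltn_ord mul1r.
    have -> : (N%:R / r - N%:R * (- N%:R / r)) / r = (N%:R * (1 + N%:R)) / r ^+ 2 by field.
    by rewrite r2 nat1r divff ?mulr1// mulf_neq0 ?pnatr_eq0.
  have UU : \sum_(k < N) U k z.1 * U' k z = `|sin z.2|.
    transitivity (cos z.2 / r * (\sum_(k < N) U k z.1) +
        `|sin z.2| * (\sum_(k < N) U k z.1 ^+ 2)); last by rewrite U0 U1 mulr0 add0r mulr1.
    rewrite !mulr_sumr -big_split/=; apply: eq_bigr => k _.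
    by rewrite /U' /e ltn_ord; ring.
  by rewrite eU UU -!expr2 real_normK ?num_real// cos2Dsin2.
move=> x m; set a := (\sum_(k < N) x k - N%:R * x N) / r.
(* Pythagoras: [a] is the component of [x] along [e]. *)
have -> : centered_ss N.+1 x = a ^+ 2 + centered_ss N x.
  rewrite /centered_ss [\sum_(k < N.+1) x k ^+ 2]big_ord_recr [\sum_(k < N.+1) x k]big_ord_recr/=.
  rewrite /a exprMn exprVn r2.
  move: (\sum_(k < N) x k) (\sum_(k < N) x k ^+ 2) => S S2.
  rewrite -natr1; have : N%:R != 0 :> R by rewrite pnatr_eq0.
  have : N%:R + 1 != 0 :> R by rewrite natr1 pnatr_eq0.
  by move: (N%:R) (x N) => c y c1 c0; field; rewrite c0 c1.
pose f i (t : T) := om t * (\sum_(k < N) U k t * x k) ^+ i.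
pose g i (p : measurableTypeR R) := 'C(m.*2, i)%:R * (a ^+ (m.*2 - i) / trig_moment 0 n)
   * (cos p ^+ (m.*2 - i) * `|sin p| ^+ (n + i)).
have bf i : bounded_measurable (f i).
  apply: bounded_measurableM => //; apply: bounded_measurableX.
  by apply: bounded_measurable_sum => k; apply: bounded_measurableM => //; exact: bounded_measurable_cst.
have bcs i j : bounded_measurable (fun p : R => cos p ^+ i * `|sin p| ^+ j).
  by apply: bounded_measurableM; apply: bounded_measurableX; [exact: bcos|exact: bsin].
have bg i : bounded_measurable (g i).
  by apply: bounded_measurableM; [exact: bounded_measurable_cst|exact: bcs].
transitivity (\sum_(i < m.*2.+1) (\int[P]_t f i t) * (\int[uniform_angle]_p g i p)).
  under [RHS]eq_bigr => i _ do rewrite -Rintegral_product//.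
  rewrite -Rintegral_sum; last first.
    move=> i; apply: bounded_measurable_integrable.
    by apply: bounded_measurableM; [exact: b1|exact: b2].
  apply: eq_Rintegral => z _; rewrite UN eN -/a exprDn mulr_sumr.
  apply: eq_bigr => i _; rewrite /om' /f /g -mulr_natl !exprMn exprD; ring.
have gI i : \int[uniform_angle]_p g i p = 'C(m.*2, i)%:R *
    (a ^+ (m.*2 - i) / trig_moment 0 n) * trig_moment (m.*2 - i) (n + i).
  have := bounded_measurable_integrable uniform_angle (bcs (m.*2 - i)%N (n + i)%N).
  by move=> h; rewrite /g RintegralZl.
under eq_bigr do rewrite gI.
(* Terms of odd index carry an odd power of the cosine and integrate to 0, so odd moments of the old
   sphere are never evaluated; beyond the range the binomial coefficient is 0. *)
rewrite (sum_even_only (F := fun i => (\int[P]_t f i t) *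
    ('C(m.*2, i)%:R * (a ^+ (m.*2 - i) / trig_moment 0 n) * trig_moment (m.*2 - i) (n + i)))); last first.
  move=> i; have [im|mi] := ltnP i m; last by rewrite bin_small ?mul0r ?mulr0// ltnS leq_double.
  have -> : (m.*2 - i.*2.+1 = (m - i.+1).*2.+1)%N.
    by rewrite doubleB doubleS -subSn ?subSS// -doubleS leq_double.
  by rewrite trig_moment_odd !mulr0.
rewrite exprDn mulr_sumr; apply: eq_bigr => j _.
have jm : (j <= m)%N by rewrite -ltnS.
have aE : a ^+ (m - j).*2 = (a ^+ 2) ^+ (m - j) by rewrite -exprM mul2n.
rewrite -doubleB Um -[X in _ = _ * X]mulr_natl aE.
transitivity (('C(m.*2, j.*2)%:R * (sphere_moment n.+1 j *
    (trig_moment (m - j).*2 (n + j.*2) / trig_moment 0 n))) *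
   ((a ^+ 2) ^+ (m - j) * centered_ss N x ^+ j)).
  by rewrite /= -/N; ring.
by rewrite (sphere_moment_step n jm) /=; ring.
Qed.

Lemma sphere_average_exists (K : nat) : (2 <= K)%N ->
  exists d (T : measurableType d) (P : subprobability T R) om U,
  sphere_average P K om U.
Proof.
case: K => // -[//|K] _; elim: K => [|K ih]; first exact: sphere_average2.
exact: sphere_average_step.
Qed.

End sphere_moments.

Section bessel_average.
Context {R : realType}.

(** The spherical average of the Taylor term of order [2m] of [cos (sum_k u_k x_k)], as a function
    of [y = centered_ss K x]. *)
Definition bessel_term (K m : nat) (y : R) : R :=
  (-1) ^+ m / m.*2`!%:R * (sphere_moment K.-1 m * y ^+ m).

Lemma sum_cos_coeff (y : R) N :
  \sum_(0 <= k < N.*2) cos_coeff y k = \sum_(0 <= m < N) (-1) ^+ m / m.*2`!%:R * y ^+ m.*2.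
Proof.
elim: N => [|N ih]; first by rewrite !big_nil.
rewrite doubleS !big_nat_recr//= ih cos_coeff_odd addr0; congr (_ + _).
by rewrite -cos_coeff'E /cos_coeff' mulrAC.
Qed.

Section average.
Context d (T : measurableType d) (P : subprobability T R) (K : nat)
  (om : T -> R) (U : nat -> T -> R).
Hypothesis sU : sphere_average P K om U.

Lemma sphere_average_coord_le1 k t : (k < K)%N -> `|U k t| <= 1.
Proof.
case: sU => _ _ _ U1 _ kK; rewrite -(@ler_pXn2r _ 2)// ?nnegrE// expr1n real_normK ?num_real//.
rewrite -(U1 t) (bigD1 (Ordinal kK))//= lerDl sumr_ge0// => i _.
exact: sqr_ge0.
Qed.

Lemma sphere_average_weight1 : \int[P]_t om t = 1.
Proof.
case: sU => _ _ _ _ /(_ (fun=> 0) 0%N) h.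
transitivity (sphere_moment K.-1 0 * centered_ss K (fun=> 0 : R) ^+ 0); last first.
  by rewrite /sphere_moment /odd_fact !big_ord0 !expr0 divr1 mulr1.
rewrite -h; by apply: eq_Rintegral => t _; rewrite expr0 mulr1.
Qed.

Lemma sphere_average_bounded (x : nat -> R) t :
  `|\sum_(k < K) U k t * x k| <= \sum_(k < K) `|x k|.
Proof.
rewrite (le_trans (ler_norm_sum _ _ _))//; apply: ler_sum => k _.
by rewrite normrM ler_piMl// sphere_average_coord_le1.
Qed.

Lemma bounded_measurable_sphere_lin (x : nat -> R) :
  bounded_measurable (fun t => \sum_(k < K) U k t * x k).
Proof.
case: sU => -[_ bU] _ _ _ _; apply: bounded_measurable_sum => k.
by apply: bounded_measurableM => //; exact: bounded_measurable_cst.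
Qed.

(** The linear form is bounded by [M] uniformly on the sphere, so the cosine tail is bounded by one
    null sequence and sum and integral may be exchanged. *)
Lemma sphere_average_cos (x : nat -> R) :
  (fun N => \sum_(0 <= m < N) bessel_term K m (centered_ss K x)) @ \oo -->
  \int[P]_t (om t * cos (\sum_(k < K) U k t * x k)).
Proof.
have [[bom bU] om0 _ _ Um] := sU.
pose y t := \sum_(k < K) U k t * x k.
pose M := \sum_(k < K) `|x k|.
have by_ : bounded_measurable y by exact: bounded_measurable_sphere_lin.
have bterm m : bounded_measurable (fun t => (-1) ^+ m / m.*2`!%:R * (om t * y t ^+ m.*2)).
  apply: bounded_measurableM; first exact: bounded_measurable_cst.
  by apply: bounded_measurableM => //; exact: bounded_measurableX.
have bcosy : bounded_measurable (fun t => om t * cos (y t)).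
  apply: bounded_measurableM => //; apply: (bounded_measurable_comp (T' := measurableTypeR R)).
    exact: by_.1.
  exact: bounded_measurable_cos.
have bi (f : T -> R) : bounded_measurable f -> P.-integrable setT (EFin \o f).
  exact: bounded_measurable_integrable.
have partial N : \sum_(0 <= m < N) bessel_term K m (centered_ss K x) =
    \int[P]_t (om t * \sum_(0 <= k < N.*2) cos_coeff (y t) k).
  transitivity (\int[P]_t (\sum_(0 <= m < N) (-1) ^+ m / m.*2`!%:R * (om t * y t ^+ m.*2))).
    rewrite Rintegral_sum; last by move=> m; exact: bi.
    apply: eq_bigr => m _; rewrite RintegralZl ?Um//; apply: bi.
    by apply: bounded_measurableM => //; exact: bounded_measurableX.
  apply: eq_Rintegral => t _; rewrite sum_cos_coeff mulr_sumr.
  by apply: eq_bigr => m _; rewrite mulrCA.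
apply/cvgrPdist_le => e e0.
have e_cvg : (fun N => exp_coeff M N.*2 * expR M) @ \oo --> (0 : R).
  rewrite -[X in _ --> X](mul0r (expR M)); apply: cvgMl.
  apply: (cvg_comp (fun N => N.*2) (exp_coeff M)); last exact: cvg_exp_coeff.
  move=> A [n _ An]; exists n => // k nk; apply: An => /=.
  by rewrite -addnn (leq_trans nk) ?leq_addr.
near=> N; apply: (@le_trans _ _ (exp_coeff M N.*2 * expR M)); last first.
  by near: N; exact: (cvgr_le _ e_cvg).
have M0 : 0 <= M by exact: sumr_ge0.
have bsum : bounded_measurable (fun t => om t * \sum_(0 <= k < N.*2) cos_coeff (y t) k).
  apply: bounded_measurableM => //.
  under [X in bounded_measurable X]eq_fun do rewrite sum_cos_coeff.
  apply: bounded_measurable_sum => m; apply: bounded_measurableM.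
    exact: bounded_measurable_cst.
  exact: bounded_measurableX.
have bdiff := bounded_measurableB bcosy bsum.
rewrite partial -RintegralB//; [|exact: bi|exact: bi].
rewrite (le_trans (le_normr_Rintegral _ _))//; first exact: bi.
rewrite -[leRHS]mul1r -sphere_average_weight1 -RintegralZr//; last exact: bi.
apply: le_Rintegral => //.
- by apply: bi; exact: bounded_measurable_norm.
- by apply: bi; apply: bounded_measurableM => //; exact: bounded_measurable_cst.
move=> t _; rewrite -mulrBr normrM ger0_norm// ler_wpM2l//.
apply: (le_trans (cos_tail _ _)); rewrite ler_pM ?expR_ge0 ?divr_ge0 ?exprn_ge0//.
  by rewrite ler_wpM2r// lerXn2r ?nnegrE// sphere_average_bounded.
by rewrite ler_expR sphere_average_bounded.
Unshelve. all: by end_near. Qed.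

End average.

(** Termwise match of the two series. It rests on [K - 1 = 2 (nu + 1)], which turns the denominator
    of the sphere moment into the product in [Gamma_natD], and on the factorization of [(2m)!]. *)
Lemma bessel_termE (K m : nat) (z : R) : (2 <= K)%N -> 0 < z ->
  let nu : R := (K%:R - 3) / 2 in
  (-1) ^+ m / (m`!%:R * Gamma (m%:R + nu + 1)) * (z / 2) `^ (2 * m%:R + nu) =
  (z / 2) `^ nu / Gamma (nu + 1) * bessel_term K m (z ^+ 2).
Proof.
move=> K2 z0 nu.
have K1 : K.-1%:R = 2 * (nu + 1) :> R.
  by rewrite /nu -[K in RHS]prednK ?(ltnW K2)// -natr1; field.
have K10 : 0 < K.-1%:R :> R by rewrite ltr0n -ltnS prednK ?(ltnW K2).
have nu0 : 0 < nu + 1 by move: K10; rewrite K1 pmulr_rgt0.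
have z20 : 0 < z / 2 by rewrite divr_gt0.
rewrite -addrA Gamma_natD// powRD; last by rewrite (gt_eqF z20) implybT.
have -> : (z / 2) `^ (2 * m%:R) = (z ^+ 2) ^+ m / 4 ^+ m.
  have -> : 4 = 2 ^+ 2 :> R by rewrite -natrX.
  by rewrite -natrM powR_mulrn ?ltW// exprM !expr_div_n.
rewrite /bessel_term /sphere_moment fact_double natrM.
have -> : \prod_(i < m) (K.-1 + i.*2)%:R = 2 ^+ m * \prod_(i < m) (nu + 1 + i%:R) :> R.
  have -> : 2 ^+ m = \prod_(i < m) (2 : R) by rewrite prodr_const card_ord.
  rewrite -big_split/=.
  by apply: eq_bigr => i _; rewrite natrD K1 -mul2n natrM -mulrDr.
rewrite natrM natrX.
have o0 : (odd_fact m)%:R != 0 :> R.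
  by rewrite /odd_fact natr_prod; apply/prodf_neq0 => i _; rewrite pnatr_eq0.
have f0 : m`!%:R != 0 :> R by rewrite pnatr_eq0 -lt0n fact_gt0.
have p0 : \prod_(i < m) (nu + 1 + i%:R) != 0.
  by apply/prodf_neq0 => i _; rewrite gt_eqF// ltr_wpDr.
have g0 : Gamma (nu + 1) != 0 by rewrite gt_eqF// Gamma_gt0.
have t0 : 2 ^+ m != 0 :> R by rewrite expf_neq0.
have -> : 4 ^+ m = 2 ^+ m * 2 ^+ m :> R by rewrite -exprMn -natrM.
move: (2 ^+ m) (\prod_(i < m) _) (Gamma _) (m`!%:R) (odd_fact m)%:R p0 g0 f0 o0 t0.
by move=> a b c d' e b0 c0 d0 e0 a0; field; rewrite a0 b0 c0 d0 e0.
Qed.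

Lemma bessel_factorE (K : nat) (beta s2 l : R) : (2 <= K)%N -> 0 < beta -> 0 <= s2 ->
  (fun N => \sum_(0 <= m < N) bessel_term K m (beta ^+ 2 * ((K%:R - 1) * s2 / K%:R)))
    @ \oo --> l ->
  bessel_factor beta s2 K = l.
Proof.
move=> K2 beta0 s0; rewrite /bessel_factor.
set y := (K%:R - 1) * s2 / K%:R; set z := beta * Num.sqrt y => cl.
have y0 : 0 <= y by rewrite divr_ge0// mulr_ge0// subr_ge0 ler1n ltnW.
have z2 : z ^+ 2 = beta ^+ 2 * y by rewrite exprMn sqr_sqrtr.
(* For [z = 0] only the term of index 0 survives, and it equals 1, the value that [bessel_factor]
   prescribes there. *)
rewrite -z2 in cl; case: eqVneq => [z0|z0].
  apply: (cvg_unique _ _ cl); first exact: Rhausdorff.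
  apply: cvg_near_cst; near=> N.
  have N0 : (0 < N)%N by near: N; exact: nbhs_infty_gt.
  rewrite -(prednK N0) big_nat_recl// big1 ?addr0.
    by rewrite /bessel_term /sphere_moment /odd_fact !big_ord0 !expr0 !divr1 !mulr1.
  by move=> m _; rewrite /bessel_term z0 -exprM expr0n muln_eq0/= !mulr0.
have zp : 0 < z by rewrite lt_neqAle eq_sym z0 mulr_ge0 ?sqrtr_ge0 ?ltW.
have z2p : 0 < z / 2 by rewrite divr_gt0.
pose nu : R := (K%:R - 3) / 2.
have g0 : Gamma (nu + 1) != 0.
  rewrite gt_eqF// Gamma_gt0// /nu; move: K2; rewrite -(ler_nat R); lra.
have -> : besselJ nu z = (z / 2) `^ nu / Gamma (nu + 1) * l.
  rewrite /besselJ; apply: cvg_lim; first exact: Rhausdorff.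
  have -> : series (fun m : nat => (-1) ^+ m / (m`!%:R * Gamma (m%:R + nu + 1))
      * (z / 2) `^ (2 * m%:R + nu)) =
    (fun N => (z / 2) `^ nu / Gamma (nu + 1) * \sum_(0 <= m < N) bessel_term K m (z ^+ 2)).
    apply/funext => N; rewrite /series/= mulr_sumr.
    by apply: eq_bigr => m _; exact: bessel_termE.
  exact: cvgMr.
have p0 : (z / 2) `^ nu != 0 by rewrite gt_eqF// powR_gt0.
by rewrite powRN; field; rewrite g0 p0.
Unshelve. all: by end_near. Qed.

(** The scale [beta / sqrt K] is forced: scaling [x] by it turns [centered_ss] into
    [beta^2 (K - 1) s2 / K], the square of the Bessel argument. *)
Lemma bessel_factor_average d (T : measurableType d) (P : subprobability T R) (K : nat)
    (om : T -> R) (U : nat -> T -> R) (beta : R) (x : nat -> R) :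
  (2 <= K)%N -> 0 < beta -> sphere_average P K om U ->
  0 <= centered_ss K x ->
  bessel_factor beta ((K%:R - 1)^-1 * centered_ss K x) K =
  \int[P]_t (om t * cos (beta / Num.sqrt K%:R * \sum_(k < K) U k t * x k)).
Proof.
move=> K2 beta0 sU ss0.
have K0 : 0 < K%:R :> R by rewrite ltr0n ltnW.
have K1 : 0 < K%:R - 1 :> R by rewrite subr_gt0 ltr1n.
apply: bessel_factorE => //; first by rewrite mulr_ge0// invr_ge0 ltW.
pose c := beta / Num.sqrt K%:R.
have c2 : c ^+ 2 = beta ^+ 2 / K%:R by rewrite exprMn exprVn sqr_sqrtr// ltW.
have -> : beta ^+ 2 * ((K%:R - 1) * ((K%:R - 1)^-1 * centered_ss K x) / K%:R) =
    centered_ss K (fun k => c * x k).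
  rewrite mulVKf ?gt_eqF// /centered_ss -mulr_sumr.
  under [X in _ = X - _]eq_bigr do rewrite exprMn.
  by rewrite -mulr_sumr c2 exprMn c2; field; rewrite gt_eqF.
have := @sphere_average_cos _ _ P K om U sU (fun k => c * x k).
congr (_ @ _ --> _); apply: eq_Rintegral => t _; congr (_ * cos _).
by rewrite mulr_sumr; apply: eq_bigr => k _; rewrite mulrCA.
Qed.

End bessel_average.

(** * Complex expectations and independence *)

Section independent_pair.
Context d d1 d2 (W : measurableType d) (S : measurableType d1) (T : measurableType d2)
  (R : realType) (P : probability W R) (X : W -> S) (Y : W -> T).
Hypotheses (mX : measurable_fun setT X) (mY : measurable_fun setT Y).
Hypothesis indep : forall A B, measurable A -> measurable B ->
  P (X @^-1` A `&` Y @^-1` B) = (P (X @^-1` A) * P (Y @^-1` B))%E.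

(** The joint law agrees with the product of the marginals on rectangles, hence everywhere;
    integrability and the value of the integral then come from Tonelli and Fubini. No boundedness is
    required, as the factors are exponentials. *)
Lemma integrable_Rintegral_indep_mul (f : S -> R) (g : T -> R) :
  measurable_fun setT f -> measurable_fun setT g ->
  P.-integrable setT (EFin \o (f \o X)) -> P.-integrable setT (EFin \o (g \o Y)) ->
  P.-integrable setT (EFin \o (fun w => f (X w) * g (Y w))) /\
  \int[P]_w (f (X w) * g (Y w)) = (\int[P]_w f (X w)) * (\int[P]_w g (Y w)).
Proof.
move=> mf mg fX gY.
pose X' : {mfun W >-> S} := HB.pack X (isMeasurableFun.Build _ _ _ _ X mX).
pose Y' : {mfun W >-> T} := HB.pack Y (isMeasurableFun.Build _ _ _ _ Y mY).
pose m1 : probability S R := distribution P X'.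
pose m2 : probability T R := distribution P Y'.
have mXY : measurable_fun setT (fun w => (X w, Y w)) by exact: measurable_fun_pair.
pose Z : {mfun W >-> (S * T)%type} := HB.pack (fun w => (X w, Y w)) (isMeasurableFun.Build _ _ _ _ (fun w => (X w, Y w)) mXY).
pose m' : probability (S * T)%type R := distribution P Z.
have m'E A : measurable A -> m' A = (m1 \x m2)%E A.
  by move=> mA; apply/esym; apply: product_measure_unique => // B C mB mC; exact: indep.
pose h (z : S * T) := f z.1 * g z.2.
have mh : measurable_fun setT h.
  by apply: measurable_funM; exact: measurableT_comp.
have fX' : m1.-integrable setT (EFin \o f).
  by apply: (integrable_pushforward mX) => //; exact/measurable_EFinP.
have gY' : m2.-integrable setT (EFin \o g).
  by apply: (integrable_pushforward mY) => //; exact/measurable_EFinP.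
have h12 : (m1 \x m2)%E.-integrable setT (EFin \o h).
  apply/integrable12ltyP; first exact/measurable_EFinP.
  have /integrableP[_ f1] := fX'; have /integrableP[_ g1] := gY'.
  rewrite (_ : (\int[m1]_x _)%E = (\int[m1]_x (`|(f x)%:E| * \int[m2]_y `|(g y)%:E|))%E).
    rewrite ge0_integralZr//; first (apply: lte_mul_pinfty => //; first exact: integral_ge0).
    + by rewrite ge0_fin_numE//; exact: integral_ge0.
    - by apply: measurableT_comp => //; exact/measurable_EFinP.
    - exact: integral_ge0.
  apply: eq_integral => x _; rewrite -ge0_integralZl//.
    by apply: eq_integral => y _; rewrite /= normrM EFinM.
  by apply: measurableT_comp => //; exact/measurable_EFinP.
have h' : m'.-integrable setT (EFin \o h).
  apply/integrableP; split; first exact/measurable_EFinP.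
  have /integrableP[_] := h12.
  rewrite (@eq_measure_integral _ _ _ setT (m1 \x m2)%E m')// => A mA _; exact: m'E.
have hP : P.-integrable setT (EFin \o (fun w => f (X w) * g (Y w))).
  apply/integrableP; split.
    by apply/measurable_EFinP; apply: measurable_funM; exact: measurableT_comp.
  have /integrableP[_] := h'.
  rewrite (ge0_integral_pushforward mXY)//.
  by apply: measurableT_comp => //; exact/measurable_EFinP.
split => //; rewrite /Rintegral -fineM ?integrable_fin_num//; congr fine.
transitivity (\int[m']_z (h z)%:E)%E.
  by rewrite (integral_pushforward mXY)//; exact/measurable_EFinP.
rewrite (@eq_measure_integral _ _ _ setT (m1 \x m2)%E m'); last by move=> A mA _; exact: m'E.
rewrite -(integral12_prod_meas1 h12) /fubini_F/=.
have -> : (\int[P]_w (f (X w))%:E)%E = (\int[m1]_x (f x)%:E)%E.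
  by rewrite (integral_pushforward mX)//; exact/measurable_EFinP.
have -> : (\int[P]_w (g (Y w))%:E)%E = (\int[m2]_y (g y)%:E)%E.
  by rewrite (integral_pushforward mY)//; exact/measurable_EFinP.
rewrite -[X in (_ * X)%E]fineK ?integrable_fin_num// muleC -integralZl//.
apply: eq_integral => x _; rewrite muleC fineK ?integrable_fin_num//.
by rewrite -integralZl//; exact: eq_integral.
Qed.

End independent_pair.

Section complex_measurability.
Context (R : realType).

Definition cmeasurable d' (T : measurableType d') (f : T -> R[i]) : Prop :=
  measurable_fun setT (fun w => complex.Re (f w)) /\
  measurable_fun setT (fun w => complex.Im (f w)).

Lemma cmeasurableM d' (T : measurableType d') (f g : T -> R[i]) :
  cmeasurable f -> cmeasurable g -> cmeasurable (fun w => f w * g w).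
Proof.
move=> [f1 f2] [g1 g2].
have RM w : complex.Re (f w * g w) = complex.Re (f w) * complex.Re (g w)
    - complex.Im (f w) * complex.Im (g w) by case: (f w) (g w) => [a b] [c e].
have IM w : complex.Im (f w * g w) = complex.Re (f w) * complex.Im (g w)
    + complex.Im (f w) * complex.Re (g w) by case: (f w) (g w) => [a b] [c e].
split.
  under eq_fun do rewrite RM.
  by apply: measurable_funB; exact: measurable_funM.
under eq_fun do rewrite IM.
by apply: measurable_funD; exact: measurable_funM.
Qed.

Lemma cmeasurable_comp d' (T : measurableType d') d'' (T' : measurableType d'')
    (h : T -> T') (f : T' -> R[i]) :
  measurable_fun setT h -> cmeasurable f -> cmeasurable (fun w => f (h w)).
Proof.
by move=> mh [f1 f2]; split; [exact: (measurableT_comp f1 mh)|exact: (measurableT_comp f2 mh)].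
Qed.

Lemma cmeasurable_cst d' (T : measurableType d') (c : R[i]) :
  cmeasurable (fun _ : T => c).
Proof. by split; exact: measurable_cst. Qed.

Lemma cmeasurable_prod d' (T : measurableType d') (I : Type) (s : seq I)
    (f : I -> T -> R[i]) : (forall i, cmeasurable (f i)) ->
  cmeasurable (fun w => \prod_(i <- s) f i w).
Proof.
move=> mf; elim: s => [|i s ih].
  by under [X in cmeasurable X]eq_fun do rewrite big_nil; exact: cmeasurable_cst.
by under [X in cmeasurable X]eq_fun do rewrite big_cons; exact: cmeasurableM.
Qed.

End complex_measurability.

Section complex_expectation.
Context d (W : measurableType d) (R : realType) (P : probability W R).
Implicit Types f g : W -> R[i].

Definition cintegrable f : Prop :=
  P.-integrable setT (EFin \o (fun w => complex.Re (f w))) /\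
  P.-integrable setT (EFin \o (fun w => complex.Im (f w))).

Definition cexpect f : R[i] :=
  ((\int[P]_w complex.Re (f w)) +i* (\int[P]_w complex.Im (f w)))%C.

Lemma cexpect_cst (c : R[i]) : cexpect (fun=> c) = c.
Proof.
rewrite /cexpect !Rintegral_cst//; have -> : fine (P setT) = 1 by rewrite probability_setT.
by rewrite !mulr1; case: c.
Qed.

Lemma cintegrable_cst (c : R[i]) : cintegrable (fun=> c).
Proof.
by split; apply: bounded_measurable_integrable; exact: bounded_measurable_cst.
Qed.

Lemma cexpect_indep_mul d1 d2 (S : measurableType d1) (T : measurableType d2)
    (X : W -> S) (Y : W -> T) (f : S -> R[i]) (g : T -> R[i]) :
  measurable_fun setT X -> measurable_fun setT Y ->
  (forall A B, measurable A -> measurable B ->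
    P (X @^-1` A `&` Y @^-1` B) = (P (X @^-1` A) * P (Y @^-1` B))%E) ->
  cmeasurable f -> cmeasurable g ->
  cintegrable (fun w => f (X w)) -> cintegrable (fun w => g (Y w)) ->
  cintegrable (fun w => f (X w) * g (Y w)) /\
  cexpect (fun w => f (X w) * g (Y w)) =
    cexpect (fun w => f (X w)) * cexpect (fun w => g (Y w)).
Proof.
move=> mX mY ind [f1 f2] [g1 g2] [F1 F2] [G1 G2].
have [i11 e11] := integrable_Rintegral_indep_mul mX mY ind f1 g1 F1 G1.
have [i12 e12] := integrable_Rintegral_indep_mul mX mY ind f1 g2 F1 G2.
have [i21 e21] := integrable_Rintegral_indep_mul mX mY ind f2 g1 F2 G1.
have [i22 e22] := integrable_Rintegral_indep_mul mX mY ind f2 g2 F2 G2.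
have RM w : complex.Re (f (X w) * g (Y w)) = complex.Re (f (X w)) * complex.Re (g (Y w))
    - complex.Im (f (X w)) * complex.Im (g (Y w)) by case: (f _) (g _) => [a b] [c e].
have IM w : complex.Im (f (X w) * g (Y w)) = complex.Re (f (X w)) * complex.Im (g (Y w))
    + complex.Im (f (X w)) * complex.Re (g (Y w)) by case: (f _) (g _) => [a b] [c e].
rewrite /cintegrable /cexpect; split.
  split.
    by under [_ \o _]eq_fun do rewrite /= RM EFinB; exact: integrableB.
  by under [_ \o _]eq_fun do rewrite /= IM EFinD; exact: integrableD.
under eq_Rintegral do rewrite RM.
under [X in (_ +i* X)%C]eq_Rintegral do rewrite IM.
by rewrite RintegralB// RintegralD// e11 e12 e21 e22; simpc.
Qed.

End complex_expectation.

Section independent_product.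
Context d d' (W : measurableType d) (T : measurableType d') (R : realType)
  (P : probability W R) (Y : nat -> W -> T).
Hypothesis mY : forall k, measurable_fun setT (Y k).

Let measurable_preim k A : measurable A -> measurable (Y k @^-1` A).
Proof. by move=> mA; rewrite -[X in measurable X]setTI; exact: mY. Qed.

Lemma mutually_independentW N j : (j <= N)%N ->
  mutually_independent P N Y -> mutually_independent P j Y.
Proof.
move=> jN ind A mA.
have := ind (fun k => if (k < j)%N then A k else setT).
rewrite -(subnKC jN) !big_split_ord/=.
rewrite [X in _ `&` X]big1; last by move=> i _; rewrite ltnNge leq_addr/= preimage_setT.
rewrite [X in (_ * X)%E]big1; last first.
  by move=> i _; rewrite ltnNge leq_addr/= preimage_setT probability_setT.
rewrite setIT mule1 => h.
rewrite (eq_bigr (fun k : 'I_j => Y k @^-1` (if (k < j)%N then A k else setT))).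
  by rewrite h => [|k]; [apply: eq_bigr => k _; rewrite ltn_ord|case: ifP].
by move=> k _; rewrite ltn_ord.
Qed.

Section past.
Variables (N j : nat).
Hypothesis ind : mutually_independent P N Y.
Hypothesis jN : (j < N)%N.

(** Cylinder events of the first [j] variables, a class stable under intersection. Mapping [W] by
    the identity to the sigma-algebra that they generate makes a function of the past just a
    measurable function, without tuples of variables. *)
Let G : set (set W) := [set A | exists2 B : nat -> set T,
  (forall k, measurable (B k)) & A = \big[setI/setT]_(k < j) (Y k @^-1` B k)].

Let GI : setI_closed G.
Proof.
move=> _ _ [B mB ->] [C mC ->]; exists (fun k => B k `&` C k).
  by move=> k; exact: measurableI.
by rewrite -big_split/=; apply: eq_bigr => k _; rewrite preimage_setI.
Qed.

Let GT : G setT.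
Proof. by exists (fun=> setT) => //; rewrite big1// => k _; rewrite preimage_setT. Qed.

Let Gmeas A : G A -> measurable A.
Proof.
by move=> [B mB ->]; apply: bigsetI_measurable => k _; exact: measurable_preim.
Qed.

Let past : W -> g_sigma_algebraType G := id.

Let mpast : measurable_fun setT past.
Proof.
move=> _ A mA; rewrite setTI; apply: (@smallest_sub _ _ G (@measurable _ W)) mA => //.
exact: sigma_algebra_measurable.
Qed.

(** For fixed [D], both sides are finite measures in the past event; they agree on the cylinders, so
    uniqueness of measures extends the equality. *)
Let past_indep A B : measurable A -> measurable B ->
  P (past @^-1` A `&` Y j @^-1` B) = (P (past @^-1` A) * P (Y j @^-1` B))%E.
Proof.
move=> mA mB; set D := Y j @^-1` B.
have mD : measurable D by exact: measurable_preim.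
pose m1 : measure (g_sigma_algebraType G) R :=
  measure_function_pushforward__canonical__measure_function_Measure (mrestr P mD) mpast.
have Dfin : P D \is a fin_num by exact: fin_num_measure.
pose q : {nonneg R} := NngNum (fine_ge0 (measure_ge0 P D)).
pose past' : {mfun W >-> g_sigma_algebraType G} :=
  HB.pack past (isMeasurableFun.Build _ _ _ _ past mpast).
pose m2 : measure (g_sigma_algebraType G) R := mscale q (distribution P past').
have -> : P (past @^-1` A `&` D) = m1 A by [].
have m2E C : m2 C = (P (past @^-1` C) * P D)%E.
  by rewrite /m2/= /mscale/= fineK// muleC.
rewrite -m2E; apply: (@measure_unique _ R (g_sigma_algebraType G) G (fun=> setT)) => //.
- by rewrite bigcup_const.
- move=> _ [C mC ->]; rewrite m2E /m1/= /pushforward /mrestr/=.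
  have := mutually_independentW jN ind.
  move=> /(_ (fun k => if (k < j)%N then C k else B)).
  rewrite !big_ord_recr/= ltnn.
  rewrite (eq_bigr (fun k : 'I_j => Y k @^-1` C k)); last by move=> k _; rewrite ltn_ord.
  rewrite (eq_bigr (fun k : 'I_j => P (Y k @^-1` C k))); last by move=> k _; rewrite ltn_ord.
  move=> h; rewrite [LHS]h; last by move=> k; case: ifP.
  by congr (_ * _)%E; rewrite -(mutually_independentW (ltnW jN) ind mC).
- by move=> k; rewrite ltey_eq /m1/= /pushforward /mrestr/= preimage_setT setTI Dfin.
Qed.

Lemma cexpect_past (f : W -> R[i]) (g : T -> R[i]) :
  @cmeasurable R _ (g_sigma_algebraType G) f -> cmeasurable g ->
  cintegrable P f -> cintegrable P (fun w => g (Y j w)) ->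
  cintegrable P (fun w => f w * g (Y j w)) /\
  cexpect P (fun w => f w * g (Y j w)) = cexpect P f * cexpect P (fun w => g (Y j w)).
Proof. by move=> mf mg fi gi; exact: (cexpect_indep_mul mpast (mY j) past_indep). Qed.

Lemma cmeasurable_past k (g : T -> R[i]) : (k < j)%N -> cmeasurable g ->
  @cmeasurable R _ (g_sigma_algebraType G) (fun w => g (Y k w)).
Proof.
move=> kj mg; apply: (cmeasurable_comp (h := (Y k : g_sigma_algebraType G -> T))) => //.
move=> _ A mA; rewrite setTI.
apply: sub_sigma_algebra; exists (fun i => if i == k then A else setT).
  by move=> i; case: ifP.
rewrite (bigD1 (Ordinal kj))//= eqxx big1 ?setIT// => i.
by rewrite -val_eqE/= => /negbTE ->; rewrite preimage_setT.
Qed.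

End past.

Lemma cexpect_indep_prod N (f : nat -> T -> R[i]) :
  mutually_independent P N Y -> (forall k, cmeasurable (f k)) ->
  (forall k, (k < N)%N -> cintegrable P (fun w => f k (Y k w))) ->
  cintegrable P (fun w => \prod_(k < N) f k (Y k w)) /\
  cexpect P (fun w => \prod_(k < N) f k (Y k w)) =
    \prod_(k < N) cexpect P (fun w => f k (Y k w)).
Proof.
move=> ind mf intf.
suff H j : (j <= N)%N -> cintegrable P (fun w => \prod_(k < j) f k (Y k w)) /\
  cexpect P (fun w => \prod_(k < j) f k (Y k w)) =
    \prod_(k < j) cexpect P (fun w => f k (Y k w)) by exact: H.
elim: j => [_|j ih jN].
  under [X in cintegrable P X]eq_fun do rewrite big_ord0.
  under [X in cexpect P X]eq_fun do rewrite big_ord0.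
  by rewrite big_ord0 cexpect_cst; split => //; exact: cintegrable_cst.
have [i1 e1] := ih (ltnW jN).
under [X in cintegrable P X]eq_fun do rewrite big_ord_recr/=.
under [X in cexpect P X]eq_fun do rewrite big_ord_recr/=.
rewrite big_ord_recr/= -e1; apply: (cexpect_past ind jN) => //; last exact: intf.
apply: (@cmeasurable_prod _ _ (g_sigma_algebraType _)) => k.
exact: cmeasurable_past.
Qed.

End independent_product.

Section complex_expectation_facts.
Context d (W : measurableType d) (R : realType) (P : probability W R).
Implicit Types f g : W -> R[i].

Lemma cintegrableD f g : cintegrable P f -> cintegrable P g ->
  cintegrable P (fun w => f w + g w).
Proof.
move=> [f1 f2] [g1 g2]; split.
  by under [_ \o _]eq_fun do rewrite /= raddfD/= EFinD; exact: integrableD.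
by under [_ \o _]eq_fun do rewrite /= raddfD/= EFinD; exact: integrableD.
Qed.

Lemma cexpectD f g : cintegrable P f -> cintegrable P g ->
  cexpect P (fun w => f w + g w) = cexpect P f + cexpect P g.
Proof.
move=> [f1 f2] [g1 g2]; rewrite /cexpect.
under eq_Rintegral do rewrite raddfD/=.
under [X in (_ +i* X)%C]eq_Rintegral do rewrite raddfD/=.
by rewrite !RintegralD.
Qed.

Lemma cintegrable_scale (c : R[i]) (h : W -> R) : P.-integrable setT (EFin \o h) ->
  cintegrable P (fun w => c * (h w)%:C%C) /\
  cexpect P (fun w => c * (h w)%:C%C) = c * (\int[P]_w h w)%:C%C.
Proof.
case: c => a b ih.
have -> : (fun w => (a +i* b)%C * (h w)%:C%C) = (fun w => ((a * h w) +i* (b * h w))%C).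
  by apply/funext => w; simpc.
by split; [split; exact: integrable_scale|rewrite /cexpect !RintegralZl//; simpc].
Qed.

Lemma n1_cexpect_le f (g : W -> R) : cintegrable P f ->
  P.-integrable setT (EFin \o g) -> (forall w, n1 (f w) <= g w) ->
  n1 (cexpect P f) <= \int[P]_w g w.
Proof.
move=> [f1 f2] ig fg; rewrite /n1/=.
have nf1 : P.-integrable setT (EFin \o (fun w => `|complex.Re (f w)|)) by exact: integrable_norm.
have nf2 : P.-integrable setT (EFin \o (fun w => `|complex.Im (f w)|)) by exact: integrable_norm.
apply: (@le_trans _ _ (\int[P]_w (`|complex.Re (f w)| + `|complex.Im (f w)|))).
  by rewrite RintegralD// lerD// le_normr_Rintegral.
by apply: le_Rintegral => // [|w _]; [exact: (integrableD _ nf1 nf2)|exact: fg].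
Qed.

Lemma cintegrable_le f (g : W -> R) : cmeasurable f ->
  P.-integrable setT (EFin \o g) -> (forall w, n1 (f w) <= g w) -> cintegrable P f.
Proof.
move=> [m1 m2] ig fg; split.
  apply: le_integrable ig => //; first exact/measurable_EFinP.
  move=> w _ /=; rewrite lee_fin (le_trans _ (le_trans (fg w) (ler_norm _)))//.
  by rewrite /n1 lerDl.
apply: le_integrable ig => //; first exact/measurable_EFinP.
move=> w _ /=; rewrite lee_fin (le_trans _ (le_trans (fg w) (ler_norm _)))//.
by rewrite /n1 lerDr.
Qed.

Lemma cmeasurable_cexp d' (T : measurableType d') (z : R[i]) (h : T -> R) :
  measurable_fun setT h -> cmeasurable (fun t => cexp (z * (h t)%:C%C)).
Proof.
case: z => a b mh.
have E t : cexp ((a +i* b)%C * (h t)%:C%C) =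
    (expR (a * h t) * cos (b * h t) +i* (expR (a * h t) * sin (b * h t)))%C.
  by rewrite -cexpE; congr cexp; simpc.
have mc (c : R) : measurable_fun setT (fun t => c * h t) by exact: measurable_funM.
have me : measurable_fun setT (fun t => expR (a * h t)) by exact: measurableT_comp.
split; under eq_fun do rewrite E/=; apply: measurable_funM => //.
  apply: (measurableT_comp (f := @cos R)) => //.
  by apply: continuous_measurable_fun; exact: continuous_cos.
apply: (measurableT_comp (f := @sin R)) => //.
by apply: continuous_measurable_fun; exact: continuous_sin.
Qed.

End complex_expectation_facts.

(* The only consequence of the analytic cgf assumption that is used: a bound on
   the exponential moments of the standardized error, uniform in everything. *)
Definition exp_moment_bound d (W : measurableType d) (R : realType)
    (P : probability W R) (eta C : R) (Y : W -> R) : Prop :=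
  [/\ measurable_fun setT Y, P.-integrable setT (fun w => (expR (eta * `|Y w|))%:E),
    \int[P]_w expR (eta * `|Y w|) <= C & \int[P]_w Y w = 0].

(** * Moments and Taylor remainder under an exponential moment bound *)

Section exponential_moments.
Context {R : realType} (eta C : R).
Hypotheses (eta0 : 0 < eta).

Section one_variable.
Context d (W : measurableType d) (P : probability W R) (Y : W -> R).
Hypothesis hY : exp_moment_bound P eta C Y.

Let mY : measurable_fun setT Y. Proof. by case: hY. Qed.

Lemma integrable_exp_dom (h : W -> R) (c : R) : measurable_fun setT h ->
  (forall w, `|h w| <= c * expR (eta * `|Y w|)) ->
  P.-integrable setT (EFin \o h).
Proof.
case: hY => _ ie _ _ mh hc.
apply: le_integrable (integrable_scale c measurableT ie) => //.
  exact/measurable_EFinP.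
by move=> w _ /=; rewrite lee_fin (le_trans (hc w))// ler_norm.
Qed.

Lemma exp_dom_normX k w : `|Y w| ^+ k <= k`!%:R / eta ^+ k * expR (eta * `|Y w|).
Proof.
rewrite mulrAC ler_pdivlMr ?exprn_gt0// mulrC -exprMn.
by apply: exprn_le_exp; rewrite mulr_ge0// ltW.
Qed.

Lemma integrable_momentX k : P.-integrable setT (EFin \o (fun w => Y w ^+ k)).
Proof.
apply: (@integrable_exp_dom _ (k`!%:R / eta ^+ k)); first exact: measurable_funX.
by move=> w; rewrite normrX exp_dom_normX.
Qed.

Lemma momentX_le k : `|\int[P]_w (Y w ^+ k)| <= k`!%:R / eta ^+ k * C.
Proof.
have ik := integrable_momentX k; have [_ ie eC _] := hY.
apply: (le_trans (le_normr_Rintegral _ ik)) => //.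
apply: (@le_trans _ _ (\int[P]_w (k`!%:R / eta ^+ k * expR (eta * `|Y w|)))).
  apply: le_Rintegral => //; first exact: integrable_norm.
    exact: integrable_scale.
  by move=> w _; rewrite normrX exp_dom_normX.
rewrite RintegralZl// ler_wpM2l// divr_ge0// exprn_ge0// ltW//.
Qed.

Definition cmgf (z : R[i]) : R[i] := cexpect P (fun w => cexp (z * (Y w)%:C%C)).

Lemma n1_real_scale (z : R[i]) (y : R) : n1 (z * y%:C%C) = n1 z * `|y|.
Proof. by case: z => a b; rewrite /n1; simpc; rewrite !normrM mulrDl. Qed.

Lemma cintegrable_cmgf (z : R[i]) : `|complex.Re z| <= eta ->
  cintegrable P (fun w => cexp (z * (Y w)%:C%C)).
Proof.
move=> zeta; have [_ ie _ _] := hY.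
apply: (cintegrable_le (cmeasurable_cexp z mY) (integrable_scale 2 measurableT ie)).
move=> w; apply: (le_trans (n1_cexp_le _)); rewrite ler_wpM2l// ler_expR.
case: z zeta => a b /= az; rewrite mulr0 subr0.
by rewrite (le_trans (ler_norm _))// normrM ler_wpM2r.
Qed.

(** Integrates [cexp_taylor]; the linear term drops because [Y] is centered. The radius [eta / 4]
    keeps [exp (2 n1 z |Y|)] below [exp (eta |Y| / 2)], and the other half of [eta] absorbs [|Y|^4]
    at the cost [4! (2 / eta)^4]. *)
Lemma cmgf_taylor (z : R[i]) : n1 z <= eta / 4 ->
  n1 (cmgf z - (1 + (\int[P]_w (Y w ^+ 2))%:C%C * z ^+ 2 / 2
                  + (\int[P]_w (Y w ^+ 3))%:C%C * z ^+ 3 / 6)) <=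
  10 * (24 * (2 / eta) ^+ 4) * C * n1 z ^+ 4.
Proof.
move=> ze; have [_ ie eC EY] := hY.
pose p (w : W) : R[i] := 1 + (z * (Y w)%:C%C + ((z ^+ 2 / 2) * (Y w ^+ 2)%:C%C
  + (z ^+ 3 / 6) * (Y w ^+ 3)%:C%C)).
have iY1 : P.-integrable setT (EFin \o Y).
  by have := integrable_momentX 1; under [_ \o _]eq_fun do rewrite /= expr1.
have [i1 e1] := cintegrable_scale z iY1.
have [i2 e2] := cintegrable_scale (z ^+ 2 / 2) (integrable_momentX 2).
have [i3 e3] := cintegrable_scale (z ^+ 3 / 6) (integrable_momentX 3).
have i0 := @cintegrable_cst _ W R P 1.
have i23 := cintegrableD i2 i3; have i123 := cintegrableD i1 i23.
have ip : cintegrable P p := cintegrableD i0 i123.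
have ep : cexpect P p = 1 + (\int[P]_w (Y w ^+ 2))%:C%C * z ^+ 2 / 2
    + (\int[P]_w (Y w ^+ 3))%:C%C * z ^+ 3 / 6.
  rewrite (cexpectD i0 i123) cexpect_cst (cexpectD i1 i23) (cexpectD i2 i3) e1 e2 e3 EY.
  by rewrite mulr0 add0r; ring.
have iz : cintegrable P (fun w => cexp (z * (Y w)%:C%C)).
  apply: cintegrable_cmgf; rewrite (le_trans (Re_le_n1 z))// (le_trans ze)//.
  by rewrite ler_pdivrMr// ler_peMr// ?ler1n// ltW.
have iNp : cintegrable P (fun w => - p w).
  case: ip => p1 p2; split.
    under [_ \o _]eq_fun do rewrite /= raddfN/= EFinN; exact: integrableN.
  under [_ \o _]eq_fun do rewrite /= raddfN/= EFinN; exact: integrableN.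
have eNp : cexpect P (fun w => - p w) = - cexpect P p.
  have := cexpectD ip iNp; rewrite (_ : (fun w => p w + - p w) = (fun=> 0)); last first.
    by apply/funext => w; rewrite subrr.
  by rewrite cexpect_cst => h; apply/eqP; rewrite -addr_eq0 addrC -h.
rewrite -ep -eNp -cexpectD//.
pose c := 10 * (24 * (2 / eta) ^+ 4) * n1 z ^+ 4.
have e40 : 0 <= (2 / eta) ^+ 4 by apply: exprn_ge0; apply: divr_ge0 => //; exact: ltW.
have c0 : 0 <= c.
  exact: mulr_ge0 (mulr_ge0 (ler0n _ 10) (mulr_ge0 (ler0n _ 24) e40)) (exprn_ge0 4 (n1_ge0 z)).
apply: (@le_trans _ _ (\int[P]_w (c * expR (eta * `|Y w|)))); last first.
  by rewrite RintegralZl// [leRHS]mulrAC -/c ler_wpM2l.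
apply: n1_cexpect_le; first exact: cintegrableD.
  exact: integrable_scale.
move=> w; set zy := z * (Y w)%:C%C.
have -> : cexp zy - p w = cexp zy - (1 + zy + zy ^+ 2 / 2 + zy ^+ 3 / 6).
  by rewrite /p /zy !rmorphXn/= !exprMn; ring.
apply: (le_trans (cexp_taylor zy)).
rewrite /zy n1_real_scale exprMn.
set n := n1 z in ze c c0 *; set y := `|Y w|.
have n0 : 0 <= n by exact: n1_ge0.
have y0 : 0 <= y by exact: normr_ge0.
have h1 : expR (2 * (n * y)) <= expR (eta / 2 * y).
  by rewrite ler_expR mulrA ler_wpM2r//; move: ze; lra.
have h2 : y ^+ 4 <= 24 * (2 / eta) ^+ 4 * expR (eta / 2 * y).
  have := @exprn_le_exp R (eta / 2 * y) 4; rewrite mulr_ge0 ?divr_ge0 ?(ltW eta0)//.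
  move=> /(_ isT); rewrite !factS fact0 !muln1 => h.
  have -> : y ^+ 4 = (eta / 2 * y) ^+ 4 * (2 / eta) ^+ 4.
    by rewrite -exprMn; congr (_ ^+ _); field; rewrite gt_eqF.
  by rewrite [leRHS]mulrAC ler_wpM2r.
have -> : expR (eta * y) = expR (eta / 2 * y) * expR (eta / 2 * y).
  by rewrite -expRD; congr expR; field.
rewrite /c; have n40 := exprn_ge0 4 n0.
have : y ^+ 4 * expR (2 * (n * y)) <=
    (24 * (2 / eta) ^+ 4 * expR (eta / 2 * y)) * expR (eta / 2 * y).
  by rewrite ler_pM ?exprn_ge0 ?expR_ge0.
move: (y ^+ 4) (expR (2 * (n * y))) (expR (eta / 2 * y)) ((2 / eta) ^+ 4) => a b e f h.
have := ler_wpM2l (mulr_ge0 (ler0n _ 10) n40) h.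
by congr (_ <= _); ring.
Qed.

End one_variable.

End exponential_moments.

(** * Expansion of the complex mgf *)

Section n1_bounds.
Context {R : realType}.
Implicit Types (z w : R[i]) (a b : R).

Lemma n1M_le z w a b : n1 z <= a -> n1 w <= b -> n1 (z * w) <= a * b.
Proof. by move=> za wb; rewrite (le_trans (n1M z w))// ler_pM ?n1_ge0. Qed.

Lemma n1D_le z w a b : n1 z <= a -> n1 w <= b -> n1 (z + w) <= a + b.
Proof. by move=> za wb; rewrite (le_trans (n1D z w))// lerD. Qed.

Lemma n1_scale (x : R) z : n1 (x%:C%C * z) = `|x| * n1 z.
Proof. by rewrite mulrC n1_real_scale mulrC. Qed.

Lemma n1_natmul (n : nat) z : n1 (n%:R * z) = n%:R * n1 z.
Proof. by rewrite -(rmorph_nat (real_complex R)) n1_scale ger0_norm. Qed.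

Lemma real_complex_inv_nat (n : nat) : (n%:R : R[i])^-1 = ((n%:R)^-1 : R)%:C%C.
Proof. by rewrite fmorphV rmorph_nat. Qed.

Lemma cexp_taylor2 w b : n1 w <= b ->
  n1 (cexp w - 1 - w) <= (1 + b + 10 * b ^+ 2 * expR (2 * b)) * n1 w ^+ 2.
Proof.
move=> wb; have n0 := n1_ge0 w; set n := n1 w in wb n0 *.
have b0 : 0 <= b by exact: le_trans wb.
have -> : cexp w - 1 - w = (cexp w - (1 + w + w ^+ 2 / 2 + w ^+ 3 / 6))
    + ((2^-1)%:C%C * w ^+ 2 + (6^-1)%:C%C * w ^+ 3).
  by rewrite -!real_complex_inv_nat; ring.
have h1 := cexp_taylor w; rewrite -/n in h1.
have h2 : n1 ((2^-1)%:C%C * w ^+ 2) <= n ^+ 2.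
  rewrite n1_scale ger0_norm ?invr_ge0// (le_trans (ler_wpM2l _ (n1X w 2)))//.
  by rewrite -/n; have := exprn_ge0 2 n0; lra.
have h3 : n1 ((6^-1)%:C%C * w ^+ 3) <= b * n ^+ 2.
  rewrite n1_scale ger0_norm ?invr_ge0// (le_trans (ler_wpM2l _ (n1X w 3)))//.
  rewrite -/n exprS; have := ler_wpM2r (exprn_ge0 2 n0) wb.
  by have := mulr_ge0 n0 (exprn_ge0 2 n0); lra.
have h4 : 10 * n ^+ 4 * expR (2 * n) <= 10 * b ^+ 2 * expR (2 * b) * n ^+ 2.
  have : n ^+ 2 * expR (2 * n) <= b ^+ 2 * expR (2 * b).
    by rewrite ler_pM ?exprn_ge0 ?expR_ge0 ?ler_expR ?ler_wpM2l// lerXn2r ?nnegrE.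
  move=> h; have := ler_wpM2l (mulr_ge0 (ler0n _ 10) (exprn_ge0 2 n0)) h.
  by congr (_ <= _); ring.
apply: (le_trans (n1D_le (le_trans h1 h4) (n1D_le h2 h3))).
by rewrite le_eqVlt; apply/orP; left; apply/eqP; ring.
Qed.

Lemma Re_scale (x : R) z : complex.Re (x%:C%C * z) = x * complex.Re z.
Proof. by case: z => a b; simpc. Qed.

Lemma ReD z w : complex.Re (z + w) = complex.Re z + complex.Re w.
Proof. by case: z w => [a b] [c e]. Qed.

Lemma csum (I : Type) (s : seq I) (a b : I -> R) :
  \sum_(i <- s) (a i +i* b i)%C = ((\sum_(i <- s) a i) +i* (\sum_(i <- s) b i))%C.
Proof.
elim: s => [|i s ih]; first by rewrite !big_nil.
by rewrite !big_cons ih; simpc.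
Qed.

End n1_bounds.

Section expansions.
Context {R : realType} (eta C : R).
Hypotheses (eta0 : 0 < eta).

(** The constants are chosen before the probability space and [Y]; uniformity over [n], [B] and the
    states rests on this order of quantifiers. The absolute value of [C] appears because its sign is
    not assumed, and [rho <= 1] lets higher powers be absorbed by lower ones. *)
Lemma cmgf_expansion1 : exists A rho : R, [/\ 0 <= A, 0 < rho &
  forall d (W : measurableType d) (P : probability W R) (Y : W -> R),
  exp_moment_bound P eta C Y -> forall z, n1 z <= rho ->
  n1 (cmgf P Y z - 1 - (\int[P]_w (Y w ^+ 2))%:C%C * z ^+ 2 / 2) <= A * n1 z ^+ 3 /\
  n1 (cmgf P Y z - 1) <= A * n1 z ^+ 2].
Proof.
pose V := 2%N`!%:R / eta ^+ 2 * `|C|; pose U := 3%N`!%:R / eta ^+ 3 * `|C|.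
pose A4 := 10 * (24 * (2 / eta) ^+ 4) * `|C|.
have V0 : 0 <= V by rewrite mulr_ge0// divr_ge0// exprn_ge0// ltW.
have U0 : 0 <= U by rewrite mulr_ge0// divr_ge0// exprn_ge0// ltW.
have e40 : 0 <= (2 / eta) ^+ 4 by apply: exprn_ge0; apply: divr_ge0 => //; exact: ltW.
have A40 : 0 <= A4 by exact: mulr_ge0 (mulr_ge0 (ler0n _ 10) (mulr_ge0 (ler0n _ 24) e40)) _.
exists (U + A4 + V), (Num.min 1 (eta / 4)); split.
- by rewrite !addr_ge0.
- by rewrite lt_min ltr01 divr_gt0.
move=> d W P Y hY z; rewrite le_min => /andP[z1 ze].
have := cmgf_taylor eta0 hY ze.
set v := \int[P]_w _; set u := \int[P]_w _; move=> ht.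
have n0 := n1_ge0 z.
have hv : `|v| <= V.
  apply: (le_trans (momentX_le eta0 hY 2)); rewrite ler_wpM2l ?ler_norm//.
  by rewrite divr_ge0// exprn_ge0// ltW.
have hu : `|u| <= U.
  apply: (le_trans (momentX_le eta0 hY 3)); rewrite ler_wpM2l ?ler_norm//.
  by rewrite divr_ge0// exprn_ge0// ltW.
have n20 := exprn_ge0 2 n0; have n30 := exprn_ge0 3 n0; have n40 := exprn_ge0 4 n0.
have n32 : n1 z ^+ 3 <= n1 z ^+ 2 by rewrite exprS ler_piMl.
have n43 : n1 z ^+ 4 <= n1 z ^+ 3 by rewrite exprS ler_piMl.
have h4 : 10 * (24 * (2 / eta) ^+ 4) * C * n1 z ^+ 4 <= A4 * n1 z ^+ 3.
  apply: (@le_trans _ _ (A4 * n1 z ^+ 4)); last exact: ler_wpM2l.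
  rewrite ler_wpM2r// ler_wpM2l ?ler_norm//.
  exact: mulr_ge0 (ler0n _ 10) (mulr_ge0 (ler0n _ 24) e40).
have h3 : n1 (u%:C%C * z ^+ 3 / 6) <= U * n1 z ^+ 3.
  rewrite real_complex_inv_nat mulrC mulrA -rmorphM/= n1_scale.
  rewrite normrM ger0_norm ?invr_ge0//.
  have := ler_pM (normr_ge0 u) (n1_ge0 (z ^+ 3)) hu (n1X z 3).
  by have := mulr_ge0 U0 n30; lra.
have h2 : n1 (v%:C%C * z ^+ 2 / 2) <= V * n1 z ^+ 2.
  rewrite real_complex_inv_nat mulrC mulrA -rmorphM/= n1_scale.
  rewrite normrM ger0_norm ?invr_ge0//.
  have := ler_pM (normr_ge0 v) (n1_ge0 (z ^+ 2)) hv (n1X z 2).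
  by have := mulr_ge0 V0 n20; lra.
have first : n1 (cmgf P Y z - 1 - v%:C%C * z ^+ 2 / 2) <= (U + A4) * n1 z ^+ 3.
  have -> : cmgf P Y z - 1 - v%:C%C * z ^+ 2 / 2 =
      u%:C%C * z ^+ 3 / 6 + (cmgf P Y z - (1 + v%:C%C * z ^+ 2 / 2 + u%:C%C * z ^+ 3 / 6)).
    by ring.
  by rewrite mulrDl; apply: n1D_le => //; exact: le_trans ht h4.
split.
  by apply: (le_trans first); rewrite ler_wpM2r// lerDl.
have -> : cmgf P Y z - 1 = v%:C%C * z ^+ 2 / 2 + (cmgf P Y z - 1 - v%:C%C * z ^+ 2 / 2) by ring.
apply: (le_trans (n1D_le h2 first)); rewrite [leRHS]mulrDl addrC lerD2r.
by rewrite ler_wpM2l// addr_ge0.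
Qed.

(** Removing the Gaussian factor cancels the quadratic term, so that [r] starts at order three, with
    the third moment as coefficient. *)
Lemma cmgf_expansion2 : exists A rho : R, [/\ 0 <= A, 0 < rho &
  forall d (W : measurableType d) (P : probability W R) (Y : W -> R),
  exp_moment_bound P eta C Y -> forall z, n1 z <= rho ->
  let r := cmgf P Y z * cexp (- ((\int[P]_w (Y w ^+ 2))%:C%C * z ^+ 2 / 2)) - 1 in
  n1 (r - (\int[P]_w (Y w ^+ 3))%:C%C * z ^+ 3 / 6) <= A * n1 z ^+ 4 /\
  n1 r <= A * n1 z ^+ 3].
Proof.
pose V := 2%N`!%:R / eta ^+ 2 * `|C|; pose U := 3%N`!%:R / eta ^+ 3 * `|C|.
pose A4 := 10 * (24 * (2 / eta) ^+ 4) * `|C|.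
have V0 : 0 <= V by rewrite mulr_ge0// divr_ge0// exprn_ge0// ltW.
have U0 : 0 <= U by rewrite mulr_ge0// divr_ge0// exprn_ge0// ltW.
have e40 : 0 <= (2 / eta) ^+ 4 by apply: exprn_ge0; apply: divr_ge0 => //; exact: ltW.
have A40 : 0 <= A4 by exact: mulr_ge0 (mulr_ge0 (ler0n _ 10) (mulr_ge0 (ler0n _ 24) e40)) _.
pose D1 := 1 + V + 10 * V ^+ 2 * expR (2 * V).
have D10 : 0 <= D1.
  by rewrite !addr_ge0// mulr_ge0 ?expR_ge0// mulr_ge0 ?exprn_ge0.
pose D := D1 * V ^+ 2.
have D0 : 0 <= D by rewrite mulr_ge0 ?exprn_ge0.
pose E := V ^+ 2 + U * V + (A4 * (1 + V + D) + D * (1 + V + U)).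
have E0 : 0 <= E.
  have VD0 : 0 <= 1 + V + D by rewrite !addr_ge0.
  have VU0 : 0 <= 1 + V + U by rewrite !addr_ge0.
  rewrite /E; apply: addr_ge0; apply: addr_ge0.
  - exact: exprn_ge0.
  - exact: mulr_ge0.
  - exact: mulr_ge0.
  - exact: mulr_ge0.
exists (E + U), (Num.min 1 (eta / 4)); split.
- by rewrite addr_ge0.
- by rewrite lt_min ltr01 divr_gt0.
move=> d W P Y hY z; rewrite le_min => /andP[z1 ze].
have := cmgf_taylor eta0 hY ze.
set v := \int[P]_w _; set u := \int[P]_w _; move=> ht.
have n0 := n1_ge0 z.
have hv : `|v| <= V.
  apply: (le_trans (momentX_le eta0 hY 2)); rewrite ler_wpM2l ?ler_norm//.
  by rewrite divr_ge0// exprn_ge0// ltW.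
have hu : `|u| <= U.
  apply: (le_trans (momentX_le eta0 hY 3)); rewrite ler_wpM2l ?ler_norm//.
  by rewrite divr_ge0// exprn_ge0// ltW.
have n20 := exprn_ge0 2 n0; have n30 := exprn_ge0 3 n0; have n40 := exprn_ge0 4 n0.
have n2le1 : n1 z ^+ 2 <= 1 by rewrite exprn_ile1.
have n3le1 : n1 z ^+ 3 <= 1 by rewrite exprn_ile1.
have n4le1 : n1 z ^+ 4 <= 1 by rewrite exprn_ile1.
have n43 : n1 z ^+ 4 <= n1 z ^+ 3 by rewrite exprS ler_piMl.
set w := - (v%:C%C * z ^+ 2 / 2); pose M3 := u%:C%C * z ^+ 3 / 6.
pose E1 := cmgf P Y z - (1 + v%:C%C * z ^+ 2 / 2 + M3).
pose E2 := cexp w - 1 - w.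
have h1 : n1 E1 <= A4 * n1 z ^+ 4.
  apply: (le_trans ht); rewrite ler_wpM2r// ler_wpM2l ?ler_norm//.
  exact: mulr_ge0 (ler0n _ 10) (mulr_ge0 (ler0n _ 24) e40).
have h3 : n1 M3 <= U * n1 z ^+ 3.
  rewrite /M3 real_complex_inv_nat mulrC mulrA -rmorphM/= n1_scale.
  rewrite normrM ger0_norm ?invr_ge0//.
  have := ler_pM (normr_ge0 u) (n1_ge0 (z ^+ 3)) hu (n1X z 3).
  by have := mulr_ge0 U0 n30; lra.
have hw : n1 w <= V * n1 z ^+ 2.
  rewrite /w n1N real_complex_inv_nat mulrC mulrA -rmorphM/= n1_scale.
  rewrite normrM ger0_norm ?invr_ge0//.
  have := ler_pM (normr_ge0 v) (n1_ge0 (z ^+ 2)) hv (n1X z 2).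
  by have := mulr_ge0 V0 n20; lra.
have hwV : n1 w <= V by rewrite (le_trans hw)// ler_piMr.
have hw2 : n1 w ^+ 2 <= V ^+ 2 * n1 z ^+ 4.
  have -> : V ^+ 2 * n1 z ^+ 4 = (V * n1 z ^+ 2) ^+ 2 by ring.
  by rewrite lerXn2r ?nnegrE ?n1_ge0// mulr_ge0.
have h2 : n1 E2 <= D * n1 z ^+ 4.
  apply: (le_trans (cexp_taylor2 hwV)); rewrite -/D1.
  have -> : D * n1 z ^+ 4 = D1 * (V ^+ 2 * n1 z ^+ 4) by rewrite /D mulrA.
  exact: ler_wpM2l.
have hM31 : n1 M3 <= U by rewrite (le_trans h3)// ler_piMr.
have hE21 : n1 E2 <= D by rewrite (le_trans h2)// ler_piMr.
have h11 : n1 (1 : R[i]) <= 1 by rewrite n1_1.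
(* Expansion of [(1 - w + M3 + E1) (1 + w + E2)], where [w] has order 2, [M3] order 3 and both
   errors order 4: the terms [w] cancel and everything listed has order at least 4. *)
set r := _ - 1; have rE : r - M3 = (- w ^+ 2 + M3 * w) +
    (E1 * (1 + w + E2) + E2 * (1 - w + M3)).
  have -> : r = (1 - w + M3 + E1) * (1 + w + E2) - 1.
    rewrite /r -/w; congr (_ * _ - 1); first by rewrite /E1 /w; ring.
    by rewrite /E2; ring.
  by ring.
have hr : n1 (r - M3) <= E * n1 z ^+ 4.
  rewrite rE; have -> : E * n1 z ^+ 4 = (V ^+ 2 * n1 z ^+ 4 + U * V * n1 z ^+ 4)
      + (A4 * (1 + V + D) * n1 z ^+ 4 + D * (1 + V + U) * n1 z ^+ 4).
    by rewrite /E; ring.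
  apply: n1D_le; apply: n1D_le.
  - by rewrite n1N (le_trans (n1X w 2)).
  - apply: (le_trans (n1M_le h3 hw)).
    have -> : U * n1 z ^+ 3 * (V * n1 z ^+ 2) = U * V * (n1 z * n1 z ^+ 4) by ring.
    by apply: ler_wpM2l; [exact: mulr_ge0|exact: ler_piMl].
  - by rewrite mulrAC; apply: n1M_le => //; apply: n1D_le => //; exact: n1D_le.
  - rewrite mulrAC; apply: n1M_le => //; apply: n1D_le => //; apply: n1D_le => //.
    by rewrite n1N.
split; first by rewrite (le_trans hr)// ler_wpM2r// lerDl.
have -> : r = (r - M3) + M3 by rewrite subrK.
rewrite mulrDl; apply: n1D_le => //; rewrite (le_trans hr)//.
by rewrite ler_wpM2l.
Qed.

(** Each factor differs from 1 by order [q^2], so the exponent in [n1_prodX_expand] has order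
    [N q^2]; the hypothesis on it keeps the exponential there bounded. *)
Lemma uncorrected_expansion (K : nat) : exists A rho : R, [/\ 0 <= A, 0 < rho &
  forall d (W : measurableType d) (P : probability W R) (Y : W -> R),
  exp_moment_bound P eta C Y -> forall (N : nat) (q : R),
  0 <= q <= rho -> N%:R * q ^+ 2 <= 1 ->
  n1 (\prod_(k < K) cmgf P Y (- q)%:C%C ^+ N
    - (1 + (K%:R * (N%:R * q ^+ 2 * (\int[P]_w (Y w ^+ 2)) / 2)))%:C%C) <=
  A * (N%:R * q ^+ 3 + (N%:R * q ^+ 2) ^+ 2)].
Proof.
have [A [rho [A0 rho0 H]]] := cmgf_expansion1.
exists (K%:R * A + (K%:R * A) ^+ 2 * expR (K%:R * A)), rho; split => //.
  by rewrite addr_ge0 ?mulr_ge0 ?expR_ge0 ?exprn_ge0 ?mulr_ge0.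
move=> d W P Y hY N q /andP[q0 qrho] Nq.
have nq : n1 (- q)%:C%C = q by rewrite n1_real normrN ger0_norm.
have := H _ _ _ _ hY (- q)%:C%C; rewrite nq => /(_ qrho).
set m := cmgf P Y _; set v := \int[P]_w _; move=> [h3 h2].
have NA0 : 0 <= N%:R * q ^+ 2 by rewrite mulr_ge0// exprn_ge0.
have := @n1_prodX_expand R K N (fun=> m - 1) (K%:R * A * (N%:R * q ^+ 2)).
have sE (V : pzRingType) (x : V) : \sum_(k < K) x = K%:R * x.
  by rewrite sumr_const card_ord mulr_natl.
rewrite !sE => h.
have {}h : n1 (\prod_(k < K) m ^+ N - 1 - N%:R * (K%:R * (m - 1))) <=
    (K%:R * A * (N%:R * q ^+ 2)) ^+ 2 * expR (K%:R * A * (N%:R * q ^+ 2)).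
  have -> : \prod_(k < K) m ^+ N = \prod_(k < K) (1 + (m - 1)) ^+ N.
    by apply: eq_bigr => k _; rewrite addrC subrK.
  apply: h; have -> : K%:R * A * (N%:R * q ^+ 2) = N%:R * (K%:R * (A * q ^+ 2)) by ring.
  by rewrite !ler_wpM2l.
have -> : \prod_(k < K) m ^+ N - (1 + K%:R * (N%:R * q ^+ 2 * v / 2))%:C%C =
  (\prod_(k < K) m ^+ N - 1 - N%:R * (K%:R * (m - 1))) +
  N%:R * (K%:R * (m - 1 - v%:C%C * (- q)%:C%C ^+ 2 / 2)).
  rewrite real_complex_inv_nat.
  rewrite !(rmorphM, rmorphD, rmorphXn, rmorphN, rmorph_nat, rmorph1)/=.
  by rewrite ?rmorph1; ring.
rewrite [leRHS]mulrDr [leRHS]addrC; apply: n1D_le.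
  apply: (le_trans h); rewrite exprMn mulrAC ler_wpM2r ?exprn_ge0//.
  rewrite ler_wpDl ?mulr_ge0// ler_wpM2l ?exprn_ge0 ?mulr_ge0// ler_expR.
  by rewrite ler_piMr// mulr_ge0.
rewrite !n1_natmul; apply: (@le_trans _ _ (N%:R * (K%:R * (A * q ^+ 3)))).
  by rewrite !ler_wpM2l.
have -> : N%:R * (K%:R * (A * q ^+ 3)) = K%:R * A * (N%:R * q ^+ 3) by ring.
rewrite ler_wpM2r ?mulr_ge0 ?exprn_ge0// lerDl.
by rewrite mulr_ge0 ?expR_ge0 ?exprn_ge0 ?mulr_ge0.
Qed.

(* With zeta_k = - q (1 - i y_k), sum_k zeta_k^2 = 0 removes the variance and the
   real part of sum_k zeta_k^3 equals 2 K q^3. *)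
Lemma corrected_expansion (K : nat) : exists A rho : R, [/\ 0 <= A, 0 < rho &
  forall d (W : measurableType d) (P : probability W R) (Y : W -> R),
  exp_moment_bound P eta C Y -> forall (N : nat) (q : R) (y : nat -> R),
  0 <= q <= rho -> N%:R * q ^+ 3 <= 1 ->
  \sum_(k < K) y k = 0 -> \sum_(k < K) y k ^+ 2 = K%:R ->
  `|complex.Re (\prod_(k < K) cmgf P Y ((- q)%:C * (1 -i* y k))%C ^+ N)
    - (1 + K%:R * (N%:R * q ^+ 3 * (\int[P]_w (Y w ^+ 3)) / 3))| <=
  A * (N%:R * q ^+ 4 + (N%:R * q ^+ 3) ^+ 2)].
Proof.
have [A [rho [A0 rho0 H]]] := cmgf_expansion2.
(* Bounds [n1 (1 - i y_k)]: the constraint [sum_k y_k^2 = K] gives [|y_k| <= K]. *)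
pose k1 : R := K.+1%:R.
have k10 : 0 <= k1 by [].
exists (K%:R * A * k1 ^+ 4 + (K%:R * A * k1 ^+ 3) ^+ 2 * expR (K%:R * A * k1 ^+ 3)), (rho / k1).
have B0 : 0 <= K%:R * A * k1 ^+ 3 by rewrite !mulr_ge0 ?exprn_ge0.
have B40 : 0 <= K%:R * A * k1 ^+ 4 by rewrite !mulr_ge0 ?exprn_ge0.
split.
- by rewrite addr_ge0// mulr_ge0 ?expR_ge0 ?exprn_ge0.
- by rewrite divr_gt0// ltr0n.
move=> d W P Y hY N q y /andP[q0 qrho] Nq y1 y2.
pose z k : R[i] := ((- q)%:C * (1 -i* y k))%C.
have yK k : (k < K)%N -> `|y k| <= K%:R.
  move=> kK; have K1 : 1 <= K%:R :> R by rewrite ler1n (leq_ltn_trans _ kK).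
  rewrite -(@ler_pXn2r _ 2)// ?nnegrE// real_normK ?num_real//.
  apply: (@le_trans _ _ K%:R); last by rewrite expr2 ler_peMl.
  rewrite -y2 (bigD1 (Ordinal kK))//= lerDl sumr_ge0// => i _.
  exact: sqr_ge0.
have nz k : (k < K)%N -> n1 (z k) <= q * k1.
  move=> kK; rewrite /z n1_scale normrN ger0_norm// ler_wpM2l//.
  by rewrite /n1/= normrN normr1 /k1 -natr1 addrC lerD2r yK.
have zrho k : (k < K)%N -> n1 (z k) <= rho.
  by move=> /nz/le_trans; apply; rewrite -ler_pdivlMr// ltr0n.
set u := \int[P]_w _; pose v := \int[P]_w (Y w ^+ 2).
pose ww k := - (v%:C%C * z k ^+ 2 / 2).
pose r k := cmgf P Y (z k) * cexp (ww k) - 1.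
have rb k : (k < K)%N -> n1 (r k - u%:C%C * z k ^+ 3 / 6) <= A * n1 (z k) ^+ 4 /\
    n1 (r k) <= A * n1 (z k) ^+ 3.
  by move=> kK; exact: (H _ _ _ _ hY _ (zrho _ kK)).
have zE k : z k = (- q +i* (q * y k))%C.
  by rewrite /z; simpc.
have sz2 : \sum_(k < K) z k ^+ 2 = 0.
  have zz k : z k ^+ 2 = ((q ^+ 2 - q ^+ 2 * y k ^+ 2) +i* (- 2 * q ^+ 2 * y k))%C.
    by rewrite zE expr2; simpc; congr (_ +i* _)%C; ring.
  under eq_bigr do rewrite zz.
  rewrite csum sumrB sumr_const card_ord -!mulr_sumr y1 y2 !mulr0.
  by rewrite [_ * K%:R]mulr_natr subrr.
have sz3 : complex.Re (\sum_(k < K) z k ^+ 3) = 2 * K%:R * q ^+ 3.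
  have zz k : z k ^+ 3 = ((3 * q ^+ 3 * y k ^+ 2 - q ^+ 3) +i*
      (3 * q ^+ 3 * y k - q ^+ 3 * y k ^+ 3))%C.
    by rewrite zE !exprS expr0 mulr1; simpc; congr (_ +i* _)%C; ring.
  under eq_bigr do rewrite zz.
  by rewrite csum/= sumrB sumr_const card_ord -mulr_sumr y2 -[_ *+ K]mulr_natl; ring.
(* The Gaussian factors multiply to [exp 0], so they can be inserted at no cost. With remainders of
   order three, a bound on [N q^3] suffices and [N q^2] may be large. *)
have prodE : \prod_(k < K) cmgf P Y (z k) ^+ N = \prod_(k < K) (1 + r k) ^+ N.
  have : \prod_(k < K) cexp (ww k) = 1.
    rewrite -cexp_sum (_ : \sum_(k < K) ww k = 0) ?cexp0//.
    by rewrite /ww sumrN -mulr_suml -mulr_sumr sz2 mulr0 mul0r oppr0.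
  move=> h; rewrite !prodrXl; congr (_ ^+ N).
  under [RHS]eq_bigr do rewrite /r addrC subrK.
  by rewrite big_split/= h mulr1.
have h := @n1_prodX_expand R K N (fun k => r k) (K%:R * A * k1 ^+ 3 * (N%:R * q ^+ 3)).
have {}h : n1 (\prod_(k < K) (1 + r k) ^+ N - 1 - N%:R * \sum_(k < K) r k) <=
    (K%:R * A * k1 ^+ 3 * (N%:R * q ^+ 3)) ^+ 2 * expR (K%:R * A * k1 ^+ 3 * (N%:R * q ^+ 3)).
  apply: h; have -> : K%:R * A * k1 ^+ 3 * (N%:R * q ^+ 3) =
      N%:R * \sum_(k < K) (A * (q * k1) ^+ 3).
    by rewrite sumr_const card_ord -[_ *+ K]mulr_natl exprMn; ring.
  rewrite ler_wpM2l//; apply: ler_sum => k _.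
  rewrite (le_trans (rb k (ltn_ord k)).2)// ler_wpM2l// lerXn2r ?nnegrE ?n1_ge0//.
    by rewrite mulr_ge0.
  exact: nz.
have rest : n1 (N%:R * \sum_(k < K) (r k - u%:C%C * z k ^+ 3 / 6)) <=
    K%:R * A * k1 ^+ 4 * (N%:R * q ^+ 4).
  rewrite n1_natmul.
  have -> : K%:R * A * k1 ^+ 4 * (N%:R * q ^+ 4) =
      N%:R * \sum_(k < K) (A * (q * k1) ^+ 4).
    by rewrite sumr_const card_ord -[_ *+ K]mulr_natl exprMn; ring.
  rewrite ler_wpM2l// (le_trans (n1_sum _ _))//; apply: ler_sum => k _.
  rewrite (le_trans (rb k (ltn_ord k)).1)// ler_wpM2l// lerXn2r ?nnegrE ?n1_ge0//.
    by rewrite mulr_ge0.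
  exact: nz.
have Rere : complex.Re (N%:R * (u%:C%C / 6 * \sum_(k < K) z k ^+ 3)) =
    K%:R * (N%:R * q ^+ 3 * u / 3).
  rewrite real_complex_inv_nat -(rmorph_nat (real_complex R)) -rmorphM/= !Re_scale.
  by rewrite sz3; field.
have sumE : \sum_(k < K) (r k - u%:C%C * z k ^+ 3 / 6) =
    \sum_(k < K) r k - u%:C%C / 6 * \sum_(k < K) z k ^+ 3.
  by rewrite sumrB mulr_sumr; congr (_ - _); apply: eq_bigr => k _; ring.
rewrite -/z prodE.
have -> : \prod_(k < K) (1 + r k) ^+ N = (\prod_(k < K) (1 + r k) ^+ N - 1 - N%:R * \sum_(k < K) r k)
  + N%:R * \sum_(k < K) (r k - u%:C%C * z k ^+ 3 / 6)
  + (1 + N%:R * (u%:C%C / 6 * \sum_(k < K) z k ^+ 3)).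
  by rewrite sumE; ring.
set a := _ - 1 - _ in h *; set b := N%:R * _ in rest *.
rewrite (ReD (a + b)) (ReD a) (ReD 1) Rere addrK.
rewrite (le_trans (ler_normD _ _))// [leRHS]mulrDr [leRHS]addrC lerD//.
  apply: (le_trans (Re_le_n1 _)); apply: (le_trans h).
  rewrite exprMn mulrAC ler_wpM2r ?exprn_ge0//; first by rewrite mulr_ge0// exprn_ge0.
  rewrite ler_wpDl// ler_wpM2l ?exprn_ge0// ler_expR ler_piMr//.
apply: (le_trans (Re_le_n1 _)); apply: (le_trans rest).
rewrite ler_wpM2r ?mulr_ge0 ?exprn_ge0// lerDl.
by rewrite mulr_ge0 ?expR_ge0 ?exprn_ge0.
Qed.

End expansions.

(** * Expansion of the weights *)

(* X k is s times a sum of N independent copies of Y, and the blocks X k are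
   independent. *)
Definition block_factorization d (W : measurableType d) (R : realType)
    (P : probability W R) (K : nat) (X : nat -> W -> R) (Y : W -> R) (N : nat)
    (s eta : R) : Prop :=
  forall z : nat -> R[i], (forall k, `|complex.Re (z k)| * s <= eta) ->
  cintegrable P (fun w => \prod_(k < K) cexp (z k * (X k w)%:C%C)) /\
  cexpect P (fun w => \prod_(k < K) cexp (z k * (X k w)%:C%C)) =
    \prod_(k < K) cmgf P Y (z k * s%:C%C) ^+ N.

Section bessel_weight.
Context d (W : measurableType d) (R : realType) (P : probability W R) (K : nat)
  (X : nat -> W -> R) (beta s eta : R) (Y : W -> R) (N : nat).
Hypotheses (K2 : (2 <= K)%N) (beta0 : 0 < beta).
Hypothesis mX : forall k, measurable_fun setT (X k).
Hypothesis factor : block_factorization P K X Y N s eta.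

Let A w := K%:R^-1 * \sum_(k < K) X k w.
Let q := beta * s / K%:R.

Let K0 : 0 < K%:R :> R. Proof. by rewrite ltr0n ltnW. Qed.

Lemma sum_sqr_sub_mean w : \sum_(k < K) (X k w - A w) ^+ 2 = centered_ss K (X^~ w).
Proof.
have E k : (X k w - A w) ^+ 2 = X k w ^+ 2 - 2 * A w * X k w + A w ^+ 2 by ring.
under eq_bigr do rewrite E.
rewrite big_split/= sumrB -mulr_sumr sumr_const card_ord /centered_ss /A.
by rewrite -[_ *+ K]mulr_natl; field; rewrite gt_eqF.
Qed.

(** Taking [y = 0] yields the uncorrected weight, and [y_k = sqrt K * u_k] the integrand of the
    corrected one. *)
Let zz (y : nat -> R) k : R[i] := ((- (beta / K%:R))%:C * (1 -i* y k))%C.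

Let prod_cexpE (y : nat -> R) w : complex.Re (\prod_(k < K) cexp (zz y k * (X k w)%:C%C)) =
  expR (- beta * A w) * cos (beta / K%:R * \sum_(k < K) y k * X k w).
Proof.
rewrite -cexp_sum.
have -> : \sum_(k < K) zz y k * (X k w)%:C%C =
    ((- beta * A w) +i* (beta / K%:R * \sum_(k < K) y k * X k w))%C.
  rewrite /A mulr_sumr !mulr_sumr -csum; apply: eq_bigr => k _.
  by rewrite /zz; simpc; congr (_ +i* _)%C; ring.
by rewrite cexpE.
Qed.

Let zzs y k : zz y k * s%:C%C = ((- q)%:C * (1 -i* y k))%C.
Proof. by rewrite /zz /q; simpc; congr (_ +i* _)%C; ring. Qed.

Hypothesis qeta : q <= eta.

Let Re_zz y k : `|complex.Re (zz y k)| * s <= eta.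
Proof.
rewrite /zz; simpc; rewrite normrN ger0_norm; last by rewrite divr_ge0 ?ltW.
by rewrite mulrAC.
Qed.

Lemma integrable_exp_mean : P.-integrable setT (EFin \o (fun w => expR (- beta * A w))).
Proof.
have [[i _] _] := factor (Re_zz (fun=> 0)).
move: i; congr (_.-integrable _ (EFin \o _)); apply/funext => w; rewrite prod_cexpE.
rewrite [X in cos (_ * X)]big1 ?mulr0 ?cos0 ?mulr1// => k _.
by rewrite mul0r.
Qed.

Lemma weight_uncorrectedE : \int[P]_w expR (- beta * A w) =
  complex.Re (\prod_(k < K) cmgf P Y (- q)%:C%C ^+ N).
Proof.
have [_] := factor (Re_zz (fun=> 0)).
under eq_bigr do rewrite zzs oppr0 mulr1.
move=> <-; rewrite /cexpect/=; apply: eq_Rintegral => w _; rewrite prod_cexpE.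
rewrite [X in cos (_ * X)]big1 ?mulr0 ?cos0 ?mulr1// => k _.
by rewrite mul0r.
Qed.

(** Writes the Bessel factor as a spherical average and exchanges the two integrals; the integrand
    is dominated by a constant times [exp (- beta A)], which [integrable_exp_mean] covers. *)
Lemma weight_correctedE d' (T : measurableType d') (Q : subprobability T R)
    (om : T -> R) (U : nat -> T -> R) : sphere_average Q K om U ->
  let F t := complex.Re (\prod_(k < K)
      cmgf P Y ((- q)%:C * (1 -i* (Num.sqrt K%:R * U k t)))%C ^+ N) in
  Q.-integrable setT (EFin \o (fun t => om t * F t)) /\
  \int[P]_w (expR (- beta * A w) *
     bessel_factor beta ((K%:R - 1)^-1 * \sum_(k < K) (X k w - A w) ^+ 2) K) =
  \int[Q]_t (om t * F t).
Proof.
move=> sU F; have [[[mom bom] bU] om0 _ _ _] := sU.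
pose c := beta / Num.sqrt K%:R.
pose f (z : W * T) := expR (- beta * A z.1) *
  (om z.2 * cos (c * \sum_(k < K) U k z.2 * X k z.1)).
have mA : measurable_fun setT (fun w => expR (- beta * A w)).
  apply: measurableT_comp => //; apply: measurable_funM => //.
  by apply: measurable_funM => //; apply: measurable_sum => k; exact: mX.
have mf : measurable_fun setT (EFin \o f).
  apply/measurable_EFinP; apply: measurable_funM.
    exact: (measurableT_comp mA).
  apply: measurable_funM; first exact: (measurableT_comp mom).
  apply: (measurableT_comp (f := @cos R)).
    by apply: continuous_measurable_fun; exact: continuous_cos.
  apply: measurable_funM => //; apply: measurable_sum => k; apply: measurable_funM.
    by have [mU _] := bU k; exact: (measurableT_comp mU).
  exact: (measurableT_comp (mX k)).
have [M bM] := bom.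
have M0 : 0 <= M by rewrite (le_trans _ (bM point)).
have IA := integrable_exp_mean.
have fi : (P \x Q)%E.-integrable setT (EFin \o f).
  apply/integrable12ltyP => //.
  apply: (@le_lt_trans _ _ (\int[P]_w (M * expR (- beta * A w))%:E)%E); last first.
    have /integrableP[_] := integrable_scale M measurableT IA.
    apply: le_lt_trans; apply: ge0_le_integral => //.
    + by move=> w _; rewrite lee_fin mulr_ge0// expR_ge0.
    + exact/measurable_EFinP/measurable_funM.
    + by apply: measurableT_comp => //; exact/measurable_EFinP/measurable_funM.
    + by move=> w _; rewrite /= lee_fin ler_norm.
  apply: ge0_le_integral => //.
  - by move=> w _; exact: integral_ge0.
  - by apply: (@measurable_fun_fubini_tonelli_F _ _ _ _ _ Q (fun z => `|(f z)%:E|%E)) => //; exact: measurableT_comp.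
  - exact/measurable_EFinP/measurable_funM.
  move=> w _; apply: (@le_trans _ _ (\int[Q]_t (M * expR (- beta * A w))%:E)%E).
    apply: ge0_le_integral => //.
    - apply: measurableT_comp => //.
      exact: (measurableT_comp mf (measurable_fun_pair (measurable_cst w) (@measurable_id _ _ setT))).
    - move=> t _; rewrite /= lee_fin normrM ger0_norm ?expR_ge0// mulrC.
      rewrite ler_wpM2r ?expR_ge0// normrM -[leRHS]mulr1 ler_pM//.
      exact: cos_max.
  rewrite integral_cst//= -[leRHS]mule1 lee_wpmul2l//.
    by rewrite lee_fin mulr_ge0 ?expR_ge0.
  exact: sprobability_setT.
have Fub := Fubini fi.
have FE t : (\int[P]_w (f (w, t))%:E)%E = (om t * F t)%:E.
  pose y k := Num.sqrt K%:R * U k t.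
  have [[i1 _] e] := factor (Re_zz y).
  have -> : om t * F t = om t * \int[P]_w complex.Re (\prod_(k < K) cexp (zz y k * (X k w)%:C%C)).
    congr (_ * _); rewrite /F; under eq_bigr do rewrite -(zzs y).
    by rewrite -e.
  rewrite EFinM /Rintegral fineK ?integrable_fin_num// -integralZl//.
  apply: eq_integral => w _; rewrite -EFinM prod_cexpE /f/= mulrCA.
  congr (_ * (_ * cos _))%:E; rewrite !mulr_sumr; apply: eq_bigr => k _.
  rewrite /c /y; have sK : Num.sqrt K%:R * Num.sqrt K%:R = K%:R :> R.
    by rewrite -expr2 sqr_sqrtr// ltW.
  rewrite -{2}sK; field; rewrite gt_eqF// sqrtr_gt0//.
split.
  have mG := measurable_fubini_G fi.
  have GE : fubini_G P (EFin \o f) = EFin \o (fun t => om t * F t).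
    by apply/funext => t; exact: FE.
  apply/integrableP; rewrite -GE; split => //.
  have := (integrable21ltyP _ _ mf).1 fi; apply: le_lt_trans.
  apply: ge0_le_integral => //.
  - exact: measurableT_comp.
  - by apply: (@measurable_fun_fubini_tonelli_G _ _ _ _ _ P (fun z => `|(f z)%:E|%E)) => //; exact: measurableT_comp.
  move=> t _; apply: le_abse_integral => //.
  exact: (measurableT_comp mf (measurable_fun_pair (@measurable_id _ _ setT) (measurable_cst t))).
rewrite /Rintegral; congr fine.
under [RHS]eq_integral do rewrite -FE.
rewrite -Fub; apply: eq_integral => w _ /=.
have ss0 : 0 <= centered_ss K (X^~ w).
  by rewrite -sum_sqr_sub_mean sumr_ge0// => k _; exact: sqr_ge0.
rewrite sum_sqr_sub_mean (bessel_factor_average K2 beta0 sU ss0).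
have bi : Q.-integrable setT (EFin \o (fun t => om t * cos (c * \sum_(k < K) U k t * X k w))).
  apply: bounded_measurable_integrable; apply: bounded_measurableM; first by split=> //; exists M.
  apply: (bounded_measurable_comp (T' := measurableTypeR R)); last exact: bounded_measurable_cos.
  by apply: measurable_funM => //; exact: (bounded_measurable_sphere_lin sU (X^~ w)).1.
rewrite EFinM /Rintegral fineK ?integrable_fin_num// -integralZl//.
Qed.

End bessel_weight.

(** The spherical average is fixed once for each [K]. The corrected expansion holds at every point
    of the sphere with the same main term and error, and the weight [om] has integral 1, so
    averaging loses nothing. *)
Lemma weight_expansion (R : realType) (K : nat) (eta C : R) : (2 <= K)%N -> 0 < eta ->
  exists A rho : R, [/\ 0 <= A, 0 < rho &
  forall d (W : measurableType d) (P : probability W R) (X : nat -> W -> R)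
    (beta s : R) (Y : W -> R) (N : nat),
  0 < beta -> 0 <= s -> (forall k, measurable_fun setT (X k)) ->
  exp_moment_bound P eta C Y -> block_factorization P K X Y N s eta ->
  let q := beta * s / K%:R in
  let A_K w := K%:R^-1 * \sum_(k < K) X k w in
  q <= rho ->
  (N%:R * q ^+ 2 <= 1 ->
   `|\int[P]_w expR (- beta * A_K w)
      - (1 + K%:R * (N%:R * q ^+ 2 * (\int[P]_w (Y w ^+ 2)) / 2))| <=
   A * (N%:R * q ^+ 3 + (N%:R * q ^+ 2) ^+ 2)) /\
  (N%:R * q ^+ 3 <= 1 ->
   `|\int[P]_w (expR (- beta * A_K w) *
        bessel_factor beta ((K%:R - 1)^-1 * \sum_(k < K) (X k w - A_K w) ^+ 2) K)
      - (1 + K%:R * (N%:R * q ^+ 3 * (\int[P]_w (Y w ^+ 3)) / 3))| <=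
   A * (N%:R * q ^+ 4 + (N%:R * q ^+ 3) ^+ 2))].
Proof.
move=> K2 eta0.
have [A1 [r1 [A10 r10 H1]]] := @uncorrected_expansion R eta C eta0 K.
have [A2 [r2 [A20 r20 H2]]] := @corrected_expansion R eta C eta0 K.
have [d' [T [Q [om [U sU]]]]] := @sphere_average_exists R K K2.
exists (A1 + A2), (Num.min eta (Num.min r1 r2)); split; first exact: addr_ge0.
  by rewrite !lt_min eta0 r10.
move=> d W P X beta s Y N beta0 s0 mX hY fac q AK; rewrite !le_min => /and3P[qe q1 q2].
have q0 : 0 <= q by rewrite divr_ge0// mulr_ge0// ltW.
have ebound_ge0 i j : 0 <= N%:R * q ^+ i + (N%:R * q ^+ j) ^+ 2.
  apply: addr_ge0; last exact: sqr_ge0.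
  by apply: mulr_ge0 => //; exact: exprn_ge0.
have A12 : A1 <= A1 + A2 by rewrite lerDl.
have A21 : A2 <= A1 + A2 by rewrite lerDr.
split=> Nq.
  have -> := weight_uncorrectedE (Y := Y) (N := N) K2 beta0 fac qe.
  have := H1 _ _ _ _ hY N q; rewrite q0 q1 => /(_ isT Nq) h.
  have {}h := le_trans (Re_le_n1 _) h.
  have RB (z : R[i]) x : complex.Re (z - x%:C%C) = complex.Re z - x by case: z.
  rewrite RB in h; rewrite -/q; apply: (le_trans h).
  by apply: ler_wpM2r => //; exact: ebound_ge0.
have [iF ->] := weight_correctedE (Y := Y) (N := N) K2 beta0 mX fac qe sU.
have [[bom _] om0 U0 U1 _] := sU.
rewrite -/q in iF *; set c := 1 + _.
pose F t := complex.Re (\prod_(k < K)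
  cmgf P Y ((- q)%:C * (1 -i* (Num.sqrt K%:R * U k t)))%C ^+ N).
have {}iF : Q.-integrable setT (EFin \o (fun t => om t * F t)) := iF.
rewrite (_ : \int[Q]_t _ = \int[Q]_t (om t * F t))//.
have K0 : 0 <= K%:R :> R by [].
have Fc t : `|F t - c| <= A2 * (N%:R * q ^+ 4 + (N%:R * q ^+ 3) ^+ 2).
  apply: (H2 _ _ _ _ hY N q (fun k => Num.sqrt K%:R * U k t)) => //.
  - by rewrite q0 q2.
  - by rewrite -mulr_sumr U0 mulr0.
  under eq_bigr do rewrite exprMn sqr_sqrtr//.
  by rewrite -mulr_sumr U1 mulr1.
have iom : Q.-integrable setT (EFin \o om) by exact: bounded_measurable_integrable.
have ic (r : R) : Q.-integrable setT (EFin \o (fun t => om t * r)).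
  by apply: bounded_measurable_integrable; apply: bounded_measurableM => //; exact: bounded_measurable_cst.
have om1 r : \int[Q]_t (om t * r) = r.
  by rewrite RintegralZr// (sphere_average_weight1 sU) mul1r.
rewrite -{1}(om1 c) -RintegralB//.
have iD : Q.-integrable setT (EFin \o (fun t => om t * F t - om t * c)).
  by have := integrableB measurableT iF (ic c).
rewrite (le_trans (le_normr_Rintegral _ iD))//.
apply: (@le_trans _ _ (A2 * (N%:R * q ^+ 4 + (N%:R * q ^+ 3) ^+ 2))); last first.
  by apply: ler_wpM2r => //; exact: ebound_ge0.
rewrite -[leRHS]om1; apply: le_Rintegral => //; first exact: integrable_norm.
move=> t _; rewrite -mulrBr normrM ger0_norm// ler_wpM2l//.
Qed.

(** * Almost sure equality, equality of laws and standardization *)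

Section almost_everywhere.
Context d (W : measurableType d) (R : realType) (P : probability W R).

Lemma integrable_ae_eq (f g : W -> R) : measurable_fun setT f -> measurable_fun setT g ->
  {ae P, forall w, f w = g w} -> P.-integrable setT (EFin \o g) ->
  P.-integrable setT (EFin \o f) /\ \int[P]_w f w = \int[P]_w g w.
Proof.
move=> mf mg fg /integrableP[_ ig].
have mfE : measurable_fun setT (EFin \o f) by exact/measurable_EFinP.
have mgE : measurable_fun setT (EFin \o g) by exact/measurable_EFinP.
split.
  apply/integrableP; split => //; apply: le_lt_trans ig.
  rewrite le_eqVlt; apply/orP; left; apply/eqP.
  apply: ae_eq_integral => //; try exact: measurableT_comp.
  by apply: filterS fg => w fgw _; rewrite /= fgw.
congr fine; apply: ae_eq_integral => //.
by apply: filterS fg => w fgw _; rewrite fgw.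
Qed.

Lemma cexpect_ae_eq (f g : W -> R[i]) : cmeasurable f -> cmeasurable g ->
  {ae P, forall w, f w = g w} -> cintegrable P g ->
  cintegrable P f /\ cexpect P f = cexpect P g.
Proof.
move=> [f1 f2] [g1 g2] fg [i1 i2].
have [j1 e1] := integrable_ae_eq f1 g1 (filterS (fun w h => congr1 (@complex.Re R) h) fg) i1.
have [j2 e2] := integrable_ae_eq f2 g2 (filterS (fun w h => congr1 (@complex.Im R) h) fg) i2.
by rewrite /cexpect e1 e2.
Qed.

End almost_everywhere.

Section same_law.
Context d d1 d2 (W : measurableType d) (T : measurableType d1) (W' : measurableType d2)
  (R : realType) (P : probability W R) (P' : probability W' R)
  (X : W -> T) (X' : W' -> T).
Hypotheses (mX : measurable_fun setT X) (mX' : measurable_fun setT X').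
Hypothesis law : forall A, measurable A -> P (X @^-1` A) = P' (X' @^-1` A).

Lemma integrable_same_law (f : T -> R) : measurable_fun setT f ->
  P'.-integrable setT (EFin \o (f \o X')) ->
  P.-integrable setT (EFin \o (f \o X)) /\ \int[P]_w f (X w) = \int[P']_w f (X' w).
Proof.
move=> mf i'.
pose Z : {mfun W >-> T} := HB.pack X (isMeasurableFun.Build _ _ _ _ X mX).
pose Z' : {mfun W' >-> T} := HB.pack X' (isMeasurableFun.Build _ _ _ _ X' mX').
pose m : probability T R := distribution P Z.
pose m' : probability T R := distribution P' Z'.
have mm A : measurable A -> A `<=` setT -> m A = m' A by move=> mA _; exact: law.
have mfE : measurable_fun setT (EFin \o f) by exact/measurable_EFinP.
have i : P.-integrable setT (EFin \o (f \o X)).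
  apply/integrableP; split; first by apply/measurable_EFinP; exact: measurableT_comp.
  have /integrableP[_] := i'; apply: le_lt_trans.
  have mf0 : measurable_fun setT (fun t => `|(f t)%:E|%E) by exact: measurableT_comp.
  have e := ge0_integral_pushforward mX P measurableT mf0 (fun y _ => abse_ge0 _).
  have e' := ge0_integral_pushforward mX' P' measurableT mf0 (fun y _ => abse_ge0 _).
  rewrite [leLHS](esym e) [leRHS](esym e') le_eqVlt; apply/orP; left; apply/eqP.
  exact: eq_measure_integral.
split => //; congr fine.
have e := integral_pushforward mX mfE i measurableT.
have e' := integral_pushforward mX' mfE i' measurableT.
rewrite -e -e'; exact: eq_measure_integral.
Qed.

Lemma cexpect_same_law (f : T -> R[i]) : cmeasurable f ->
  cintegrable P' (fun w => f (X' w)) ->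
  cintegrable P (fun w => f (X w)) /\
  cexpect P (fun w => f (X w)) = cexpect P' (fun w => f (X' w)).
Proof.
move=> [f1 f2] [i1 i2].
have [j1 e1] := integrable_same_law f1 i1.
have [j2 e2] := integrable_same_law f2 i2.
by rewrite /cexpect e1 e2.
Qed.

End same_law.

Section standardization.
Context d (W : measurableType d) (R : realType) (P : probability W R) (V : W -> R).
Hypotheses (mV : measurable_fun setT V) (iV : P.-integrable setT (EFin \o V)).
Hypothesis EV : \int[P]_w V w = 0.
Hypothesis finV : ('V_P[V] < +oo)%E.

Let v := fine ('V_P[V])%E.
Let Y w := V w / Num.sqrt v.

Lemma centered_varianceE : ('V_P[V])%E = (\int[P]_w ((V w) ^+ 2)%:E)%E.
Proof.
have E0 : fine ('E_P[V])%E = 0 by rewrite unlock; exact: EV.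
rewrite /variance [in LHS]unlock E0 unlock; apply: eq_integral => w _ /=.
have -> : ((V \- cst 0) * (V \- cst 0)) w = (V w - 0) * (V w - 0) by [].
by rewrite subr0 expr2.
Qed.

Lemma integrable_sqr_centered : P.-integrable setT (EFin \o (fun w => V w ^+ 2)).
Proof.
apply/integrableP; split; first by apply/measurable_EFinP; exact: measurable_funX.
rewrite (eq_integral (fun w => ((V w) ^+ 2)%:E)); first by rewrite -centered_varianceE.
by move=> w _ /=; rewrite ger0_norm ?sqr_ge0.
Qed.

Lemma centered_variance_ge0 : 0 <= v.
Proof.
by rewrite /v centered_varianceE fine_ge0// integral_ge0// => w _; rewrite lee_fin sqr_ge0.
Qed.

Lemma centered_variance_Rintegral : v = \int[P]_w (V w ^+ 2).
Proof. by rewrite /v centered_varianceE. Qed.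

Lemma centered_variance0 : v = 0 -> {ae P, forall w, V w = 0}.
Proof.
move=> v0; have i2 := integrable_sqr_centered.
have : (\int[P]_w `|((V w) ^+ 2)%:E|)%E = 0%E.
  rewrite (eq_integral (fun w => ((V w) ^+ 2)%:E)).
    have := centered_variance_Rintegral; rewrite v0 /Rintegral => /esym h.
    by rewrite -[LHS]fineK ?integrable_fin_num// h.
  by move=> w _ /=; rewrite ger0_norm ?sqr_ge0.
move/ae_eq_integral_abs => /(_ measurableT) h.
have /h : measurable_fun setT (fun w => ((V w) ^+ 2)%:E).
  by apply/measurable_EFinP; exact: measurable_funX.
apply: filterS => w /(_ I) [] /eqP.
by rewrite sqrf_eq0 => /eqP.
Qed.

(** Only almost sure because of the degenerate case: for [v = 0] division by 0 makes [Y] identically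
    0, while [V] vanishes merely almost everywhere. *)
Lemma standardizedK : {ae P, forall w, V w = Num.sqrt v * Y w}.
Proof.
have [v0|v0] := eqVneq v 0.
  by apply: filterS (centered_variance0 v0) => w ->; rewrite /Y v0 sqrtr0 mul0r.
apply: nearW => w; rewrite /Y mulrCA divff ?mulr1//.
by rewrite gt_eqF// sqrtr_gt0 lt_neqAle eq_sym v0 centered_variance_ge0.
Qed.

Lemma measurable_standardized : measurable_fun setT Y.
Proof. exact: measurable_funM. Qed.

Lemma standardized_mean : \int[P]_w Y w = 0.
Proof.
by under eq_Rintegral do rewrite /Y mulrC; rewrite RintegralZl// EV mulr0.
Qed.

(** The factor [v] makes the identity hold for degenerate states too, where the second moment of [Y]
    is 0 and not 1. *)
Lemma standardized_moment2 : v * \int[P]_w (Y w ^+ 2) = v.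
Proof.
have [->|v0] := eqVneq v 0; first by rewrite mul0r.
have E w : Y w ^+ 2 = v^-1 * V w ^+ 2.
  by rewrite /Y expr_div_n sqr_sqrtr ?centered_variance_ge0// mulrC.
under eq_Rintegral do rewrite E.
rewrite RintegralZl//; last exact: integrable_sqr_centered.
by rewrite -centered_variance_Rintegral mulVf// mulr1.
Qed.

Lemma standardized_cexp (z : R[i]) :
  cintegrable P (fun w => cexp (z * (Num.sqrt v)%:C%C * (Y w)%:C%C)) ->
  cintegrable P (fun w => cexp (z * (V w)%:C%C)) /\
  cexpect P (fun w => cexp (z * (V w)%:C%C)) = cmgf P Y (z * (Num.sqrt v)%:C%C).
Proof.
apply: cexpect_ae_eq; [exact: cmeasurable_cexp| |].
  by apply: cmeasurable_cexp; exact: measurable_standardized.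
by apply: filterS standardizedK => w {1}->; rewrite rmorphM/= mulrA.
Qed.

(** At the real points [eta] and [- eta] the extension is the cgf, so both exponential moments are
    at most [exp |C|]; their sum dominates [exp (eta |Y|)], whence the factor 2. In the degenerate
    case the integrand is 1. *)
Lemma standardized_exp_moment (eta C : R) : 0 < eta ->
  (v != 0 -> cgf_extends_bounded P Y eta C) ->
  exp_moment_bound P eta (2 * expR `|C|) Y.
Proof.
move=> eta0 hY; have mY := measurable_standardized.
suff [i1 i2] : P.-integrable setT (fun w => (expR (eta * `|Y w|))%:E) /\
    \int[P]_w expR (eta * `|Y w|) <= 2 * expR `|C|.
  by split => //; exact: standardized_mean.
have e1 : 1 <= expR `|C| by rewrite -expR0 ler_expR.
have [v0|v0] := eqVneq v 0.
  have E : (fun w => expR (eta * `|Y w|)) = cst 1.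
    by apply/funext => w; rewrite /Y v0 sqrtr0 invr0 mulr0 normr0 mulr0 expR0.
  have -> : (fun w => (expR (eta * `|Y w|))%:E) = EFin \o cst 1 by rewrite -E.
  split; first exact/bounded_measurable_integrable/bounded_measurable_cst.
  rewrite E; under eq_Rintegral do rewrite /=.
  have -> : \int[P]_w cst (1 : R) w = 1.
    by have := cexpect_cst P 1; rewrite /cexpect => -[].
  by lra.
have [U [g [_ _ hcgf gC]]] := hY v0.
have M t : `|t| <= eta -> P.-integrable setT (EFin \o (fun w => expR (t * Y w))) /\
    \int[P]_w expR (t * Y w) <= expR `|C|.
  move=> te; have [Mfin gt] := hcgf t te.
  have ME : ('M_P Y t)%E = (\int[P]_w (expR (t * Y w))%:E)%E.
    by rewrite /mmt_gen_fun unlock; apply: eq_integral => w _ /=; rewrite mulrC.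
  have it : P.-integrable setT (EFin \o (fun w => expR (t * Y w))).
    apply/integrableP; split.
      by apply/measurable_EFinP; apply: measurableT_comp => //; exact: measurable_funM.
    rewrite (eq_integral (fun w => (expR (t * Y w))%:E)); first by rewrite -ME.
    by move=> w _ /=; rewrite ger0_norm ?expR_ge0.
  split => //.
  have tC : `|(t%:C)%C| <= (eta%:C)%C.
    by rewrite normc_def/= expr0n/= addr0 sqrtr_sqr lecR.
  have := le_trans (normc_ge_Re _) (gC _ tC); rewrite gt lecR /= /cgf ME.
  rewrite -/(Rintegral P setT (fun w => expR (t * Y w))); set m := \int[P]_w _ => lnm.
  (* For nonpositive [m] the value of [ln] carries no information, but the bound is then trivial. *)
  have [m0|m0] := leP m 0; first by rewrite (le_trans m0)// expR_ge0.
  rewrite -(lnK m0) ler_expR (le_trans (ler_norm _))// (le_trans lnm)//.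
  exact: ler_norm.
have [|ip bp] := M eta; first by rewrite ger0_norm// ltW.
have [|im bm] := M (- eta); first by rewrite normrN ger0_norm// ltW.
have ipm := integrableD measurableT ip im.
have dom w : expR (eta * `|Y w|) <= expR (eta * Y w) + expR (- eta * Y w).
  have [y0|y0] := leP 0 (Y w); first by rewrite ger0_norm// lerDl expR_ge0.
  by rewrite ltr0_norm// mulrN mulNr lerDr expR_ge0.
have i : P.-integrable setT (fun w => (expR (eta * `|Y w|))%:E).
  apply: le_integrable ipm => //.
    apply/measurable_EFinP; apply: measurableT_comp => //.
    by apply: measurable_funM => //; exact: measurableT_comp.
  move=> w _ /=; rewrite lee_fin ger0_norm ?expR_ge0//.
  exact: le_trans (dom w) (ler_norm _).
split => //; apply: (@le_trans _ _ (\int[P]_w (expR (eta * Y w) + expR (- eta * Y w)))).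
  by apply: le_Rintegral => // w _; exact: dom.
by rewrite RintegralD// mulrDl mul1r lerD.
Qed.

End standardization.

(** * Block laws *)

Lemma mutually_independent_pair d d' (W : measurableType d) (T : measurableType d')
    (R : realType) (P : probability W R) N (Y : nat -> W -> T) i j :
  mutually_independent P N Y -> (i < N)%N -> (j < N)%N -> i != j ->
  forall A B, measurable A -> measurable B ->
  P (Y i @^-1` A `&` Y j @^-1` B) = (P (Y i @^-1` A) * P (Y j @^-1` B))%E.
Proof.
move=> ind iN jN ij A B mA mB.
have := ind (fun k => if k == i then A else if k == j then B else setT).
rewrite (bigD1 (Ordinal iN))//= (bigD1 (Ordinal jN))/=; last by rewrite -val_eqE/= eq_sym.
rewrite !eqxx [j == i]eqtype.eq_sym (negbTE ij) big1 ?setIT => [|k /andP[]]; last first.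
  by rewrite -!val_eqE/= => /negbTE -> /negbTE ->; rewrite preimage_setT.
rewrite (bigD1 (Ordinal iN))//= (bigD1 (Ordinal jN))/=; last by rewrite -val_eqE/= eq_sym.
rewrite !eqxx [j == i]eqtype.eq_sym (negbTE ij) big1 ?mule1 => [|k /andP[]]; last first.
  rewrite -!val_eqE/= => /negbTE -> /negbTE ->.
  by rewrite preimage_setT probability_setT.
by apply => k; case: ifP => // _; case: ifP.
Qed.

Section block_laws.
Context (R : realType) (S : model R) (K : nat) (D : block_rule S K) (n B : nat)
  (theta : Theta S n).
Hypotheses (K2 : (2 <= K)%N) (B0 : (0 < B)%N).

Let P : probability (Omega D n B) R := Pr D B theta.
Let K0 : (0 < K)%N. Proof. exact: ltnW. Qed.
Let Bneq0 : B%:R != 0 :> R. Proof. by rewrite pnatr_eq0 -lt0n. Qed.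

Lemma measurable_input_loss : measurable_fun setT (L theta).
Proof.
exact: (measurableT_comp (@L_measurable R S n) (measurable_fun_pair (measurable_cst theta) (@measurable_id _ _ setT))).
Qed.

Let block k w : B.-tuple (Input S n) := [tuple @xi R S K D n B k b w | b < B].

Let mblock k : measurable_fun setT (block k).
Proof.
apply/measurable_fun_tnthP => i.
have -> : (tnth (T:=Input S n))^~ i \o block k = @xi R S K D n B k i.
  by apply/funext => w; rewrite /= tnth_mktuple.
exact: xi_measurable.
Qed.

Let g (t : B.-tuple (Input S n)) : R :=
  B%:R^-1 * \sum_(b < B) L theta (tnth t b) - loss theta.

Let mg : measurable_fun setT g.
Proof.
apply: measurable_funB => //; apply: measurable_funM => //.
apply: measurable_sum => b.
exact: (measurableT_comp measurable_input_loss (measurable_tnth b)).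
Qed.

Let block_errE k w : block_err k theta w = g (block k w).
Proof.
rewrite /block_err /block_loss /g; congr (_ * _ - _); apply: eq_bigr => b _.
by rewrite tnth_mktuple.
Qed.

Lemma measurable_block_err k : measurable_fun setT (@block_err _ _ _ D n B k theta).
Proof.
have -> : block_err k theta = g \o @block k by apply/funext => w; exact: block_errE.
exact: measurableT_comp.
Qed.

Lemma integrable_block_err k : (k < K)%N ->
  P.-integrable setT (EFin \o @block_err _ _ _ D n B k theta).
Proof.
move=> kK; have i1 := block_loss_integrable D theta B0 kK.
have i2 : P.-integrable setT (EFin \o fun=> loss theta).
  exact/bounded_measurable_integrable/bounded_measurable_cst.
by have := integrableB measurableT i1 i2.
Qed.

Lemma mean_block_err k : (k < K)%N -> \int[P]_w block_err k theta w = 0.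
Proof.
move=> kK; have i1 := block_loss_integrable D theta B0 kK.
have i2 : P.-integrable setT (EFin \o fun=> loss theta).
  exact/bounded_measurable_integrable/bounded_measurable_cst.
rewrite /block_err RintegralB//.
have := block_loss_unbiased D theta B0 kK; rewrite unlock => /(congr1 fine)/=.
rewrite -/(Rintegral P setT _) => ->.
have := cexpect_cst P (loss theta)%:C%C; rewrite /cexpect => -[-> _].
by rewrite subrr.
Qed.

Lemma block_err_mean k w :
  block_err k theta w = B%:R^-1 * \sum_(b < B) @point_err _ _ _ D n B k b theta w.
Proof.
rewrite /block_err /block_loss /point_err sumrB sumr_const card_ord.
have -> : loss theta *+ B = B%:R * loss theta by rewrite mulr_natl.
by rewrite mulrBr mulKf.
Qed.

Section randomized_quadrature.
Let X0 := @block_err _ _ _ D n B 0 theta.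
Hypothesis finV : ('V_P[X0] < +oo)%E.
Let Y w := X0 w / Num.sqrt (block_var D B theta).

(** A block enters as a whole, as one copy of [Y], since its points may be dependent. Every block
    has the law of block 0, and blocks are independent. *)
Lemma block_factorization_RQ eta C : exp_moment_bound P eta C Y ->
  block_factorization P K (fun k => @block_err _ _ _ D n B k theta) Y 1
    (Num.sqrt (block_var D B theta)) eta.
Proof.
move=> hY z zeta; set s := Num.sqrt _ in zeta *.
have mX0 : measurable_fun setT X0 by exact: measurable_block_err.
have iX0 := integrable_block_err K0; have EX0 := mean_block_err K0.
pose f k (t : B.-tuple (Input S n)) := cexp (z k * (g t)%:C%C).
have mf k : cmeasurable (f k) by exact: cmeasurable_cexp.
have first k : cintegrable P (fun w => f k (block 0 w)) /\
    cexpect P (fun w => f k (block 0 w)) = cmgf P Y (z k * s%:C%C).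
  have -> : (fun w => f k (block 0 w)) = (fun w => cexp (z k * (X0 w)%:C%C)).
    by apply/funext => w; rewrite /f -block_errE.
  apply: standardized_cexp => //; apply: cintegrable_cmgf hY _ _.
  by rewrite mulrC Re_scale normrM ger0_norm ?sqrtr_ge0// mulrC.
have each k : (k < K)%N -> cintegrable P (fun w => f k (block k w)) /\
    cexpect P (fun w => f k (block k w)) = cmgf P Y (z k * s%:C%C).
  move=> kK; have [i e] := first k; rewrite -e.
  apply: cexpect_same_law => // A mA.
  exact: (blocks_identically_distributed D theta B0 kK mA).
have := @cexpect_indep_prod _ _ _ _ _ P block mblock K f (blocks_independent D theta B0) mf.
case=> [k kK|]; first by have [] := each k kK.
have -> : (fun w => \prod_(k < K) f k (block k w)) =
    (fun w => \prod_(k < K) cexp (z k * (block_err k theta w)%:C%C)).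
  by apply/funext => w; apply: eq_bigr => k _; rewrite /f -block_errE.
move=> i ->; split => //; apply: eq_bigr => k _.
by rewrite expr1; have [] := each k (ltn_ord k).
Qed.

End randomized_quadrature.

Section monte_carlo.
Hypothesis mc : forall k, (k < K)%N ->
    mutually_independent P B (fun b => @xi R S K D n B k b) /\
    forall (b : nat) (A : set (Input S n)), (b < B)%N -> measurable A ->
      P (@xi R S K D n B k b @^-1` A) = inputP S n A.

Let h x := L theta x - loss theta.

Let mh : measurable_fun setT h.
Proof. by apply: measurable_funB => //; exact: measurable_input_loss. Qed.

Let ih : (inputP S n).-integrable setT (EFin \o h).
Proof.
have i2 : (inputP S n).-integrable setT (EFin \o fun=> loss theta).
  exact/bounded_measurable_integrable/bounded_measurable_cst.
by have := integrableB measurableT (L_integrable theta) i2.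
Qed.

Let mxi k b : measurable_fun setT (@xi R S K D n B k b).
Proof. exact: xi_measurable. Qed.

Let law k b k' b' : (k < K)%N -> (b < B)%N -> (k' < K)%N -> (b' < B)%N ->
  forall A, measurable A ->
  P (@xi R S K D n B k b @^-1` A) = P (@xi R S K D n B k' b' @^-1` A).
Proof.
move=> kK bB kK' bB' A mA.
by rewrite (mc kK).2// (mc kK').2.
Qed.

Lemma integrable_point_err k b : (k < K)%N -> (b < B)%N ->
  P.-integrable setT (EFin \o @point_err _ _ _ D n B k b theta).
Proof.
move=> kK bB; have [] := @integrable_same_law _ _ _ _ _ _ _ P (inputP S n) _ id
  (mxi k b) (@measurable_id _ _ setT) _ h mh ih => //.
by move=> A mA; rewrite (mc kK).2.
Qed.

Lemma mean_point_err k b : (k < K)%N -> (b < B)%N -> \int[P]_w point_err k b theta w = 0.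
Proof.
move=> kK bB; have [|_] := @integrable_same_law _ _ _ _ _ _ _ P (inputP S n) _ id
  (mxi k b) (@measurable_id _ _ setT) _ h mh ih.
  by move=> A mA; rewrite (mc kK).2.
move=> ->; rewrite /h RintegralB//; last first.
- exact/bounded_measurable_integrable/bounded_measurable_cst.
- exact: L_integrable.
have := cexpect_cst (inputP S n) (loss theta)%:C%C; rewrite /cexpect => -[-> _].
by rewrite subrr.
Qed.

Let V0 := @point_err _ _ _ D n B 0 0 theta.
Hypothesis finV : ('V_P[V0] < +oo)%E.
Let Y w := V0 w / Num.sqrt (sigma2 D B theta).

Let mV0 : measurable_fun setT V0.
Proof. exact: (measurableT_comp mh (mxi 0 0)). Qed.

Let iV0 := integrable_point_err K0 B0.
Let EV0 := mean_point_err K0 B0.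

(** The cgf assumption excludes degenerate states through [block_var], while MC-blocks are
    standardized by [sigma2]; this identity shows that the two vanish together. Off-diagonal terms
    are 0 by pairwise independence and centering. *)
Lemma block_var_MC : block_var D B theta = sigma2 D B theta / B%:R.
Proof.
have iX0 := integrable_block_err K0; have EX0 := mean_block_err K0.
have mX0 := measurable_block_err 0.
rewrite /block_var (centered_variance_Rintegral EX0).
have i2 b : (b < B)%N ->
    P.-integrable setT (EFin \o (fun w => point_err 0 b theta w ^+ 2)) /\
    \int[P]_w (point_err 0 b theta w ^+ 2) = sigma2 D B theta.
  move=> bB.
  have [] := @integrable_same_law _ _ _ _ _ _ _ P P _ _ (mxi 0 b) (mxi 0 0)
    (law K0 bB K0 B0) (fun x => h x ^+ 2).
  - exact: measurable_funX.
  - exact: integrable_sqr_centered.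
  by move=> i e; split => //; rewrite e /sigma2 (centered_variance_Rintegral EV0).
have i11 a b : (a < B)%N -> (b < B)%N ->
    P.-integrable setT (EFin \o (fun w => point_err 0 a theta w * point_err 0 b theta w)) /\
    \int[P]_w (point_err 0 a theta w * point_err 0 b theta w) =
      if a == b then sigma2 D B theta else 0.
  move=> aB bB; have [->|ab] := eqVneq a b; first exact: i2.
  have [] := integrable_Rintegral_indep_mul (mxi 0 a) (mxi 0 b)
    (mutually_independent_pair (mc K0).1 aB bB ab) mh mh.
  - exact: integrable_point_err.
  - exact: integrable_point_err.
  by move=> i e; split => //; rewrite e [X in X * _](mean_point_err K0 aB) mul0r.
have E (w : Omega D n B) : block_err 0 theta w ^+ 2 = B%:R ^- 2 *
    \sum_(a < B) \sum_(b < B) (point_err 0 a theta w * point_err 0 b theta w).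
  under eq_bigr do rewrite -mulr_sumr.
  by rewrite -mulr_suml -expr2 -exprVn -exprMn block_err_mean.
under eq_Rintegral do rewrite E.
have ib (a : 'I_B) : P.-integrable setT (EFin \o (fun w =>
    \sum_(b < B) point_err 0 a theta w * point_err 0 b theta w)).
  under [EFin \o _]eq_fun do rewrite /= -sumEFin.
  by apply: integrable_sum => // b _; have [] := i11 a b (ltn_ord a) (ltn_ord b).
rewrite RintegralZl//; last first.
  under [EFin \o _]eq_fun do rewrite /= -sumEFin.
  by apply: integrable_sum => // a _; exact: ib.
rewrite Rintegral_sum//.
have sumE (a : 'I_B) : \int[P]_w (\sum_(b < B) point_err 0 a theta w * point_err 0 b theta w) =
    sigma2 D B theta.
  rewrite Rintegral_sum; last by move=> b; have [] := i11 a b (ltn_ord a) (ltn_ord b).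
  rewrite (bigD1 a)//= big1 ?addr0; first by rewrite (i11 a a _ _).2 ?eqxx.
  by move=> b ba; rewrite (i11 a b _ _).2// ifN// eqtype.eq_sym.
under eq_bigr do rewrite sumE.
by rewrite sumr_const card_ord -[_ *+ B]mulr_natl; field.
Qed.

(** Independence is used twice, between blocks and then within each block, where the exponential of
    the block error is a product over points with exponent [z k / B]. *)
Lemma block_factorization_MC eta C : exp_moment_bound P eta C Y ->
  block_factorization P K (fun k => @block_err _ _ _ D n B k theta) Y B
    (Num.sqrt (sigma2 D B theta) / B%:R) eta.
Proof.
move=> hY z zeta; set s := Num.sqrt _ in zeta *.
pose zB k := z k * (B%:R^-1)%:C%C.
pose f k x := cexp (zB k * (h x)%:C%C).
have mf k : cmeasurable (f k) by exact: cmeasurable_cexp.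
have zBs k : z k * (s / B%:R)%:C%C = zB k * s%:C%C.
  by rewrite /zB rmorphM/=; ring.
have first k : cintegrable P (fun w => f k (@xi R S K D n B 0 0 w)) /\
    cexpect P (fun w => f k (@xi R S K D n B 0 0 w)) = cmgf P Y (zB k * s%:C%C).
  apply: (standardized_cexp mV0 EV0 finV (z := zB k)); apply: cintegrable_cmgf hY _ _.
  rewrite -zBs mulrC Re_scale normrM ger0_norm ?divr_ge0 ?sqrtr_ge0//.
  by rewrite mulrC.
have each k b : (k < K)%N -> (b < B)%N ->
    cintegrable P (fun w => f k (@xi R S K D n B k b w)) /\
    cexpect P (fun w => f k (@xi R S K D n B k b w)) = cmgf P Y (zB k * s%:C%C).
  move=> kK bB; have [i e] := first k; rewrite -e.
  apply: cexpect_same_law => // A mA.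
  exact: (law kK bB K0 B0).
pose F k (t : B.-tuple (Input S n)) := \prod_(b < B) f k (tnth t b).
have mF k : cmeasurable (F k).
  apply: cmeasurable_prod => b.
  exact: (cmeasurable_comp (measurable_tnth b)).
have blockE k : (fun w => F k (block k w)) =
    (fun w => \prod_(b < B) f k (@xi R S K D n B k b w)).
  by apply/funext => w; apply: eq_bigr => b _; rewrite tnth_mktuple.
have block_cexp k w : F k (block k w) = cexp (z k * (block_err k theta w)%:C%C).
  rewrite /F -cexp_sum; congr cexp; rewrite -mulr_sumr /zB -mulrA; congr (_ * _).
  rewrite -rmorph_sum -rmorphM/=; congr (_%:C)%C.
  rewrite block_err_mean; congr (_ * _); apply: eq_bigr => b _.
  by rewrite tnth_mktuple.
have eachF k : (k < K)%N -> cintegrable P (fun w => F k (block k w)) /\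
    cexpect P (fun w => F k (block k w)) = cmgf P Y (zB k * s%:C%C) ^+ B.
  move=> kK; rewrite blockE.
  have := @cexpect_indep_prod _ _ _ _ _ P _ (mxi k) B (fun=> f k) (mc kK).1 (fun=> mf k).
  case=> [b bB|i ->]; first by have [] := each k b kK bB.
  split => //; under eq_bigr => b _ do rewrite (each k b kK (ltn_ord b)).2.
  by rewrite prodr_const card_ord.
have := @cexpect_indep_prod _ _ _ _ _ P block mblock K F (blocks_independent D theta B0) mF.
case=> [k kK|]; first by have [] := eachF k kK.
have -> : (fun w => \prod_(k < K) F k (block k w)) =
    (fun w => \prod_(k < K) cexp (z k * (block_err k theta w)%:C%C)).
  by apply/funext => w; apply: eq_bigr => k _.
move=> i ->; split => //; apply: eq_bigr => k _.
by rewrite zBs; have [] := eachF k (ltn_ord k).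
Qed.

End monte_carlo.

End block_laws.

(** * Third cumulant *)

Section derivative_from_remainder.
Context {R : realType}.

(** Allows an integral to be differentiated in its parameter by integrating a pointwise quadratic
    remainder bound. *)
Lemma is_derive_sqr_remainder (f : R -> R) (t df c r : R) : 0 < r ->
  (forall h, `|h| <= r -> `|f (t + h) - f t - h * df| <= c * h ^+ 2) ->
  is_derive (t : R) (1 : R) f df.
Proof.
move=> r0 H.
suff L : h^-1 *: ((f \o shift t) (h *: 1) - f t) @[h --> 0^'] --> df.
  by apply: DeriveDef; [apply/cvg_ex; exists df|exact: cvg_lim].
apply/cvgrPdist_le => e e0; near=> h.
have h0 : h != 0 by near: h; exact: nbhs_dnbhs_neq.
have hr : `|h| <= r by near: h; apply: dnbhs0_le.
have hc : `|h| <= e / (`|c| + 1).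
  by near: h; apply: dnbhs0_le; rewrite divr_gt0// ltr_wpDl.
have -> : (f \o shift t) (h *: 1) = f (t + h).
  by rewrite /= -[h *: 1]/(h * 1) mulr1 addrC.
rewrite distrC.
have -> : h^-1 *: (f (t + h) - f t) - df = h^-1 * (f (t + h) - f t - h * df).
  by rewrite mulrBr mulKf.
rewrite normrM normfV ler_pdivrMl ?normr_gt0//.
rewrite (le_trans (H h hr))// -real_normK ?num_real// expr2 mulrCA ler_wpM2l//.
rewrite (le_trans (ler_wpM2r (normr_ge0 h) (ler_norm c)))//.
move: hc; rewrite ler_pdivlMr ?ltr_wpDl// => hc; apply: le_trans hc.
by rewrite mulrC ler_wpM2l// lerDl.
Unshelve. all: by end_near. Qed.

End derivative_from_remainder.

Section third_cumulant.
Context {R : realType} (eta C : R) d (W : measurableType d) (P : probability W R) (X : W -> R).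
Hypotheses (eta0 : 0 < eta) (hX : exp_moment_bound P eta C X).

Let mX : measurable_fun setT X. Proof. by case: hX. Qed.
Let iexp : P.-integrable setT (fun w => (expR (eta * `|X w|))%:E).
Proof. by case: hX. Qed.

(** The derivative of order [k] of the moment generating function at [t], for [t] near 0. *)
Definition tilted_moment (k : nat) (t : R) : R := \int[P]_w (X w ^+ k * expR (t * X w)).
Let m := tilted_moment.

Let half_dom k (t : R) w : `|t| <= eta / 2 ->
  `|X w| ^+ k * expR (`|t| * `|X w|) <= k`!%:R / (eta / 2) ^+ k * expR (eta * `|X w|).
Proof.
move=> t2; have e2 : 0 < eta / 2 by rewrite divr_gt0.
have -> : eta * `|X w| = eta / 2 * `|X w| + eta / 2 * `|X w| by field.
rewrite expRD mulrA ler_pM ?expR_ge0 ?exprn_ge0 ?ler_expR ?ler_wpM2r//.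
rewrite mulrAC ler_pdivlMr ?exprn_gt0// mulrC -exprMn.
by apply: exprn_le_exp; rewrite mulr_ge0// ltW.
Qed.

Let expR_norm_le (t : R) w : expR (t * X w) <= expR (`|t| * `|X w|).
Proof. by rewrite ler_expR -normrM ler_norm. Qed.

Let mterm k (t : R) : measurable_fun setT (fun w => X w ^+ k * expR (t * X w)).
Proof.
apply: measurable_funM; first exact: measurable_funX.
by apply: measurableT_comp => //; exact: measurable_funM.
Qed.

Let iterm k (t : R) : `|t| <= eta / 2 ->
  P.-integrable setT (EFin \o (fun w => X w ^+ k * expR (t * X w))).
Proof.
move=> t2; apply: (integrable_exp_dom hX (c := k`!%:R / (eta / 2) ^+ k)) => // w.
rewrite normrM normrX (ger0_norm (expR_ge0 _)) (le_trans _ (half_dom k w t2))//.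
by rewrite ler_wpM2l ?exprn_ge0.
Qed.

(** Radius [eta / 4] for both [t] and the increment keeps all arguments within [eta / 2], where
    [half_dom] spends one half of [eta] on the exponential and the other on the powers of [X]. *)
Let is_derive_m k (t : R) : `|t| <= eta / 4 ->
  is_derive (t : R) (1 : R) (m k) (m k.+1 t).
Proof.
move=> t4; have e4 : 0 < eta / 4 by rewrite divr_gt0.
have eta_half : eta / 4 + eta / 4 = eta / 2 by field.
have ineq42 : eta / 4 <= eta / 2 by rewrite -eta_half lerDl ltW.
have t2 : `|t| <= eta / 2 by rewrite (le_trans t4).
pose c := (k.+2)`!%:R / (eta / 2) ^+ k.+2 * C.
apply: (@is_derive_sqr_remainder _ _ _ _ c _ e4) => h h4.
have th2 : `|t + h| <= eta / 2.
  by rewrite (le_trans (ler_normD _ _))// -eta_half lerD.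
have hth : `| `|t| + `|h| | <= eta / 2 by rewrite ger0_norm ?addr_ge0// -eta_half lerD.
have i1 := iterm k th2; have i2 := iterm k t2; have i3 := iterm k.+1 t2.
have i4 := integrable_scale h measurableT i3.
have i12 := integrableB measurableT i1 i2.
rewrite /m /tilted_moment -RintegralB// -RintegralZl// -RintegralB//.
have iD := integrableB measurableT i12 i4.
rewrite (le_trans (le_normr_Rintegral _ iD))//.
have idom := integrable_scale (h ^+ 2 * ((k.+2)`!%:R / (eta / 2) ^+ k.+2)) measurableT iexp.
apply: (@le_trans _ _ (\int[P]_w (h ^+ 2 * ((k.+2)`!%:R / (eta / 2) ^+ k.+2) * expR (eta * `|X w|)))).
  apply: le_Rintegral => //; first exact: integrable_norm.
  move=> w _ /=.
  have -> : X w ^+ k * expR ((t + h) * X w) - X w ^+ k * expR (t * X w) -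
      h * (X w ^+ k.+1 * expR (t * X w)) =
      X w ^+ k * expR (t * X w) * (expR (h * X w) - \sum_(0 <= j < 2) (h * X w) ^+ j / j`!%:R).
    rewrite !big_nat_recr//= big_nil add0r expr0 expr1 fact0 (_ : 1`! = 1)%N// !divr1.
    by rewrite mulrDl expRD exprS; ring.
  rewrite !normrM normrX (ger0_norm (expR_ge0 _)).
  have et := expR_tail (h * X w) 2.
  apply: (@le_trans _ _ (`|X w| ^+ k * expR (`|t| * `|X w|) * (`|h * X w| ^+ 2 * expR `|h * X w|))).
    by rewrite ler_pM ?mulr_ge0 ?exprn_ge0 ?expR_ge0// ler_wpM2l ?exprn_ge0.
  have -> : `|X w| ^+ k * expR (`|t| * `|X w|) * (`|h * X w| ^+ 2 * expR `|h * X w|) =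
      h ^+ 2 * (`|X w| ^+ k.+2 * expR ((`|t| + `|h|) * `|X w|)).
    rewrite mulrDl expRD normrM !exprS expr0 !mulr1.
    have -> : h * h = `|h| * `|h| by rewrite -!expr2 real_normK ?num_real.
    by ring.
  rewrite -mulrA ler_wpM2l ?sqr_ge0//.
  have := half_dom k.+2 w hth.
  by rewrite (ger0_norm (addr_ge0 (normr_ge0 t) (normr_ge0 h))).
rewrite RintegralZl// /c [leRHS]mulrC -[leLHS]mulrA ler_wpM2l ?sqr_ge0// ler_wpM2l//.
  by rewrite divr_ge0// exprn_ge0// divr_ge0// ltW.
by case: hX.
Qed.

(** Since [exp x >= 1 + x] and [X] is centered, the moment generating function is at least 1. *)
Let m_gt0 (t : R) : `|t| <= eta / 2 -> 0 < m 0 t.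
Proof.
move=> t2; apply: (@lt_le_trans _ _ 1) => //.
have [_ _ _ EX] := hX.
have i0 := iterm 0 t2.
have iX : P.-integrable setT (EFin \o X).
  by have := integrable_momentX eta0 hX 1; under [_ \o _]eq_fun do rewrite /= expr1.
have itX := integrable_scale t measurableT iX.
have i1 : P.-integrable setT (EFin \o (fun=> 1 : R)).
  exact/bounded_measurable_integrable/bounded_measurable_cst.
have <- : \int[P]_w (1 + t * X w) = 1.
  rewrite RintegralD// RintegralZl// EX mulr0 addr0.
  by have := cexpect_cst P 1; rewrite /cexpect => -[].
apply: le_Rintegral => //; first exact: (integrableD measurableT i1 itX).
by move=> w _; rewrite expr0 mul1r expR_ge1Dx.
Qed.

(** With [m 0 0 = 1] and [m 1 0 = 0], every other term of the third derivative of [ln (m 0)] at 0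
    vanishes. The intermediate derivatives are identified only for [|t| < eta / 4], and near
    equality suffices to differentiate again. *)
Lemma cumulant3E : cumulant P 3 X = \int[P]_w (X w ^+ 3).
Proof.
have e4 : 0 < eta / 4 by rewrite divr_gt0.
have ineq42 : eta / 4 <= eta / 2 by rewrite ler_pM2l// lef_pV2 ?posrE// ler_nat.
have in4 (t : R) : `|t| < eta / 4 -> \forall s \near t, `|s| < eta / 4.
  move=> t4; apply: (@cvgr_lt _ _ (nbhs t) _ (fun s : R => `|s|) `|t|) => //.
  exact: norm_continuous.
have [_ _ _ EX] := hX.
pose f1 t := m 1 t / m 0 t.
pose f2 t := m 2 t / m 0 t - f1 t ^+ 2.
have d0 (t : R) : `|t| < eta / 4 -> derive1 (cgf P X) t = f1 t.
  move=> /ltW t4; have t2 := le_trans t4 ineq42.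
  have -> : cgf P X = (@ln R) \o (m 0).
    apply/funext => s; rewrite /cgf /= /mmt_gen_fun unlock /m /tilted_moment; congr ln.
    congr fine; apply: eq_integral => w _ /=.
    by rewrite expr0 mul1r mulrC.
  have dm := is_derive_m 0 t4; have dl := is_derive1_ln (m_gt0 t2).
  have := is_derive1_comp dl dm => dd.
  by rewrite derive1E derive_val /f1 mulrC.
have d1 (t : R) : `|t| < eta / 4 -> is_derive (t : R) (1 : R) f1 (f2 t).
  move=> /ltW t4; have t2 := le_trans t4 ineq42.
  have dm0 := is_derive_m 0 t4; have dm1 := is_derive_m 1 t4.
  have m0 : m 0 t != 0 by rewrite gt_eqF// m_gt0.
  have dV := is_deriveV m0 dm0.
  have dM := is_deriveM dm1 dV.
  apply: is_derive_eq dM _.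
  rewrite /f2 /f1 /GRing.scale/=; field; exact: m0.
have d2 : is_derive (0 : R) (1 : R) f2 (m 3 0).
  have t4 : `|0 : R| <= eta / 4 by rewrite normr0 ltW.
  have t4' : `|0 : R| < eta / 4 by rewrite normr0.
  have dm0 := is_derive_m 0 t4; have dm2 := is_derive_m 2 t4.
  have E1 : m 1 0 = 0.
    by rewrite /m /tilted_moment -[RHS]EX; apply: eq_Rintegral => w _; rewrite mul0r expR0 mulr1.
  have E0 : m 0 0 = 1.
    have := cexpect_cst P 1; rewrite /cexpect => -[h _]; rewrite -[RHS]h.
    by apply: eq_Rintegral => w _; rewrite mul0r expR0 mulr1.
  have m0 : m 0 0 != 0 by rewrite E0 oner_neq0.
  have dV := is_deriveV m0 dm0.
  have dM := is_deriveM dm2 dV.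
  have dX := is_deriveX 2 (d1 0 t4').
  have := is_deriveB dM dX => h; apply: is_derive_eq h _.
  by rewrite /f1 E1 E0 /GRing.scale/=; field.
have step (t : R) : `|t| < eta / 4 -> derive1 (derive1 (cgf P X)) t = f2 t.
  move=> t4; rewrite derive1E (@near_eq_derive _ _ _ _ f1); last first.
    by apply: filterS (in4 t t4) => s; exact: d0.
  have := d1 t t4 => h; exact: derive_val.
rewrite /cumulant /derive1n/= derive1E (@near_eq_derive _ _ _ _ f2); last first.
  by apply: filterS (in4 0 _) => [s|]; [exact: step|rewrite normr0].
rewrite derive_val /m /tilted_moment; apply: eq_Rintegral => w _.
by rewrite mul0r expR0 mulr1.
Qed.

End third_cumulant.

(** [X] inherits an exponential moment bound with radius [eta / (1 + s)]; this choice, unlike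
    [eta / s], also covers [s = 0]. *)
Lemma cumulant3_scale (R : realType) (eta C : R) d (W : measurableType d)
    (P : probability W R) (X Y : W -> R) (s : R) : 0 < eta -> 0 <= s ->
  measurable_fun setT X -> exp_moment_bound P eta C Y ->
  {ae P, forall w, X w = s * Y w} ->
  cumulant P 3 X = \int[P]_w (X w ^+ 3) /\
  \int[P]_w (X w ^+ 3) = s ^+ 3 * \int[P]_w (Y w ^+ 3).
Proof.
move=> eta0 s0 mX hY XY; have [mY ie eC EY] := hY.
have s1 : 0 < 1 + s by rewrite ltr_wpDr.
have e1 : 0 < eta / (1 + s) by rewrite divr_gt0.
have iY : P.-integrable setT (EFin \o Y).
  by have := integrable_momentX eta0 hY 1; under [_ \o _]eq_fun do rewrite /= expr1.
have msY : measurable_fun setT (fun w => s * Y w) by exact: measurable_funM.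
have mexp (Z : W -> R) (c : R) : measurable_fun setT Z -> measurable_fun setT (fun w => expR (c * `|Z w|)).
  move=> mZ; apply: measurableT_comp => //; apply: measurable_funM => //.
  exact: measurableT_comp.
have dom w : expR (eta / (1 + s) * `|s * Y w|) <= expR (eta * `|Y w|).
  rewrite ler_expR normrM (ger0_norm s0) mulrA ler_wpM2r//.
  by rewrite mulrAC ler_pdivrMr// ler_wpM2l ?ler_wpDl// ltW.
have isY : P.-integrable setT (EFin \o (fun w => expR (eta / (1 + s) * `|s * Y w|))).
  apply: le_integrable ie => //; first by apply/measurable_EFinP; exact: mexp.
  by move=> w _; rewrite /= lee_fin !(ger0_norm (expR_ge0 _)).
have [iX eX] := integrable_ae_eq (mexp X (eta / (1 + s)) mX) (mexp _ (eta / (1 + s)) msY)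
  (filterS (fun w h => congr1 (fun x => expR (eta / (1 + s) * `|x|)) h) XY) isY.
have hX : exp_moment_bound P (eta / (1 + s)) C X.
  split => //.
    rewrite eX (le_trans _ eC)//; apply: le_Rintegral => // w _; exact: dom.
  have [_ ->] := integrable_ae_eq mX msY XY (integrable_scale s measurableT iY).
  by rewrite RintegralZl// EY mulr0.
split; first exact: cumulant3E e1 hX.
have i3 := integrable_momentX eta0 hY 3.
rewrite -RintegralZl//.
have [] := @integrable_ae_eq _ _ _ P (fun w => X w ^+ 3) (fun w => s ^+ 3 * Y w ^+ 3) => //.
- exact: measurable_funX.
- by apply: measurable_funM => //; exact: measurable_funX.
- by apply: filterS XY => w ->; rewrite exprMn.
- exact: integrable_scale.
Qed.

(** * Parameter integrals, densities and integrals of nonmeasurable functions *)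

Lemma measurable_kernel_Rintegral d d' (X : measurableType d) (Y : measurableType d')
    (R : realType) (k : R.-sfker X ~> Y) (F : X * Y -> R) : measurable_fun setT F ->
  measurable_fun setT (fun x => \int[k x]_y F (x, y)).
Proof.
move=> mF; have mE : measurable_fun setT (EFin \o F) by exact/measurable_EFinP.
have -> : (fun x => \int[k x]_y F (x, y)) = (fun x => fine
    (\int[k x]_y (EFin \o F)^\+ (x, y) - \int[k x]_y (EFin \o F)^\- (x, y))%E).
  apply/funext => x; rewrite /Rintegral integralE.
  by congr (fine (_ - _)%E); apply: eq_integral => y _; rewrite !unlock.
apply: measurableT_comp => //; apply: emeasurable_funB.
- by apply: measurable_fun_integral_sfinite_kernel => //; exact: measurable_funepos.
- by apply: measurable_fun_integral_sfinite_kernel => //; exact: measurable_funeneg.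
Qed.

Section integral_density.
Context d (T : measurableType d) (R : realType) (mu : {measure set T -> \bar R}) (f : T -> R).
Hypotheses (mf : measurable_fun setT f) (f0 : forall x, 0 <= f x).
Local Open Scope ereal_scope.
Import HBNNSimple.

Lemma ge0_integral_density (h : T -> \bar R) : (forall x, 0 <= h x) ->
  measurable_fun setT h ->
  \int[density_measure mu mf f0]_x h x = \int[mu]_x (h x * (f x)%:E).
Proof.
move=> h0 mh; have mfE : measurable_fun setT (EFin \o f) by exact/measurable_EFinP.
pose s := nnsfun_approx measurableT mh.
have sh x : (EFin \o s n) x @[n --> \oo] --> h x by exact: cvg_nnsfun_approx.
have -> : \int[density_measure mu mf f0]_x h x =
    lim (\int[density_measure mu mf f0]_x (EFin \o s n) x @[n --> \oo]).
  rewrite (eq_integral (fun x => lim ((EFin \o s n) x @[n --> \oo]))); last first.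
    by move=> x _; apply/esym/cvg_lim => //; exact: sh.
  apply: monotone_convergence => //.
  - by move=> n; exact/measurable_EFinP.
  - by move=> n x _; rewrite lee_fin.
  - by move=> x _ a b ab; rewrite lee_fin; exact/lefP/nd_nnsfun_approx.
have -> : \int[mu]_x (h x * (f x)%:E) =
    lim (\int[mu]_x ((EFin \o s n) x * (f x)%:E) @[n --> \oo]).
  rewrite (eq_integral (fun x => lim ((EFin \o s n) x * (f x)%:E @[n --> \oo]))); last first.
    by move=> x _; apply/esym/cvg_lim => //; apply: cvgeZr => //; exact: sh.
  apply: monotone_convergence => //.
  - by move=> n; apply: emeasurable_funM => //; exact/measurable_EFinP.
  - by move=> n x _; rewrite mule_ge0 ?lee_fin.
  - by move=> x _ a b ab; rewrite lee_wpmul2r ?lee_fin//; exact/lefP/nd_nnsfun_approx.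
suff suf n : \int[mu]_x ((EFin \o s n) x * (f x)%:E) =
    \int[density_measure mu mf f0]_x (EFin \o s n) x.
  by under [in RHS]eq_fun do rewrite suf.
rewrite [RHS]integral_nnsfun// patch_setT sintegralE.
transitivity (\int[mu]_x (\sum_(y \in range (s n)) (y * \1_(s n @^-1` [set y]) x)%:E * (f x)%:E)).
  apply: eq_integral => x _.
  rewrite -ge0_mule_fsuml => [|y]; last exact: nnfun_muleindic_ge0.
  by rewrite fsumEFin // -(fimfunE _ x).
rewrite ge0_integral_fsum//; last 2 first.
- move=> y; apply: emeasurable_funM => //.
  by apply/measurable_EFinP; exact: measurable_funM.
- move=> m y _; apply: mule_ge0; last by rewrite lee_fin.
  by rewrite EFinM nnfun_muleindic_ge0.
apply: eq_fsbigr => r /set_mem [x0 _ x0r].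
have r0 : (0 <= r)%R by rewrite -x0r.
rewrite [X in _ = (_ * X)%E](_ : _ =
    \int[mu]_x ((\1_(s n @^-1` [set r]) x)%:E * (f x)%:E)); last first.
  rewrite /= /density_measure integral_mkcond; apply: eq_integral => x _.
  by rewrite /patch indicE; case: ifP => _; rewrite ?mul1e ?mul0e.
rewrite -ge0_integralZl//.
- by apply: eq_integral => x _; rewrite EFinM muleA.
- by apply: emeasurable_funM => //; exact/measurable_EFinP.
- by move=> x _; rewrite mule_ge0 ?lee_fin.
Qed.

End integral_density.

Section almost_everywhere_nonmeasurable.
Context d (T : measurableType d) (R : realType) (mu : {measure set T -> \bar R}) (O : set T).
Hypotheses (mO : measurable O) (O0 : mu (~` O) = 0%E).
Local Open Scope ereal_scope.
Import HBNNSimple.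

(** The integral of a nonnegative function is a supremum over simple functions below it, measurable
    or not. Multiplying such a simple function by the indicator of [O] keeps its integral and places
    it below [g]. *)
Let ge0_integral_le_on (f g : T -> \bar R) : (forall x, 0 <= f x) -> (forall x, 0 <= g x) ->
  {in O, f =1 g} -> \int[mu]_x f x <= \int[mu]_x g x.
Proof.
move=> f0 g0 fg; rewrite !ge0_integralTE//; apply: ge_ereal_sup => _ [h hf <-].
pose k : {nnsfun T >-> R} := mul_nnsfun h (indic_nnsfun R mO).
apply: ereal_sup_ubound; exists k.
  move=> x; suff : (h x * \1_O x)%:E <= g x by [].
  rewrite indicE; case: (boolP (x \in O)) => [xO|_]; last by rewrite mulr0 g0.
  by rewrite mulr1 -fg// hf.
have mk (j : {nnsfun T >-> R}) : sintegral mu j = \int[mu]_x (j x)%:E.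
  by rewrite integral_nnsfun// patch_setT.
rewrite !mk; apply: ae_eq_integral => //; try exact/measurable_EFinP.
exists (~` O); split => //; first exact: measurableC.
move=> x /= H xO; apply: H => _; suff : (h x * \1_O x)%:E = (h x)%:E by [].
by rewrite indicE mem_set// mulr1.
Qed.

Lemma eq_integral_on (f g : T -> \bar R) : {in O, f =1 g} ->
  \int[mu]_x f x = \int[mu]_x g x.
Proof.
move=> fg; rewrite integralE [RHS]integralE.
have pE : \int[mu]_x f^\+ x = \int[mu]_x g^\+ x.
  apply/eqP; rewrite eq_le; apply/andP; split; apply: ge0_integral_le_on => // x xO.
    by rewrite !unlock fg.
  by rewrite !unlock fg.
have nE : \int[mu]_x f^\- x = \int[mu]_x g^\- x.
  apply/eqP; rewrite eq_le; apply/andP; split; apply: ge0_integral_le_on => // x xO.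
    by rewrite !unlock fg.
  by rewrite !unlock fg.
by rewrite pE nE.
Qed.

Lemma eq_Rintegral_on (f g : T -> R) : {in O, f =1 g} ->
  (\int[mu]_x f x = \int[mu]_x g x)%R.
Proof. by move=> fg; congr fine; apply: eq_integral_on => x xO; rewrite fg. Qed.

End almost_everywhere_nonmeasurable.

(** * Reweighting a density *)

Section reweighting.
Context d (T : measurableType d) (R : realType) (Q : probability T R).

Lemma bounded_le_integral (f : T -> R) (c : R) : bounded_measurable f ->
  (forall t, f t <= c) -> \int[Q]_t f t <= c.
Proof.
move=> bf fc; have := cexpect_cst Q c%:C%C; rewrite /cexpect => -[<- _].
apply: le_Rintegral => //; first exact: bounded_measurable_integrable.
exact/bounded_measurable_integrable/bounded_measurable_cst.
Qed.

Lemma bounded_norm_integral_le (f : T -> R) (c : R) : bounded_measurable f ->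
  (forall t, `|f t| <= c) -> `|\int[Q]_t f t| <= c.
Proof.
move=> bf fc; have i := bounded_measurable_integrable Q bf.
rewrite (le_trans (le_normr_Rintegral _ i))// bounded_le_integral//.
exact: bounded_measurable_norm.
Qed.

Lemma Rintegral_cst1 (c : R) : \int[Q]_t c = c.
Proof. by have := cexpect_cst Q c%:C%C; rewrite /cexpect => -[]. Qed.

(** The mean of [u] is at least [1 / 2], so dividing by it costs a factor 2. The error is at most
    [4 (A + e)^2 + 2 e], and [e <= 1 / 2] turns this into the stated bound. *)
Let reweighting_everywhere (u a : T -> R) (A e : R) : A + e <= 1 / 2 ->
  measurable_fun setT u -> measurable_fun setT a ->
  (forall t, `|u t - 1 - a t| <= e) -> (forall t, `|a t| <= A) ->
  [/\ 1 / 2 <= \int[Q]_t u t, \int[Q]_t `|a t - \int[Q]_t a t| <= 2 * A &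
  `|\int[Q]_t `|u t / (\int[Q]_t u t) - 1| - \int[Q]_t `|a t - \int[Q]_t a t| |
    <= 8 * A ^+ 2 + 6 * e].
Proof.
move=> Ae mu_ ma ue aA.
have A0 : 0 <= A by exact: le_trans (aA point).
have e0 : 0 <= e by exact: le_trans (ue point).
have ba : bounded_measurable a by split=> //; exists A.
have c1 := @bounded_measurable_cst _ T R.
pose r t := u t - 1 - a t.
have br : bounded_measurable r.
  by split; [apply: measurable_funB => //; exact: measurable_funB|exists e].
have uE t : u t = 1 + a t + r t by rewrite /r; ring.
have bu : bounded_measurable u.
  rewrite (_ : u = (fun t => 1 + a t + r t)); last by apply/funext.
  exact: bounded_measurableD (bounded_measurableD (c1 1) ba) br.
have I := bounded_measurable_integrable Q.
set m := \int[Q]_t u t; set ma_ := \int[Q]_t a t; pose mr := \int[Q]_t r t.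
have mE : m = 1 + ma_ + mr.
  rewrite /m; under eq_Rintegral do rewrite uE.
  rewrite RintegralD//; [|exact: I (bounded_measurableD (c1 1) ba)|exact: I].
  rewrite RintegralD//; [|exact: I (c1 1)|exact: I].
  by rewrite Rintegral_cst1.
have maA : `|ma_| <= A by exact: bounded_norm_integral_le.
have mre : `|mr| <= e by exact: bounded_norm_integral_le.
have m12 : 1 / 2 <= m.
  by rewrite mE; move: maA mre; rewrite !ler_norml => /andP[? ?] /andP[? ?]; lra.
have m0 : 0 < m by rewrite (lt_le_trans _ m12).
have b1 : bounded_measurable (fun t => `|u t / m - 1|).
  apply: bounded_measurable_norm; apply: bounded_measurableB; last exact: c1.
  exact: bounded_measurableM bu (c1 _).
have b2 : bounded_measurable (fun t => `|a t - ma_|).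
  by apply: bounded_measurable_norm; apply: bounded_measurableB.
split => //.
  apply: bounded_le_integral => // t.
  by rewrite (le_trans (ler_normB _ _))// mulr2n mulrDl !mul1r lerD.
rewrite -RintegralB//; [|exact: I|exact: I].
apply: bounded_norm_integral_le; first exact: bounded_measurableB.
move=> t; apply: (le_trans (ler_dist_dist _ _)).
(* Splits [(u - m) / m] as [(u - m) + (u - m) (1 - m) / m]; the first part is [a - ma_] up to the
   remainder, the second is quadratic. *)
have -> : u t / m - 1 - (a t - ma_) = (u t - m) / m * (1 - m) + (r t - mr).
  by rewrite uE mE; field; rewrite -mE gt_eqF.
have h1 : `|u t - m| <= 2 * (A + e).
  have -> : u t - m = a t + r t - ma_ - mr by rewrite uE mE; ring.
  have := aA t; have := ue t; rewrite -/(r t) => h2 h3.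
  rewrite (le_trans (ler_normB _ _))// (le_trans (lerD (ler_normB _ _) (lexx _)))//.
  by rewrite (le_trans (lerD (lerD (ler_normD _ _) (lexx _)) (lexx _)))//; lra.
have h2 : `|1 - m| <= A + e.
  have -> : 1 - m = - (ma_ + mr) by rewrite mE; ring.
  by rewrite normrN (le_trans (ler_normD _ _))// lerD.
have h3 : `|m^-1| <= 2.
  rewrite normfV gtr0_norm// -[leRHS]invrK lef_pV2 ?posrE ?invr_gt0//.
  by rewrite (le_trans _ m12)// mul1r.
have h4 : `|r t - mr| <= 2 * e.
  by rewrite (le_trans (ler_normB _ _))// mulr2n mulrDl !mul1r lerD// ue.
have h5 : `|(u t - m) / m * (1 - m)| <= 2 * (A + e) * 2 * (A + e).
  by rewrite !normrM ler_pM ?mulr_ge0// ler_pM.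
rewrite (le_trans (ler_normD _ _))// (le_trans (lerD h5 h4))//.
by nra.
Qed.

(** [a'] is a measurable version of [a] on [O]: the intended [a] contains cumulants, which are only
    known to agree with measurable moments on [O]. *)
Lemma reweighting_tv (O : set T) (u a a' : T -> R) (A e : R) :
  measurable O -> Q O = 1%E -> 0 <= A -> 0 <= e -> A + e <= 1 / 2 ->
  measurable_fun setT u -> measurable_fun setT a' -> {in O, a =1 a'} ->
  (forall t, O t -> `|u t - 1 - a t| <= e) -> (forall t, O t -> `|a t| <= A) ->
  [/\ {ae Q, forall t, 0 < u t}, 0 < \int[Q]_t u t,
   \int[Q]_t `|a t - \int[Q]_t a t| <= 2 * A &
  `|\int[Q]_t `|u t / (\int[Q]_t u t) - 1| - \int[Q]_t `|a t - \int[Q]_t a t| |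
    <= 8 * A ^+ 2 + 6 * e].
Proof.
move=> mO O1 A0 e0 Ae mu_ ma aa' ue aA.
have O0 : Q (~` O) = 0%E by rewrite probability_setC// O1 subee.
(* Outside [O] the weight becomes 1 and its main term 0, so that the bounds hold everywhere. *)
pose u1 t := \1_O t * (u t - 1) + 1; pose a1 t := \1_O t * a' t.
have m1O : measurable_fun setT (\1_O : T -> R) by exact: measurable_indic.
have mu1 : measurable_fun setT u1.
  by apply: measurable_funD => //; apply: measurable_funM => //; exact: measurable_funB.
have ma1 : measurable_fun setT a1 by exact: measurable_funM.
have uu1 : {in O, u =1 u1} by move=> t tO; rewrite /u1 indicE tO mul1r subrK.
have aa1 : {in O, a =1 a1} by move=> t tO; rewrite /a1 indicE tO mul1r aa'.
have := @reweighting_everywhere u1 a1 A e Ae mu1 ma1.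
have h1 t : `|u1 t - 1 - a1 t| <= e.
  have [tO|tO] := boolP (t \in O); first by rewrite -uu1// -aa1// ue//; exact: set_mem.
  by rewrite /u1 /a1 indicE (negbTE tO) !mul0r add0r subrr subr0 normr0.
have h2 t : `|a1 t| <= A.
  have [tO|tO] := boolP (t \in O); first by rewrite -aa1// aA//; exact: set_mem.
  by rewrite /a1 indicE (negbTE tO) mul0r normr0.
move=> /(_ h1 h2).
have E := eq_Rintegral_on mO O0.
rewrite -(E u u1)// -(E a a1)//.
rewrite -(E (fun t => `|u t / \int[Q]_t u t - 1|) (fun t => `|u1 t / \int[Q]_t u t - 1|)); last first.
  by move=> t tO; rewrite uu1.
rewrite -(E (fun t => `|a t - \int[Q]_t a t|) (fun t => `|a1 t - \int[Q]_t a t|)); last first.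
  by move=> t tO; rewrite aa1.
move=> [m12 h0 h]; split => //; last by rewrite (lt_le_trans _ m12).
exists (~` O); split => //; first exact: measurableC.
move=> t /= ut tO; apply: ut.
have := ue _ tO; have := aA _ tO; rewrite !ler_norml => /andP[? ?] /andP[? ?].
by move: e0; rewrite le_eqVlt; lra.
Qed.

Lemma mean_abs_dev_scale (O : set T) (h h' : T -> R) (c M : R) :
  measurable O -> Q O = 1%E -> 0 <= c -> measurable_fun setT h' -> {in O, h =1 h'} ->
  (forall t, O t -> `|h t| <= M) ->
  \int[Q]_t `|c * h t - \int[Q]_t (c * h t)| = c * \int[Q]_t `|h t - \int[Q]_t h t|.
Proof.
move=> mO O1 c0 mh' hh' hM.
have O0 : Q (~` O) = 0%E by rewrite probability_setC// O1 subee.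
pose g t := \1_O t * h' t.
have hg : {in O, h =1 g} by move=> t tO; rewrite /g indicE tO mul1r hh'.
have bg : bounded_measurable g.
  split; first by apply: measurable_funM => //; exact: measurable_indic.
  exists `|M| => t; have [tO|tO] := boolP (t \in O).
    by rewrite -hg// (le_trans (hM _ (set_mem tO)))// ler_norm.
  by rewrite /g indicE (negbTE tO) mul0r normr0.
have E := eq_Rintegral_on mO O0.
rewrite (E h g)// (E (fun t => c * h t) (fun t => c * g t)); last by move=> t tO; rewrite hg.
rewrite (E (fun t => `|c * h t - \int[Q]_t (c * g t)|) (fun t => `|c * g t - \int[Q]_t (c * g t)|)); last first.
  by move=> t tO; rewrite hg.
rewrite (E (fun t => `|h t - \int[Q]_t g t|) (fun t => `|g t - \int[Q]_t g t|)); last first.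
  by move=> t tO; rewrite hg.
have I := bounded_measurable_integrable Q.
rewrite RintegralZl//; last exact: I.
have bgd : bounded_measurable (fun t => `|g t - \int[Q]_t g t|).
  apply: bounded_measurable_norm.
  by apply: bounded_measurableB => //; exact: bounded_measurable_cst.
rewrite -[RHS]RintegralZl//; last exact: I bgd.
by apply: eq_Rintegral => t _; rewrite -mulrBr normrM ger0_norm.
Qed.

End reweighting.

(** * The posterior as a probability and measurability of the weights *)

Section posterior_facts.
Context (R : realType) (S : model R) (n : nat).
Local Notation Q := (post S n).

Let Z := \int[mu S n]_t (expR (- beta S n * loss t) * prior t).

Let Z_gt0 : 0 < Z.
Proof. by rewrite /Z /Rintegral fine_gt0//; exact: normalizable. Qed.

Local Notation Q' := (density_measure (mu S n) (@measurable_post_dens R S n) (@post_dens_ge0 R S n)).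

Lemma post_setT : Q' setT = 1%E.
Proof.
have mf : measurable_fun setT (fun t : Theta S n => expR (- beta S n * loss t) * prior t).
  apply: measurable_funM; last exact: prior_measurable.
  apply: measurableT_comp => //; apply: measurable_funM => //.
  exact: measurable_loss.
rewrite /= /density_measure /post_dens.
under eq_integral do rewrite mulrC EFinM.
rewrite ge0_integralZl//; last 3 first.
- exact/measurable_EFinP.
- by move=> t _; rewrite lee_fin mulr_ge0 ?expR_ge0 ?prior_ge0.
- by rewrite lee_fin invr_ge0 ltW.
have Zfin : (\int[mu S n]_t (expR (- beta S n * loss t) * prior t)%:E \is a fin_num)%E.
  by have /andP[h1 h2] := normalizable S n; rewrite ge0_fin_numE// ltW.
by rewrite -[X in (_ * X)%E]fineK// -EFinM -/(Rintegral _ _ _) mulVf// gt_eqF.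
Qed.

HB.instance Definition _ := Measure_isProbability.Build _ _ _ Q' post_setT.

Definition postP : probability (Theta S n) R := Q'.

Lemma tv_reweighted (g : Theta S n -> R) : measurable_fun setT g ->
  tv (reweighted g) (@post_dens R S n) = 2^-1 * post_mean (fun t => `|g t / post_mean g - 1|).
Proof.
move=> mg; rewrite /tv; congr (_ * _).
rewrite /post_mean /Rintegral ge0_integral_density//; last first.
  apply/measurable_EFinP; apply: measurableT_comp => //; apply: measurable_funB => //.
  exact: measurable_funM.
congr fine; apply: eq_integral => t _.
rewrite -EFinM -[post_dens t in X in _ = X]ger0_norm ?post_dens_ge0// -normrM.
by congr (`|_|%:E); rewrite /reweighted /post_mean /Rintegral; ring.
Qed.

End posterior_facts.

Lemma measurable_product_Rintegral d d' (X : measurableType d) (Y : measurableType d')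
    (R : realType) (Q : {sigma_finite_measure set Y -> \bar R}) (F : X * Y -> R) :
  measurable_fun setT F -> measurable_fun setT (fun x => \int[Q]_y F (x, y)).
Proof.
move=> mF; have mE : measurable_fun setT (EFin \o F) by exact/measurable_EFinP.
have -> : (fun x => \int[Q]_y F (x, y)) = (fun x => fine
    (\int[Q]_y (EFin \o F)^\+ (x, y) - \int[Q]_y (EFin \o F)^\- (x, y))%E).
  apply/funext => x; rewrite /Rintegral integralE.
  by congr (fine (_ - _)%E); apply: eq_integral => y _; rewrite !unlock.
apply: measurableT_comp => //; apply: emeasurable_funB.
- apply: (@measurable_fun_fubini_tonelli_F _ _ _ _ _ Q (EFin \o F)^\+%E) => //.
  exact: measurable_funepos.
- apply: (@measurable_fun_fubini_tonelli_F _ _ _ _ _ Q (EFin \o F)^\-%E) => //.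
  exact: measurable_funeneg.
Qed.

Section joint_measurability.
Context (R : realType) (S : model R) (K : nat) (D : block_rule S K) (n B : nat).
Hypothesis K2 : (2 <= K)%N.
Local Notation T := (Theta S n * Omega D n B)%type.

Lemma measurable_Pr_Rintegral (F : T -> R) : measurable_fun setT F ->
  measurable_fun setT (fun theta => \int[Pr D B theta]_w F (theta, w)).
Proof. exact: (@measurable_kernel_Rintegral _ _ _ _ _ (kprobability (@Pr_measurable R S K D n B))). Qed.

Let measurable_joint_input k b :
  measurable_fun setT (fun p : T => (p.1, @xi R S K D n B k b p.2)).
Proof.
apply: measurable_fun_pair => //.
exact: (measurableT_comp (@xi_measurable R S K D n B k b)).
Qed.

Lemma measurable_joint_point_err k b :
  measurable_fun setT (fun p : T => point_err k b p.1 p.2).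
Proof.
apply: measurable_funB; last exact: (measurableT_comp (@measurable_loss R S n)).
exact: (measurableT_comp (@L_measurable R S n) (measurable_joint_input k b)).
Qed.

Lemma measurable_joint_block_err k :
  measurable_fun setT (fun p : T => block_err k p.1 p.2).
Proof.
apply: measurable_funB; last exact: (measurableT_comp (@measurable_loss R S n)).
apply: measurable_funM => //; apply: measurable_sum => b.
exact: (measurableT_comp (@L_measurable R S n) (measurable_joint_input k b)).
Qed.

Lemma measurable_joint_exp_mean_err :
  measurable_fun setT (fun p : T => expR (- beta S n * mean_err p.1 p.2)).
Proof.
apply: measurableT_comp => //; apply: measurable_funM => //.
apply: measurable_funM => //; apply: measurable_sum => k.
exact: measurable_joint_block_err.
Qed.

Lemma sample_var_centered theta (w : Omega D n B) :
  sample_var theta w = (K%:R - 1)^-1 * centered_ss K (fun k => block_err k theta w).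
Proof. by rewrite -(@sum_sqr_sub_mean _ _ _ _ (fun k => @block_err R S K D n B k theta) K2). Qed.

(** Measurability is read off the spherical average, an integral with parameter, and not off the
    series with its real powers. *)
Lemma measurable_joint_bessel :
  measurable_fun setT (fun p : T => bessel_factor (beta S n) (sample_var p.1 p.2) K).
Proof.
have [d' [T' [Q [om [U sU]]]]] := @sphere_average_exists R K K2.
pose c := beta S n / Num.sqrt K%:R.
have -> : (fun p : T => bessel_factor (beta S n) (sample_var p.1 p.2) K) =
  (fun p => \int[Q]_t (om t * cos (c * \sum_(k < K) U k t * block_err k p.1 p.2))).
  apply/funext => -[theta w]; rewrite /= sample_var_centered.
  rewrite (bessel_factor_average K2 (beta_gt0 S n) sU)//.
  rewrite -(@sum_sqr_sub_mean _ _ _ _ (fun k => @block_err R S K D n B k theta) K2) sumr_ge0// => k _.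
  exact: sqr_ge0.
have [[[mom _] bU] _ _ _ _] := sU.
apply: (@measurable_product_Rintegral _ _ _ _ _ Q
  (fun z : T * T' => om z.2 * cos (c * \sum_(k < K) U k z.2 * block_err k z.1.1 z.1.2))).
apply: measurable_funM; first exact: (measurableT_comp mom).
apply: (measurableT_comp (f := @cos R)).
  by apply: continuous_measurable_fun; exact: continuous_cos.
apply: measurable_funM => //; apply: measurable_sum => k; apply: measurable_funM.
  by have [mU _] := bU k; exact: (measurableT_comp mU).
exact: (measurableT_comp (measurable_joint_block_err k)).
Qed.

Lemma weight_uE (theta : Theta S n) : weight_u D B theta =
  \int[Pr D B theta]_w expR (- beta S n * mean_err theta w).
Proof. by rewrite /weight_u unlock. Qed.

Lemma weight_wE (theta : Theta S n) : weight_w D B theta =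
  \int[Pr D B theta]_w (expR (- beta S n * mean_err theta w)
               * bessel_factor (beta S n) (sample_var theta w) K).
Proof. by rewrite /weight_w unlock. Qed.

Lemma measurable_weight_u : measurable_fun setT (weight_u D (n := n) B).
Proof.
have -> := funext weight_uE.
exact: (measurable_Pr_Rintegral measurable_joint_exp_mean_err).
Qed.

Lemma measurable_weight_w : measurable_fun setT (weight_w D (n := n) B).
Proof.
have -> := funext weight_wE.
apply: (@measurable_Pr_Rintegral (fun p => expR (- beta S n * mean_err p.1 p.2)
               * bessel_factor (beta S n) (sample_var p.1 p.2) K)).
exact: measurable_funM measurable_joint_exp_mean_err measurable_joint_bessel.
Qed.

End joint_measurability.

(** * Posterior estimates *)

(* The errors of all blocks at theta are those of weight_expansion, with
   N s^2 E Y^2 = h2 and N s^3 E Y^3 = h3. *)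
Definition block_structure (R : realType) (S : model R) (K : nat) (D : block_rule S K)
    (eta C : R) (n B N : nat) (theta : Theta S n) (s : R) (Y : Omega D n B -> R)
    (h2 h3 : R) : Prop :=
  [/\ 0 <= s, exp_moment_bound (Pr D B theta) eta C Y,
    block_factorization (Pr D B theta) K (fun k => @block_err R S K D n B k theta) Y N s eta,
    h2 = N%:R * s ^+ 2 * \int[Pr D B theta]_w (Y w ^+ 2) &
    h3 = N%:R * s ^+ 3 * \int[Pr D B theta]_w (Y w ^+ 3)].

Section posterior_estimates.
Context (R : realType) (S : model R) (K : nat) (D : block_rule S K) (eta C : R).
Hypotheses (K2 : (2 <= K)%N) (eta0 : 0 < eta).

Let K0 : 0 < K%:R :> R. Proof. by rewrite ltr0n ltnW. Qed.

(** The scale may depend on the state, so it is replaced by an upper bound [q]; all error terms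
    increase with it, whereas the main terms keep the exact scale through [h2] and [h3]. *)
Lemma pointwise_weight_estimate : exists A rho : R, [/\ 0 <= A, 0 < rho &
  forall n B N (theta : Theta S n) (s : R) (Y : Omega D n B -> R) (h2 h3 q : R),
  (0 < B)%N -> block_structure (D := D) eta C N theta s Y h2 h3 ->
  beta S n * s / K%:R <= q -> q <= rho ->
  let a0 := beta S n ^+ 2 / (2 * K%:R) * h2 in
  let a1 := beta S n ^+ 3 / (3 * K%:R ^+ 2) * h3 in
  [/\ `|a0| <= A * (N%:R * q ^+ 2), `|a1| <= A * (N%:R * q ^+ 3),
      N%:R * q ^+ 2 <= 1 ->
        `|weight_u D B theta - 1 - a0| <= A * (N%:R * q ^+ 3 + (N%:R * q ^+ 2) ^+ 2) &
      N%:R * q ^+ 3 <= 1 ->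
        `|weight_w D B theta - 1 - a1| <= A * (N%:R * q ^+ 4 + (N%:R * q ^+ 3) ^+ 2)]].
Proof.
have [A [rho [A0 rho0 H]]] := @weight_expansion R K eta C K2 eta0.
pose V := 2%N`!%:R / eta ^+ 2 * `|C|; pose U := 3%N`!%:R / eta ^+ 3 * `|C|.
have V0 : 0 <= V by rewrite mulr_ge0// divr_ge0// exprn_ge0// ltW.
have U0 : 0 <= U by rewrite mulr_ge0// divr_ge0// exprn_ge0// ltW.
exists (A + K%:R * V + K%:R * U), rho; split => //.
  by rewrite !addr_ge0// mulr_ge0// ltW.
move=> n B N theta s Y h2 h3 qb B0 [s0 hY fac -> ->] qqb qbrho a0 a1.
have b0 := beta_gt0 S n.
set q := beta S n * s / K%:R in qqb.
have q0 : 0 <= q by rewrite divr_ge0 ?mulr_ge0// ltW.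
have N0 : 0 <= N%:R :> R by [].
have mono i : N%:R * q ^+ i <= N%:R * qb ^+ i.
  by rewrite ler_wpM2l// lerXn2r// nnegrE (le_trans q0).
have ge0 i : 0 <= N%:R * q ^+ i by rewrite mulr_ge0// exprn_ge0.
have monoX i : (N%:R * q ^+ i) ^+ 2 <= (N%:R * qb ^+ i) ^+ 2.
  by apply: lerXn2r (mono i); rewrite nnegrE ?(le_trans (ge0 i) (mono i)).
have a0E : a0 = K%:R * (N%:R * q ^+ 2 * \int[Pr D B theta]_w (Y w ^+ 2) / 2).
  by rewrite /a0 /q; field; rewrite gt_eqF.
have a1E : a1 = K%:R * (N%:R * q ^+ 3 * \int[Pr D B theta]_w (Y w ^+ 3) / 3).
  by rewrite /a1 /q; field; rewrite gt_eqF.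
have hV : `|\int[Pr D B theta]_w (Y w ^+ 2)| <= V.
  apply: (le_trans (momentX_le eta0 hY 2)); rewrite ler_wpM2l ?ler_norm//.
  by rewrite divr_ge0// exprn_ge0// ltW.
have hU : `|\int[Pr D B theta]_w (Y w ^+ 3)| <= U.
  apply: (le_trans (momentX_le eta0 hY 3)); rewrite ler_wpM2l ?ler_norm//.
  by rewrite divr_ge0// exprn_ge0// ltW.
have KV0 : 0 <= K%:R * V by rewrite mulr_ge0// ltW.
have KU0 : 0 <= K%:R * U by rewrite mulr_ge0// ltW.
have [H1 H2] := H _ _ (Pr D B theta) (fun k => @block_err R S K D n B k theta)
  (beta S n) s Y N b0 s0 (@measurable_block_err R S K D n B theta) hY fac (le_trans qqb qbrho).
have bound i j (x G : R) : `|x| <= G -> (1 <= j)%N ->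
    `|K%:R * (N%:R * q ^+ i * x / j%:R)| <= K%:R * G * (N%:R * qb ^+ i).
  move=> xG j1; rewrite normrM (gtr0_norm K0) -[leRHS]mulrA (ler_wpM2l (ltW K0))//.
  rewrite normrM normrM ger0_norm// normfV normr_nat.
  rewrite ler_pdivrMr ?ltr0n// mulrC [leRHS]mulrC.
  have G0 : 0 <= G by rewrite (le_trans _ xG).
  have g0 := ge0 i; have mi := mono i.
  apply: (@le_trans _ _ (G * (N%:R * qb ^+ i))); first by rewrite ler_pM.
  by rewrite ler_peMl ?ler1n// mulr_ge0// (le_trans _ mi).
split.
- rewrite a0E (le_trans (bound 2%N 2%N _ _ hV isT))// ler_wpM2r//.
    by rewrite (le_trans _ (mono 2%N)).
  by rewrite addrAC lerDr addr_ge0.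
- rewrite a1E (le_trans (bound 3%N 3%N _ _ hU isT))// ler_wpM2r//.
    by rewrite (le_trans _ (mono 3%N)).
  by rewrite lerDr addr_ge0.
- move=> Nq; have := H1 (le_trans (mono 2%N) Nq).
  rewrite weight_uE -/q -a0E opprD addrA => h; apply: (le_trans h).
  apply: ler_pM => //; first by rewrite addr_ge0 ?exprn_ge0.
    by rewrite -addrA lerDl addr_ge0.
  exact: lerD (mono 3%N) (monoX 2%N).
- move=> Nq; have := H2 (le_trans (mono 3%N) Nq).
  rewrite weight_wE -/q -a1E opprD addrA => h; apply: (le_trans h).
  apply: ler_pM => //; first by rewrite addr_ge0 ?exprn_ge0.
    by rewrite -addrA lerDl addr_ge0.
  exact: lerD (mono 4%N) (monoX 3%N).
Qed.

(** The scalars [l2], [l3] take the powers of [B] out of the deviations: they are [1 / B] and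
    [1 / B^2] for MC-blocks and 1 for RQ-blocks. The primed functions are measurable versions on
    [O]. *)
Lemma posterior_estimate : exists G rho : R, [/\ 0 <= G, 0 < rho &
  forall n B N (O : set (Theta S n)) (s h2 h3 h2' h3' : Theta S n -> R)
    (Y : Theta S n -> Omega D n B -> R) (l2 l3 q : R),
  (0 < B)%N -> 0 < l2 -> 0 < l3 -> measurable O -> post S n O = 1%E ->
  (forall theta, O theta -> block_structure (D := D) eta C N theta (s theta) (Y theta)
     (l2 * h2 theta) (l3 * h3 theta)) ->
  (forall theta, O theta -> beta S n * s theta / K%:R <= q) ->
  measurable_fun setT h2' -> {in O, h2 =1 h2'} ->
  measurable_fun setT h3' -> {in O, h3 =1 h3'} ->
  0 <= q <= rho ->
  let mad g := post_mean (fun theta : Theta S n => `|g theta - post_mean g|) in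
  (N%:R * q ^+ 2 <= rho ->
    [/\ proper_weight (weight_u D (n := n) B),
      `|tv (uncorrected D B) (@post_dens R S n) - beta S n ^+ 2 / (4 * K%:R) * l2 * mad h2| <=
        G * (N%:R * q ^+ 3 + (N%:R * q ^+ 2) ^+ 2) &
      `|beta S n ^+ 2 / (4 * K%:R) * l2 * mad h2| <= G * (N%:R * q ^+ 2)]) /\
  (N%:R * q ^+ 3 <= rho ->
    [/\ proper_weight (weight_w D (n := n) B),
      `|tv (corrected D B) (@post_dens R S n) - beta S n ^+ 3 / (6 * K%:R ^+ 2) * l3 * mad h3| <=
        G * (N%:R * q ^+ 4 + (N%:R * q ^+ 3) ^+ 2) &
      `|beta S n ^+ 3 / (6 * K%:R ^+ 2) * l3 * mad h3| <= G * (N%:R * q ^+ 3)])].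
Proof.
have [A [rho0 [A0 rho00 H]]] := pointwise_weight_estimate.
(* The last bound gives [6 A p <= 1], hence [A p + A (e + p^2) <= 3 A p <= 1 / 2], the smallness
   that [reweighting_tv] requires. *)
pose rho := Num.min (Num.min 1 rho0) (6 * A + 1)^-1.
exists (4 * A ^+ 2 + 3 * A + A), rho; split.
- by rewrite !addr_ge0 ?mulr_ge0 ?exprn_ge0.
- by rewrite !lt_min ltr01 rho00 invr_gt0 ltr_wpDl ?mulr_ge0.
move=> n B N O s h2 h3 h2' h3' Y l2 l3 q B0 l20 l30 mO O1 bs sq m2 e2 m3 e3 /andP[q0 qrho] mad.
have /andP[q1 qrho0] : (q <= 1) && (q <= rho0).
  by move: qrho; rewrite /rho !le_min => /andP[].
have b0 := beta_gt0 S n.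
have N0 : 0 <= N%:R :> R by [].
have ge0 i : 0 <= N%:R * q ^+ i by rewrite mulr_ge0// exprn_ge0.
have stepq i : N%:R * q ^+ i.+1 <= N%:R * q ^+ i.
  by rewrite ler_wpM2l// exprS ler_piMl// exprn_ge0.
(* Common to both weights: [p] is the order of the main term, [N q^2] or [N q^3], and [e] the same
   with one more factor [q]. *)
have core (h h' g : Theta S n -> R) (c p e : R) : measurable_fun setT h' ->
    {in O, h =1 h'} -> measurable_fun setT g -> 0 < c -> 0 <= p <= rho ->
    0 <= e <= p ->
    (forall theta, O theta -> `|c * h theta| <= A * p) ->
    (forall theta, O theta -> `|g theta - 1 - c * h theta| <= A * (e + p ^+ 2)) ->
    [/\ proper_weight g,
      `|tv (reweighted g) (@post_dens R S n) - c / 2 * mad h| <= (4 * A ^+ 2 + 3 * A + A) * (e + p ^+ 2) &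
      `|c / 2 * mad h| <= (4 * A ^+ 2 + 3 * A + A) * p].
  move=> mh' hh' mg c0 /andP[p0 prho] /andP[e0 ep] ch gh.
  have p1 : p <= 1 by rewrite (le_trans prho)// /rho !ge_min lexx.
  have pA : p * (6 * A + 1) <= 1.
    rewrite -ler_pdivlMr ?ltr_wpDl ?mulr_ge0// mul1r.
    by rewrite (le_trans prho)// /rho !ge_min lexx !orbT.
  have p2 : p ^+ 2 <= p by rewrite expr2 ler_piMl.
  have p20 : 0 <= p ^+ 2 by exact: sqr_ge0.
  have Ap0 : 0 <= A * p by rewrite mulr_ge0.
  have Ae0 : 0 <= A * (e + p ^+ 2) by rewrite mulr_ge0 ?addr_ge0.
  have half : A * p + A * (e + p ^+ 2) <= 1 / 2.
    have : A * (e + p ^+ 2) <= A * (p + p) by rewrite ler_wpM2l// lerD.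
    by rewrite mulrDr; move: pA; rewrite mulrDr; nra.
  have mch' : measurable_fun setT (fun t => c * h' t) by exact: measurable_funM.
  have chh' : {in O, (fun t => c * h t) =1 (fun t => c * h' t)}.
    by move=> t tO; rewrite /= hh'.
  have [g0 mg0 madA tvb] := @reweighting_tv _ _ _ (postP S n) O g (fun t => c * h t)
    (fun t => c * h' t) (A * p) (A * (e + p ^+ 2)) mO O1 Ap0 Ae0 half mg mch' chh' gh ch.
  have hM t : O t -> `|h t| <= A * p / c.
    by move=> /ch; rewrite normrM gtr0_norm// mulrC ler_pdivlMr.
  have madE := @mean_abs_dev_scale _ _ _ (postP S n) O h h' c _ mO O1 (ltW c0) mh' hh' hM.
  rewrite madE in madA tvb.
  split.
  - by split.
  - rewrite tv_reweighted//.
    have -> : 2^-1 * post_mean (fun t => `|g t / post_mean g - 1|) - c / 2 * mad h =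
        2^-1 * (post_mean (fun t => `|g t / post_mean g - 1|) - c * mad h) by field.
    rewrite normrM ger0_norm//.
    apply: (@le_trans _ _ (2^-1 * (8 * (A * p) ^+ 2 + 6 * (A * (e + p ^+ 2))))).
      by rewrite ler_wpM2l.
    have -> : 2^-1 * (8 * (A * p) ^+ 2 + 6 * (A * (e + p ^+ 2))) =
      4 * A ^+ 2 * p ^+ 2 + 3 * A * (e + p ^+ 2) by field.
    rewrite [leRHS]mulrDl [X in _ <= X + _]mulrDl -addrA lerD//.
      by rewrite ler_wpM2l ?lerDr// mulr_ge0// exprn_ge0.
    by rewrite lerDl.
  - have mad0 : 0 <= mad h by apply: Rintegral_ge0.
    rewrite ger0_norm; last by rewrite mulr_ge0// divr_ge0// ltW.
    apply: (@le_trans _ _ (A * p)).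
      by rewrite mulrAC ler_pdivrMr// [leRHS]mulrC; exact: madA.
    by rewrite ler_wpM2r// lerDr addr_ge0 ?mulr_ge0 ?exprn_ge0.
split=> Nq.
- have c0 : 0 < beta S n ^+ 2 / (2 * K%:R) * l2.
    by rewrite mulr_gt0// divr_gt0 ?exprn_gt0 ?mulr_gt0.
  have h4 : beta S n ^+ 2 / (4 * K%:R) * l2 = beta S n ^+ 2 / (2 * K%:R) * l2 / 2.
    by field; rewrite gt_eqF.
  have Nq1 : N%:R * q ^+ 2 <= 1 by rewrite (le_trans Nq)// /rho !ge_min lexx.
  rewrite h4; apply: (core _ h2' (weight_u D B)) => //.
  + exact: measurable_weight_u.
  + by rewrite ge0.
  + by rewrite ge0 stepq.
  + by move=> t Ot; rewrite -mulrA; have [] := H _ _ _ _ _ _ _ _ q B0 (bs t Ot) (sq t Ot) qrho0.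
  + by move=> t Ot; rewrite -mulrA; have [_ _ + _] := H _ _ _ _ _ _ _ _ q B0 (bs t Ot) (sq t Ot) qrho0; apply.
- have c0 : 0 < beta S n ^+ 3 / (3 * K%:R ^+ 2) * l3.
    by rewrite mulr_gt0// divr_gt0 ?exprn_gt0 ?mulr_gt0 ?exprn_gt0.
  have h6 : beta S n ^+ 3 / (6 * K%:R ^+ 2) * l3 = beta S n ^+ 3 / (3 * K%:R ^+ 2) * l3 / 2.
    by field; rewrite gt_eqF.
  have Nq1 : N%:R * q ^+ 3 <= 1 by rewrite (le_trans Nq)// /rho !ge_min lexx.
  rewrite h6; apply: (core _ h3' (weight_w D B)) => //.
  + exact: measurable_weight_w.
  + by rewrite ge0.
  + by rewrite ge0 stepq.
  + by move=> t Ot; rewrite -mulrA; have [] := H _ _ _ _ _ _ _ _ q B0 (bs t Ot) (sq t Ot) qrho0.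
  + by move=> t Ot; rewrite -mulrA; have [_ _ _] := H _ _ _ _ _ _ _ _ q B0 (bs t Ot) (sq t Ot) qrho0; apply.
Qed.

End posterior_estimates.

(** * The two block rules as instances of the common scheme *)

Section block_structures.
Context (R : realType) (S : model R) (K : nat) (D : block_rule S K) (n B : nat)
  (theta : Theta S n) (eta C : R).
Hypotheses (K2 : (2 <= K)%N) (B0 : (0 < B)%N) (eta0 : 0 < eta).

Let P : probability (Omega D n B) R := Pr D B theta.
Let K0 : (0 < K)%N. Proof. exact: ltnW. Qed.

Lemma block_structure_RQ :
  let X0 := @block_err R S K D n B 0 theta in
  let Y w := X0 w / Num.sqrt (fine ('V_P[X0])%E) in
  ('V_P[X0] < +oo)%E ->
  (block_var D B theta != 0 -> cgf_extends_bounded P Y eta C) ->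
  block_structure (D := D) eta (2 * expR `|C|) 1 theta (Num.sqrt (block_var D B theta)) Y
    (block_var D B theta) (chi D B 3 theta) /\
  chi D B 3 theta = \int[P]_w (block_err 0 theta w ^+ 3).
Proof.
move=> X0 Y finV hcgf.
have mX0 : measurable_fun setT X0 by exact: measurable_block_err.
have iX0 := integrable_block_err D theta B0 K0; have EX0 := mean_block_err D theta B0 K0.
have hY : exp_moment_bound P eta (2 * expR `|C|) Y by exact: standardized_exp_moment.
have [c1 c2] := cumulant3_scale eta0 (sqrtr_ge0 _) mX0 hY (standardizedK mX0 EX0 finV).
split; last by [].
split => //.
- exact: (block_factorization_RQ K2 B0 finV hY).
- rewrite mul1r sqr_sqrtr; last exact: centered_variance_ge0 EX0.
  by rewrite (standardized_moment2 mX0 EX0 finV).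
- by rewrite mul1r -c2.
Qed.

Lemma block_structure_MC :
  (forall k, (k < K)%N ->
    mutually_independent P B (fun b => @xi R S K D n B k b) /\
    forall (b : nat) (A : set (Input S n)), (b < B)%N -> measurable A ->
      P (@xi R S K D n B k b @^-1` A) = inputP S n A) ->
  let V0 := @point_err R S K D n B 0 0 theta in
  let Y w := V0 w / Num.sqrt (fine ('V_P[V0])%E) in
  ('V_P[V0] < +oo)%E ->
  (block_var D B theta != 0 -> cgf_extends_bounded P Y eta C) ->
  [/\ block_structure (D := D) eta (2 * expR `|C|) B theta
        (Num.sqrt (sigma2 D B theta) / B%:R) Y
        (sigma2 D B theta / B%:R) (kappa D B 3 theta / B%:R ^+ 2),
    sigma2 D B theta = \int[P]_w (point_err 0 0 theta w ^+ 2) &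
    kappa D B 3 theta = \int[P]_w (point_err 0 0 theta w ^+ 3)].
Proof.
move=> mc V0 Y finV hcgf.
have Bneq0 : B%:R != 0 :> R by rewrite pnatr_eq0 -lt0n.
have mV0 : measurable_fun setT V0.
  apply: measurable_funB => //.
  exact: (measurableT_comp (@measurable_input_loss R S n theta) (@xi_measurable R S K D n B 0 0)).
have iV0 := integrable_point_err mc K0 B0; have EV0 := mean_point_err mc K0 B0.
have hY : exp_moment_bound P eta (2 * expR `|C|) Y.
  apply: standardized_exp_moment => // v0; apply: hcgf.
  by rewrite (block_var_MC K2 B0 mc finV) mulf_neq0 ?invr_eq0.
have [c1 c2] := cumulant3_scale eta0 (sqrtr_ge0 _) mV0 hY (standardizedK mV0 EV0 finV).
have s0 := centered_variance_ge0 EV0.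
split; last by [].
- split => //.
  + exact: (block_factorization_MC K2 B0 mc finV hY).
  + rewrite expr_div_n sqr_sqrtr//.
    have E : sigma2 D B theta * \int[P]_w (Y w ^+ 2) = sigma2 D B theta.
      exact: standardized_moment2 mV0 EV0 finV.
    by rewrite -[in LHS]E; field.
  + by rewrite /kappa c1 c2 expr_div_n; field.
- exact: centered_variance_Rintegral EV0.
Qed.

End block_structures.

Lemma probability_setI_ae d (T : measurableType d) (R : realType) (Q : probability T R)
    (A E : set T) : measurable A -> measurable E -> Q A = 1%E ->
  {ae Q, forall t, E t} -> Q (A `&` E) = 1%E.
Proof.
move=> mA mE A1 [N [mN N0 EN]].
have mAE : measurable (A `&` E) by exact: measurableI.
have EP : (Q (~` (A `&` E)) = 0)%E.
  apply/eqP; rewrite eq_le measure_ge0 andbT setCI.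
  apply: (@le_trans _ _ (Q (~` A) + Q (~` E))%E).
    by apply: measureU2; exact: measurableC.
  rewrite probability_setC// A1 subee// add0e -[leRHS]N0.
  by apply: le_measure; rewrite ?inE//; exact: measurableC.
have := probability_setC Q mAE; rewrite EP => h.
have : (Q (A `&` E) \is a fin_num)%E by exact: fin_num_measure.
case: (Q (A `&` E)) h => // r.
by rewrite -EFinB => -[] /esym/eqP; rewrite subr_eq0 => /eqP <-.
Qed.

Section uniform_bounds.
Context (R : realType) (S : model R) (K : nat) (D : block_rule S K).
Hypothesis K2 : (2 <= K)%N.
Let K0 : 0 < K%:R :> R. Proof. by rewrite ltr0n ltnW. Qed.
Let mad n (g : Theta S n -> R) := post_mean (fun theta : Theta S n => `|g theta - post_mean g|).

(** Here [c] bounds [sigma] uniformly, so [q] no longer depends on the state. The second and third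
    moments supply the measurable versions of [sigma2] and [kappa]. *)
Lemma MC_bounds : MC_blocks D -> MC_cgf_assumption D ->
  exists G rho c : R, [/\ 0 <= G, 0 < rho, 0 <= c & forall n B, (0 < B)%N ->
    let M : R := (K * B)%:R in let q := beta S n * c / M in q <= rho ->
    (B%:R * q ^+ 2 <= rho ->
      [/\ proper_weight (weight_u D (n := n) B),
        `|tv (uncorrected D B) (@post_dens R S n)
          - beta S n ^+ 2 / (4 * M) * @mad n (sigma2 D B)| <=
            G * (B%:R * q ^+ 3 + (B%:R * q ^+ 2) ^+ 2) &
        `|beta S n ^+ 2 / (4 * M) * @mad n (sigma2 D B)| <= G * (B%:R * q ^+ 2)]) /\
    (B%:R * q ^+ 3 <= rho ->
      [/\ proper_weight (weight_w D (n := n) B),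
        `|tv (corrected D B) (@post_dens R S n)
          - beta S n ^+ 3 / (6 * M ^+ 2) * @mad n (kappa D B 3)| <=
            G * (B%:R * q ^+ 4 + (B%:R * q ^+ 3) ^+ 2) &
        `|beta S n ^+ 3 / (6 * M ^+ 2) * @mad n (kappa D B 3)| <= G * (B%:R * q ^+ 3)])].
Proof.
move=> mc [Th [[hO [eta [C [eta0 hcgf]]]] [Cs hs]]].
have [G [rho [G0 rho0 H]]] := @posterior_estimate R S K D eta (2 * expR `|C|) K2 eta0.
exists G, rho, `|Cs|; split => // n B B0 M q qrho.
have B0' : 0 < B%:R :> R by rewrite ltr0n.
have [mO O1] := hO n.
pose Y (theta : Theta S n) (w : Omega D n B) := point_err 0 0 theta w /
  Num.sqrt (fine ('V_(Pr D B theta)[(@point_err R S K D n B 0 0 theta)])%E).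
have st theta (Ot : Th n theta) := block_structure_MC K2 B0 eta0
  (fun k kK => mc n B theta k B0 kK) (hcgf n B theta B0 Ot).1 (hcgf n B theta B0 Ot).2.
have q0 : 0 <= q by rewrite /q divr_ge0// mulr_ge0// ltW// beta_gt0.
have ME : M = K%:R * B%:R by rewrite /M natrM.
have qB theta : Th n theta -> beta S n * (Num.sqrt (sigma2 D B theta) / B%:R) / K%:R <= q.
  move=> Ot; have -> : q = beta S n * (`|Cs| / B%:R) / K%:R.
    by rewrite /q ME; field; rewrite !gt_eqF.
  rewrite ler_wpM2r ?invr_ge0 ?(ltW K0)// ler_wpM2l ?(ltW (beta_gt0 _ _))//.
  rewrite ler_wpM2r ?invr_ge0 ?(ltW B0')//.
  exact: le_trans (hs _ _ _ B0 Ot) (ler_norm _).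
have mom j : measurable_fun setT (fun theta =>
    \int[Pr D B theta]_w (@point_err R S K D n B 0 0 theta w ^+ j)).
  apply: (@measurable_Pr_Rintegral R S K D n B (fun p => point_err 0 0 p.1 p.2 ^+ j)).
  by apply: measurable_funX; exact: measurable_joint_point_err.
have l20 : 0 < B%:R^-1 :> R by rewrite invr_gt0.
have l30 : 0 < B%:R ^- 2 :> R by rewrite invr_gt0 exprn_gt0.
have := H n B B (Th n) (fun theta => Num.sqrt (sigma2 D B theta) / B%:R)
  (sigma2 D B) (kappa D B 3) _ _ Y _ _ q B0 l20 l30 mO O1 _ qB (mom 2%N) _ (mom 3%N) _ _.
have c2 : beta S n ^+ 2 / (4 * K%:R) / B%:R = beta S n ^+ 2 / (4 * M).
  by rewrite ME; field; rewrite !gt_eqF.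
have c3 : beta S n ^+ 3 / (6 * K%:R ^+ 2) / B%:R ^+ 2 = beta S n ^+ 3 / (6 * M ^+ 2).
  by rewrite ME; field; rewrite !gt_eqF.
rewrite c2 c3; apply.
- by move=> theta Ot; have [h _ _] := st theta Ot; rewrite ![_^-1 * _]mulrC.
- by move=> theta /set_mem Ot; have [_ h _] := st theta Ot.
- by move=> theta /set_mem Ot; have [_ _ h] := st theta Ot.
- by rewrite q0.
Qed.

Lemma RQ_bounds : RQ_cgf_assumption D ->
  exists G rho : R, [/\ 0 <= G, 0 < rho & forall n B c, (0 < B)%N ->
    (post_norm (block_var D (n := n) B) <= c%:E)%E ->
    let q := beta S n * Num.sqrt c / K%:R in q <= rho ->
    (q ^+ 2 <= rho ->
      [/\ proper_weight (weight_u D (n := n) B),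
        `|tv (uncorrected D B) (@post_dens R S n)
          - beta S n ^+ 2 / (4 * K%:R) * @mad n (block_var D B)| <= G * (q ^+ 3 + (q ^+ 2) ^+ 2) &
        `|beta S n ^+ 2 / (4 * K%:R) * @mad n (block_var D B)| <= G * q ^+ 2]) /\
    (q ^+ 3 <= rho ->
      [/\ proper_weight (weight_w D (n := n) B),
        `|tv (corrected D B) (@post_dens R S n)
          - beta S n ^+ 3 / (6 * K%:R ^+ 2) * @mad n (chi D B 3)| <= G * (q ^+ 4 + (q ^+ 3) ^+ 2) &
        `|beta S n ^+ 3 / (6 * K%:R ^+ 2) * @mad n (chi D B 3)| <= G * q ^+ 3])].
Proof.
move=> [Th [hO [eta [C [eta0 hcgf]]]]].
have [G [rho [G0 rho0 H]]] := @posterior_estimate R S K D eta (2 * expR `|C|) K2 eta0.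
exists G, rho; split => // n B c B0 hc q qrho.
have [mO O1] := hO n.
have mom j : measurable_fun setT (fun theta =>
    \int[Pr D B theta]_w (@block_err R S K D n B 0 theta w ^+ j)).
  apply: (@measurable_Pr_Rintegral R S K D n B (fun p => block_err 0 p.1 p.2 ^+ j)).
  by apply: measurable_funX; exact: measurable_joint_block_err.
have vE theta : block_var D B theta = \int[Pr D B theta]_w (@block_err R S K D n B 0 theta w ^+ 2).
  exact: centered_variance_Rintegral (mean_block_err D theta B0 (ltnW K2)).
(* The essential bound on [v_B] becomes a pointwise one on this set of full mass; it is measurable
   because [v_B] equals a second moment at every state. *)
pose E := [set theta : Theta S n | block_var D B theta <= c].
have mE : measurable E.
  have -> : E = (fun theta => \int[Pr D B theta]_w (@block_err R S K D n B 0 theta w ^+ 2)) @^-1` `]-oo, c].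
    by apply/seteqP; split => theta; rewrite /E/= in_itv/= -vE.
  by rewrite -[X in measurable X]setTI; exact: mom.
have mOE : measurable (Th n `&` E) by exact: measurableI.
have OE1 : post S n (Th n `&` E) = 1%E.
  apply: (@probability_setI_ae _ _ _ (postP S n)) => //.
  have /ess_supP := hc; apply: filterS => theta; rewrite lee_fin /E/=.
  exact: le_trans (ler_norm _).
pose Y (theta : Theta S n) (w : Omega D n B) := block_err 0 theta w /
  Num.sqrt (fine ('V_(Pr D B theta)[(@block_err R S K D n B 0 theta)])%E).
have st theta (Ot : Th n theta) := block_structure_RQ K2 B0 eta0
  (hcgf n B theta B0 Ot).1 (hcgf n B theta B0 Ot).2.
have q0 : 0 <= q.
  by rewrite /q divr_ge0 ?(ltW K0)// mulr_ge0 ?sqrtr_ge0 ?(ltW (beta_gt0 _ _)).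
have qB theta : (Th n `&` E) theta -> beta S n * Num.sqrt (block_var D B theta) / K%:R <= q.
  move=> [_ Et]; rewrite ler_wpM2r ?invr_ge0 ?(ltW K0)// ler_wpM2l ?(ltW (beta_gt0 _ _))//.
  exact: ler_wsqrtr.
have := H n B 1%N (Th n `&` E) (fun theta => Num.sqrt (block_var D B theta))
  (block_var D B) (chi D B 3) _ _ Y _ _ q B0 ltr01 ltr01 mOE OE1 _ qB (mom 2%N) _ (mom 3%N) _ _.
rewrite !mulr1 !mul1r; apply.
- by move=> theta [Ot _]; have [h _] := st theta Ot; rewrite !mul1r.
- by move=> theta _; exact: vE.
- by move=> theta /set_mem[Ot _]; have [_ h] := st theta Ot.
- by rewrite q0.
Qed.

End uniform_bounds.

(** * Asymptotic regimes *)

Section sequences_asymptotics.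
Context {R : realType}.
Implicit Types (f g x e : nat -> R).

Lemma cvg0_near_le f g (c : R) : (\forall n \near \oo, `|f n| <= c * g n) ->
  g @ \oo --> (0 : R) -> f @ \oo --> (0 : R).
Proof.
move=> fg g0; apply/norm_cvg0P.
apply: (@squeeze_cvgr _ _ _ _ (fun=> 0) (fun n => c * g n)).
- by apply: filterS fg => n ->; rewrite normr_ge0.
- exact: cvg_cst.
- by rewrite -[X in _ --> X](mulr0 c); apply: cvgMr.
Qed.

Lemma cvg0_exprn_le f x k : (forall n, 0 <= f n) -> (forall n, f n ^+ k.+1 <= x n) ->
  x @ \oo --> (0 : R) -> f @ \oo --> (0 : R).
Proof.
move=> f0 fx x0; apply/cvgr0Pnorm_lt => e e0.
have ek : 0 < e ^+ k.+1 by rewrite exprn_gt0.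
apply: filterS (cvgr_lt _ x0 _ ek) => n xn; rewrite ger0_norm//.
by rewrite -(@ltr_pXn2r _ k.+1)// ?nnegrE ?(ltW e0)// (le_lt_trans (fx n)).
Qed.

Lemma cvg0_powR f (a : R) : 0 < a -> (forall n, 0 <= f n) ->
  f @ \oo --> (0 : R) -> (fun n => f n `^ a) @ \oo --> (0 : R).
Proof.
move=> a0 f0 fc; apply/cvgr0Pnorm_lt => e e0.
have ea : 0 < e `^ a^-1 by rewrite powR_gt0.
apply: filterS (cvgr_lt _ fc _ ea) => n fn; rewrite ger0_norm ?powR_ge0//.
have -> : e = (e `^ a^-1) `^ a by rewrite -powRrM mulVf ?gt_eqF// powRr1// ltW.
by rewrite gt0_ltr_powR// ?nnegrE// powR_ge0.
Qed.

Lemma littleo_from_bound f g x e : (forall n, 0 <= x n) ->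
  (\forall n \near \oo, `|f n - g n| <= e n * x n) -> e @ \oo --> (0 : R) ->
  f = g +o_\oo x.
Proof.
move=> x0 fg e0; apply/eqaddoP => eps eps0.
apply: filterS2 fg (cvgr_lt _ e0 _ eps0) => n h en.
rewrite (ger0_norm (x0 n)); apply: (le_trans h).
by rewrite ler_wpM2r// ltW.
Qed.

Lemma bigO_from_bound f g x (c : R) : (forall n, 0 <= x n) ->
  (\forall n \near \oo, `|f n - g n| <= c * x n) -> f = g +O_\oo x.
Proof.
move=> x0 fg; apply/eqaddOP; near=> k; apply: filterS fg => n h.
rewrite (ger0_norm (x0 n)); apply: (le_trans h).
by rewrite ler_wpM2r//; near: k; exact: nbhs_pinfty_ge.
Unshelve. all: by end_near. Qed.

Lemma bigO0_from_bound f x (c : R) : (forall n, 0 <= x n) ->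
  (\forall n \near \oo, `|f n| <= c * x n) -> f =O_\oo x.
Proof.
move=> x0 fg; apply/eqOP; near=> k; apply: filterS fg => n h.
rewrite (ger0_norm (x0 n)); apply: (le_trans h).
by rewrite ler_wpM2r//; near: k; exact: nbhs_pinfty_ge.
Unshelve. all: by end_near. Qed.

Lemma norm_le_two_bounds (a b u v : R) : `|a - b| <= u -> `|b| <= v -> `|a| <= u + v.
Proof.
by move=> h1 h2; rewrite -[a](subrK b) (le_trans (ler_normD _ _))// lerD.
Qed.

Lemma cube_le_powR (q x : R) : 0 <= q -> q ^+ 2 <= x -> q ^+ 3 <= x `^ (3 / 2).
Proof.
move=> q0 qx; have -> : q ^+ 3 = (q ^+ 2) `^ (3 / 2).
  rewrite -[in RHS]powR_mulrn// -powRrM (_ : 2%:R * (3 / 2) = 3%:R); last by field.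
  by rewrite powR_mulrn.
by rewrite ge0_ler_powR ?nnegrE ?exprn_ge0// (le_trans _ qx)// exprn_ge0.
Qed.

Lemma sqr_le_powR32 (x : R) : 0 <= x <= 1 -> x ^+ 2 <= x `^ (3 / 2) <= x.
Proof.
move=> /andP[]; rewrite le_eqVlt => /predU1P[<- _|x0 x1].
  by rewrite expr0n/= powR0 ?lexx// mulf_neq0.
rewrite -powR_mulrn ?(ltW x0)// -{4}[x]powRr1 ?(ltW x0)//.
by apply/andP; split; apply: ger_powR; rewrite ?x0//; lra.
Qed.

End sequences_asymptotics.

Section asymptotic_regimes.
Context (R : realType) (S : model R) (K : nat) (D : block_rule S K) (B : nat -> nat).
Hypotheses (K2 : (2 <= K)%N) (B0 : forall n, (0 < B n)%N).

Let M n : R := (K * B n)%:R.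
Let b := beta S.
Let tv0 n := tv (uncorrected D (B n)) (@post_dens R S n).
Let tv1 n := tv (corrected D (B n)) (@post_dens R S n).
Let mad n (g : Theta S n -> R) := post_mean (fun theta => `|g theta - post_mean g|).

Let K0 : 0 < K%:R :> R. Proof. by rewrite ltr0n ltnW. Qed.
Let K1 : 1 <= K%:R :> R. Proof. by rewrite ler1n ltnW. Qed.
Let ME n : M n = K%:R * (B n)%:R. Proof. by rewrite /M natrM. Qed.
Let M1 n : 1 <= M n.
Proof. by rewrite /M ler1n muln_gt0 B0 andbT ltnW. Qed.
Let M0 n : 0 < M n. Proof. exact: lt_le_trans (M1 n). Qed.
Let b0 n : 0 < b n. Proof. exact: beta_gt0. Qed.

Section monte_carlo.
Hypotheses (mc : MC_blocks D) (cgf : MC_cgf_assumption D).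

Let y n := b n / M n.
Let y0 n : 0 <= y n. Proof. by rewrite divr_ge0 ?ltW. Qed.

Let BMK n : (B n)%:R = M n / K%:R.
Proof. by rewrite ME mulrC mulKf// gt_eqF. Qed.

(** One power of [M] cancels against [B = M / K], and [1 / K <= 1] is dropped. *)
Let Bq_le (c : R) n j : 0 <= c ->
  (B n)%:R * (b n * c / M n) ^+ j.+1 <= c ^+ j.+1 * (b n ^+ j.+1 / M n ^+ j).
Proof.
move=> c0.
have -> : (B n)%:R * (b n * c / M n) ^+ j.+1 = K%:R^-1 * (c ^+ j.+1 * (b n ^+ j.+1 / M n ^+ j)).
  rewrite BMK !expr_div_n exprMn [M n ^+ j.+1]exprS; field.
  apply/and3P; split; [by rewrite expf_neq0// gt_eqF|by rewrite gt_eqF|].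
  by rewrite pnatr_eq0 -lt0n.
rewrite ler_piMl ?invf_le1// mulr_ge0 ?exprn_ge0// divr_ge0// exprn_ge0// ltW//.
Qed.

(** As [M >= 1], the square of [y = b / M] is at most [x = b^2 / M], so [y] tends to 0. The errors
    [B q^3] and [(B q^2)^2] have orders [x y] and [x^2], both [o(x)]. *)
Lemma MC_uncorrected : (fun n => b n ^+ 2 / M n) @ \oo --> (0 : R) ->
  (\forall n \near \oo, proper_weight (weight_u D (n := n) (B n))) /\
  exists (e : nat -> R) (c : R), [/\ e @ \oo --> (0 : R),
    \forall n \near \oo, `|tv0 n - b n ^+ 2 / (4 * M n) * @mad n (sigma2 D (B n))|
      <= e n * (b n ^+ 2 / M n) &
    \forall n \near \oo, `|b n ^+ 2 / (4 * M n) * @mad n (sigma2 D (B n))|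
      <= c * (b n ^+ 2 / M n)].
Proof.
move=> x0; have [G [rho [c [G0 rho0 c0 H]]]] := MC_bounds K2 mc cgf.
pose x n := b n ^+ 2 / M n.
have xp n : 0 <= x n by rewrite divr_ge0 ?exprn_ge0 ?ltW.
have y_cvg : y @ \oo --> (0 : R).
  apply: (@cvg0_exprn_le _ y x 1) => // n; rewrite /y /x expr_div_n ler_wpM2l ?exprn_ge0 ?(ltW (b0 n))//.
  by rewrite lef_pV2 ?posrE ?exprn_gt0// expr2 ler_peMl// ltW.
pose e n := G * (c ^+ 3 * y n + c ^+ 4 * x n).
have e_cvg : e @ \oo --> (0 : R).
  rewrite -[X in _ --> X](mulr0 G) -[X in G * X](addr0 0).
  rewrite -{1}[X in X + _](mulr0 (c ^+ 3)) -[X in _ + X](mulr0 (c ^+ 4)).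
  by apply: cvgMr; apply: cvgD; apply: cvgMr.
have small : \forall n \near \oo, b n * c / M n <= rho /\ (B n)%:R * (b n * c / M n) ^+ 2 <= rho.
  have r1 : 0 < rho / (c + 1) by rewrite divr_gt0// ltr_wpDl.
  have r2 : 0 < rho / (c ^+ 2 + 1) by rewrite divr_gt0// ltr_wpDl// exprn_ge0.
  apply: filterS2 (cvgr_lt _ y_cvg _ r1) (cvgr_lt _ x0 _ r2) => n.
  rewrite !ltr_pdivlMr ?ltr_wpDl ?exprn_ge0// => h1 h2; split.
    rewrite mulrAC (le_trans _ (ltW h1))// ler_wpM2l// ?lerDl//; exact: y0.
  rewrite (le_trans (Bq_le n 1 c0))// expr1 (le_trans _ (ltW h2))// mulrC.
  by rewrite ler_wpM2l ?lerDl//; exact: xp.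
have main : \forall n \near \oo, [/\ proper_weight (weight_u D (n := n) (B n)),
    `|tv0 n - b n ^+ 2 / (4 * M n) * @mad n (sigma2 D (B n))| <= e n * x n &
    `|b n ^+ 2 / (4 * M n) * @mad n (sigma2 D (B n))| <= G * c ^+ 2 * x n].
  apply: filterS small => n [h1 h2]; have [/(_ h2)[p1 p2 p3] _] := H n (B n) (B0 n) h1.
  split => //.
    apply: (le_trans p2); rewrite /e -[leRHS]mulrA ler_wpM2l// mulrDl lerD//.
      apply: (le_trans (Bq_le n 2 c0)).
      rewrite /y /x le_eqVlt; apply/orP; left; move: (M n) (M0 n) => m m0.
      by apply/eqP; field; rewrite gt_eqF.
    have -> : c ^+ 4 * x n * x n = (c ^+ 2 * x n) ^+ 2 by ring.
    have := Bq_le n 1 c0; rewrite expr1 => h; rewrite lerXn2r ?nnegrE//.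
      by rewrite mulr_ge0// exprn_ge0// divr_ge0 ?mulr_ge0// ltW.
    by rewrite mulr_ge0 ?exprn_ge0.
  apply: (le_trans p3); rewrite -[leRHS]mulrA ler_wpM2l//.
  by have := Bq_le n 1 c0; rewrite expr1.
split; first by apply: filterS main => n [].
by exists e, (G * c ^+ 2); split => //; apply: filterS main => n [].
Qed.

(** Now [y^3 <= x = b^3 / M^2], and the errors [B q^4] and [(B q^3)^2] have orders [x y] and [x^2];
    nothing is asked of [b^2 / M]. *)
Lemma MC_corrected : (fun n => b n ^+ 3 / M n ^+ 2) @ \oo --> (0 : R) ->
  (\forall n \near \oo, proper_weight (weight_w D (n := n) (B n))) /\
  exists (e : nat -> R) (c : R), [/\ e @ \oo --> (0 : R),
    \forall n \near \oo, `|tv1 n - b n ^+ 3 / (6 * M n ^+ 2) * @mad n (kappa D (B n) 3)|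
      <= e n * (b n ^+ 3 / M n ^+ 2) &
    \forall n \near \oo, `|b n ^+ 3 / (6 * M n ^+ 2) * @mad n (kappa D (B n) 3)|
      <= c * (b n ^+ 3 / M n ^+ 2)].
Proof.
move=> x0; have [G [rho [c [G0 rho0 c0 H]]]] := MC_bounds K2 mc cgf.
pose x n := b n ^+ 3 / M n ^+ 2.
have xp n : 0 <= x n by rewrite divr_ge0 ?exprn_ge0 ?ltW.
have y_cvg : y @ \oo --> (0 : R).
  apply: (@cvg0_exprn_le _ y x 2) => // n; rewrite /y /x expr_div_n ler_wpM2l ?exprn_ge0 ?(ltW (b0 n))//.
  by rewrite lef_pV2 ?posrE ?exprn_gt0// [leRHS]exprS ler_peMl// exprn_ge0// ltW.
pose e n := G * (c ^+ 4 * y n + c ^+ 6 * x n).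
have e_cvg : e @ \oo --> (0 : R).
  rewrite -[X in _ --> X](mulr0 G) -[X in G * X](addr0 0).
  rewrite -{1}[X in X + _](mulr0 (c ^+ 4)) -[X in _ + X](mulr0 (c ^+ 6)).
  by apply: cvgMr; apply: cvgD; apply: cvgMr.
have small : \forall n \near \oo, b n * c / M n <= rho /\ (B n)%:R * (b n * c / M n) ^+ 3 <= rho.
  have r1 : 0 < rho / (c + 1) by rewrite divr_gt0// ltr_wpDl.
  have r2 : 0 < rho / (c ^+ 3 + 1) by rewrite divr_gt0// ltr_wpDl// exprn_ge0.
  apply: filterS2 (cvgr_lt _ y_cvg _ r1) (cvgr_lt _ x0 _ r2) => n.
  rewrite !ltr_pdivlMr ?ltr_wpDl ?exprn_ge0// => h1 h2; split.
    rewrite mulrAC (le_trans _ (ltW h1))// ler_wpM2l// ?lerDl//; exact: y0.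
  rewrite (le_trans (Bq_le n 2 c0))// (le_trans _ (ltW h2))// mulrC.
  by rewrite ler_wpM2l ?lerDl//; exact: xp.
have main : \forall n \near \oo, [/\ proper_weight (weight_w D (n := n) (B n)),
    `|tv1 n - b n ^+ 3 / (6 * M n ^+ 2) * @mad n (kappa D (B n) 3)| <= e n * x n &
    `|b n ^+ 3 / (6 * M n ^+ 2) * @mad n (kappa D (B n) 3)| <= G * c ^+ 3 * x n].
  apply: filterS small => n [h1 h2]; have [_ /(_ h2)[p1 p2 p3]] := H n (B n) (B0 n) h1.
  split => //.
    apply: (le_trans p2); rewrite /e -[leRHS]mulrA ler_wpM2l// mulrDl lerD//.
      apply: (le_trans (Bq_le n 3 c0)).
      rewrite /y /x le_eqVlt; apply/orP; left; move: (M n) (M0 n) => m m0.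
      by apply/eqP; field; rewrite gt_eqF.
    have -> : c ^+ 6 * x n * x n = (c ^+ 3 * x n) ^+ 2 by ring.
    rewrite lerXn2r ?nnegrE ?(Bq_le n 2 c0)//.
      by rewrite mulr_ge0// exprn_ge0// divr_ge0 ?mulr_ge0// ltW.
    by rewrite mulr_ge0 ?exprn_ge0.
  apply: (le_trans p3); rewrite -[leRHS]mulrA ler_wpM2l//.
  exact: Bq_le n 2 c0.
split; first by apply: filterS main => n [].
by exists e, (G * c ^+ 3); split => //; apply: filterS main => n [].
Qed.

End monte_carlo.

Lemma cvg0_from_bounds (f g x e : nat -> R) (c : R) :
  e @ \oo --> (0 : R) -> x @ \oo --> (0 : R) ->
  (\forall n \near \oo, `|f n - g n| <= e n * x n) ->
  (\forall n \near \oo, `|g n| <= c * x n) -> f @ \oo --> (0 : R).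
Proof.
move=> e0 x0 fg gx; apply: (@cvg0_near_le _ f (fun n => e n * x n + c * x n) 1).
  by apply: filterS2 fg gx => n h1 h2; rewrite mul1r; exact: norm_le_two_bounds h1 h2.
rewrite -[X in _ --> X](addr0 0) -{1}[X in X + _](mulr0 0) -[X in _ + X](mulr0 c).
by apply: cvgD; [exact: cvgM|exact: cvgMr].
Qed.

Lemma order_n_sqr_cvg0 : order_n b -> (fun n => M n / n%:R ^+ 2) @ \oo --> +oo ->
  (fun n => b n ^+ 2 / M n) @ \oo --> (0 : R).
Proof.
move=> [c [C [/andP[c0 cC] bn]]] Moo.
apply: (@cvg0_near_le _ _ (fun n => (M n / n%:R ^+ 2)^-1) (C ^+ 2)).
  near=> n; have n0 : (0 < n)%N by near: n; exact: nbhs_infty_gt.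
  have nR : 0 < n%:R :> R by rewrite ltr0n.
  have /andP[_ h] := bn n n0.
  rewrite ger0_norm ?divr_ge0 ?exprn_ge0 ?(ltW (M0 _)) ?(ltW (b0 _))//.
  rewrite invf_div mulrA ler_wpM2r ?invr_ge0 ?(ltW (M0 _))// -exprMn.
  by rewrite lerXn2r ?nnegrE ?(ltW (b0 _))// (le_trans (ltW (b0 n))).
apply/gtr0_cvgV0 => //; near=> n.
have n0 : (0 < n)%N by near: n; exact: nbhs_infty_gt.
by rewrite divr_gt0// exprn_gt0// ltr0n.
Unshelve. all: by end_near. Qed.

Lemma order_n_cube_cvg0 : order_n b -> (fun n => M n / n%:R `^ (3 / 2)) @ \oo --> +oo ->
  (fun n => b n ^+ 3 / M n ^+ 2) @ \oo --> (0 : R).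
Proof.
move=> [c [C [/andP[c0 cC] bn]]] Moo.
have C0 : 0 <= C by rewrite (le_trans _ cC)// ltW.
apply: (@cvg0_near_le _ _ (fun n => ((M n / n%:R `^ (3 / 2))^-1) ^+ 2) (C ^+ 3)).
  near=> n; have n0 : (0 < n)%N by near: n; exact: nbhs_infty_gt.
  have nR : 0 < n%:R :> R by rewrite ltr0n.
  have /andP[_ h] := bn n n0.
  rewrite ger0_norm ?divr_ge0 ?exprn_ge0 ?(ltW (M0 _)) ?(ltW (b0 _))//.
  have n3 : (n%:R `^ (3 / 2)) ^+ 2 = n%:R ^+ 3 :> R.
    rewrite -powR_mulrn ?powR_ge0// -powRrM (_ : 3 / 2 * 2%:R = 3%:R); last by field.
    by rewrite powR_mulrn.
  rewrite invf_div expr_div_n n3 mulrA ler_wpM2r ?invr_ge0 ?exprn_ge0 ?(ltW (M0 _))//.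
  rewrite -exprMn lerXn2r ?nnegrE ?(ltW (b0 _))//.
  by rewrite mulr_ge0.
rewrite -[X in _ --> X](mulr0 0).
have inv0 : (fun n => (M n / n%:R `^ (3 / 2))^-1) @ \oo --> (0 : R).
  apply/gtr0_cvgV0 => //; near=> n.
  have n0 : (0 < n)%N by near: n; exact: nbhs_infty_gt.
  by rewrite divr_gt0// powR_gt0// ltr0n.
exact: cvgM.
Unshelve. all: by end_near. Qed.

Section randomized_quadrature.
Variables (C alpha : R) (d : nat).
Hypothesis cgf : RQ_cgf_assumption D.
Hypothesis hv : forall n, (post_norm (block_var D (n := n) (B n)) <=
  (C * (B n)%:R `^ (- alpha) * ln (2 + (B n)%:R) ^+ d.-1)%:E)%E.

Let delta n := delta_RQ alpha d (b n) (K * B n).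

Let ln2_ge0 (x : R) : 0 <= x -> 0 <= ln (2 + x).
Proof. by move=> x0; rewrite ln_ge0// (le_trans _ (lerD (lexx 2) x0))// addr0 ler1n. Qed.

Lemma delta_RQ_ge0 n : 0 <= delta n.
Proof.
by rewrite /delta /delta_RQ mulr_ge0 ?exprn_ge0 ?ln2_ge0// mulr_ge0 ?powR_ge0 ?sqr_ge0.
Qed.

Let c n := `|C| * (B n)%:R `^ (- alpha) * ln (2 + (B n)%:R) ^+ d.-1.
Let q n := b n * Num.sqrt (c n) / K%:R.
Let c0 := `|C| * K%:R `^ alpha.

Let c00 : 0 <= c0. Proof. by rewrite mulr_ge0 ?powR_ge0. Qed.
Let cn0 n : 0 <= c n.
Proof. by rewrite /c mulr_ge0 ?exprn_ge0 ?ln2_ge0// mulr_ge0 ?powR_ge0. Qed.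
Let q0 n : 0 <= q n.
Proof. by rewrite divr_ge0 ?(ltW K0)// mulr_ge0 ?sqrtr_ge0 ?(ltW (b0 n)). Qed.

(** Passes from the rate in [B] to the rate in [M = K B]: the power produces the constant [K^alpha],
    and the logarithm only grows. *)
Let q2_le n : q n ^+ 2 <= c0 * delta n.
Proof.
have -> : q n ^+ 2 = K%:R ^- 2 * (b n ^+ 2 * c n).
  by rewrite /q expr_div_n exprMn sqr_sqrtr// mulrC.
have MB : (B n)%:R `^ (- alpha) = K%:R `^ alpha * M n `^ (- alpha).
  rewrite ME powRM ?(ltW K0)// mulrA -powRD; last by rewrite (gt_eqF K0) implybT.
  by rewrite subrr powRr0 mul1r.
have lnle : ln (2 + (B n)%:R) ^+ d.-1 <= ln (2 + M n) ^+ d.-1.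
  rewrite lerXn2r ?nnegrE ?ln2_ge0 ?(ltW (M0 n))// ler_ln ?posrE ?ltr_wpDr ?(ltW (M0 n))//.
  by rewrite lerD2l ME ler_peMl.
apply: (@le_trans _ _ (b n ^+ 2 * c n)).
  apply: ler_piMl; first by rewrite mulr_ge0 ?sqr_ge0.
  by rewrite invf_le1 ?exprn_gt0// exprn_ege1.
rewrite /c MB /delta /delta_RQ -/(M n) /c0.
have -> : b n ^+ 2 * (`|C| * (K%:R `^ alpha * M n `^ (- alpha)) * ln (2 + (B n)%:R) ^+ d.-1) =
  (`|C| * K%:R `^ alpha) * (b n ^+ 2 * M n `^ (- alpha)) * ln (2 + (B n)%:R) ^+ d.-1 by ring.
rewrite [leRHS]mulrA ler_wpM2l//.
by rewrite mulr_ge0// mulr_ge0 ?powR_ge0 ?sqr_ge0.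
Qed.

Let hc n : (post_norm (block_var D (n := n) (B n)) <= (c n)%:E)%E.
Proof.
apply: (le_trans (hv n)); rewrite lee_fin /c ler_wpM2r ?exprn_ge0 ?ln2_ge0//.
by rewrite ler_wpM2r ?powR_ge0// ler_norm.
Qed.

(** With [N = 1] the errors are powers of [q], and [q^2 = O(delta)]: [q^3] becomes [delta^(3/2)],
    [q^4] becomes [delta^2]. The constant [g] is a sum of all those that occur, so that it dominates
    each combination. *)
Lemma RQ_expansions : delta @ \oo --> (0 : R) -> exists g : R, \forall n \near \oo,
  [/\ proper_weight (weight_u D (n := n) (B n)),
    `|tv0 n - b n ^+ 2 / (4 * K%:R) * @mad n (block_var D (B n))| <= g * delta n `^ (3 / 2) &
    `|tv0 n| <= g * delta n] /\
  [/\ proper_weight (weight_w D (n := n) (B n)),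
    `|tv1 n - b n ^+ 3 / (6 * K%:R ^+ 2) * @mad n (chi D (B n) 3)| <= g * delta n ^+ 2 &
    `|tv1 n| <= g * delta n `^ (3 / 2)].
Proof.
move=> d0; have [G [rho [G0 rho0 H]]] := RQ_bounds K2 cgf.
have q_cvg : q @ \oo --> (0 : R).
  apply: (@cvg0_exprn_le _ q (fun n => c0 * delta n) 1) => //.
  by rewrite -[X in _ --> X](mulr0 c0); apply: cvgMr.
pose p := c0 `^ (3 / 2); have p0 : 0 <= p by exact: powR_ge0.
exists (G * (p + c0 ^+ 2 + c0 + c0 ^+ 2 + c0 ^+ 3)).
set g := p + c0 ^+ 2 + _ + _ + _.
have r1 : 0 < Num.min 1 rho by rewrite lt_min ltr01.
apply: filterS2 (cvgr_lt _ q_cvg _ r1) (cvgr_lt _ d0 _ ltr01) => n /ltW.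
rewrite le_min => /andP[q1 qrho] /ltW d1.
have dn0 := delta_RQ_ge0 n; have qn0 := q0 n; have cd0 := mulr_ge0 c00 dn0.
have q3le : q n ^+ 3 <= p * delta n `^ (3 / 2).
  by rewrite -powRM//; exact: cube_le_powR.
have q4le : q n ^+ 4 <= c0 ^+ 2 * delta n ^+ 2.
  have -> : q n ^+ 4 = (q n ^+ 2) ^+ 2 by rewrite -exprM.
  by rewrite -exprMn; apply: lerXn2r (q2_le n); rewrite nnegrE ?cd0 ?sqr_ge0.
have /andP[d21 d22] : delta n ^+ 2 <= delta n `^ (3 / 2) <= delta n.
  by apply: sqr_le_powR32; rewrite dn0.
have q6le : (q n ^+ 3) ^+ 2 <= c0 ^+ 3 * delta n ^+ 2.
  have -> : (q n ^+ 3) ^+ 2 = (q n ^+ 2) ^+ 3 by rewrite -!exprM.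
  apply: (@le_trans _ _ ((c0 * delta n) ^+ 3)).
    by apply: lerXn2r (q2_le n); rewrite nnegrE ?cd0 ?sqr_ge0.
  rewrite exprMn ler_wpM2l ?exprn_ge0// exprS ler_piMl// exprn_ge0//.
have c2 : 0 <= c0 ^+ 2 by exact: exprn_ge0.
have c3 : 0 <= c0 ^+ 3 by exact: exprn_ge0.
have e32 : 0 <= delta n `^ (3 / 2) by exact: powR_ge0.
have e2 : 0 <= delta n ^+ 2 by exact: exprn_ge0.
have q2rho : q n ^+ 2 <= rho by rewrite (le_trans _ qrho)// expr2 ler_piMl.
have q3rho : q n ^+ 3 <= rho.
  by rewrite (le_trans _ q2rho)// exprS ler_piMl// exprn_ge0.
have [/(_ q2rho)[u1 u2 u3] /(_ q3rho)[w1 w2 w3]] := H n (B n) (c n) (B0 n) (hc n) qrho.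
have ub : q n ^+ 3 + (q n ^+ 2) ^+ 2 <= (p + c0 ^+ 2) * delta n `^ (3 / 2).
  rewrite mulrDl -exprM lerD// (le_trans q4le)// ler_wpM2l//.
have wb : q n ^+ 4 + (q n ^+ 3) ^+ 2 <= (c0 ^+ 2 + c0 ^+ 3) * delta n ^+ 2.
  by rewrite mulrDl lerD.
have final (h z t : R) : 0 <= t -> h <= g -> z <= h * t -> G * z <= G * g * t.
  move=> t0 hg zh; rewrite -mulrA ler_wpM2l//; apply: (le_trans zh).
  by rewrite ler_wpM2r.
have le_g1 : p + c0 ^+ 2 <= g.
  by rewrite /g -[leRHS]addrA -[leRHS]addrA lerDl; do 2 apply: addr_ge0 => //.
have le_g2 : c0 ^+ 2 + c0 ^+ 3 <= g.
  by rewrite /g -[leRHS]addrA lerDr; do 2 apply: addr_ge0 => //.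
split; split => //.
- by apply: (le_trans u2); apply: final ub.
- apply: (le_trans (norm_le_two_bounds u2 u3)); rewrite -mulrDr.
  apply: (final (p + c0 ^+ 2 + c0)) => //.
    by rewrite /g -[leRHS]addrA lerDl; apply: addr_ge0.
  rewrite -/(q n) mulrDl; apply: lerD; last exact: q2_le.
  by apply: (le_trans ub); rewrite ler_wpM2l//; apply: addr_ge0.
- by apply: (le_trans w2); apply: final wb.
- apply: (le_trans (norm_le_two_bounds w2 w3)); rewrite -mulrDr.
  apply: (final (c0 ^+ 2 + c0 ^+ 3 + p)) => //.
    rewrite /g; have -> : p + c0 ^+ 2 + c0 + c0 ^+ 2 + c0 ^+ 3 = c0 ^+ 2 + c0 ^+ 3 + p + (c0 ^+ 2 + c0) by ring.
    by rewrite lerDl; apply: addr_ge0.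
  rewrite -/(q n) mulrDl; apply: lerD; last exact: q3le.
  by apply: (le_trans wb); rewrite ler_wpM2l//; apply: addr_ge0.
Qed.

End randomized_quadrature.

(** For [n > 0], [delta] is [(b / n)^2] times the power [- alpha] of the ratio [r] on the right;
    [b / n] lies between positive constants, so [delta] and [1 / r] tend to 0 together. *)
Lemma delta_RQ_cvg0 (alpha : R) (d : nat) : 0 < alpha -> order_n b ->
  (fun n => delta_RQ alpha d (b n) (K * B n)) @ \oo --> (0 : R) <->
  (fun n => M n / (n%:R `^ (2 / alpha) * ln (2 + M n) `^ (d.-1%:R / alpha))) @ \oo --> +oo.
Proof.
move=> alpha0 [c [C [/andP[cp cC] bn]]].
have C0 : 0 < C by exact: lt_le_trans cC.
pose r n := M n / (n%:R `^ (2 / alpha) * ln (2 + M n) `^ (d.-1%:R / alpha)).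
have l0 n : 0 < ln (2 + M n).
  by rewrite ln_gt0// (lt_le_trans _ (lerD (lexx 2) (ltW (M0 n))))// addr0 ltr1n.
have rE n : (0 < n)%N -> 0 < r n /\ delta_RQ alpha d (b n) (K * B n) =
    (b n / n%:R) ^+ 2 * (r n)^-1 `^ alpha.
  move=> n0; have nR : 0 < n%:R :> R by rewrite ltr0n.
  have p1 : 0 < n%:R `^ (2 / alpha) by rewrite powR_gt0.
  have p2 : 0 < ln (2 + M n) `^ (d.-1%:R / alpha) by rewrite powR_gt0.
  split; first by rewrite divr_gt0 ?mulr_gt0.
  rewrite /r invf_div powRM ?mulr_ge0 ?invr_ge0 ?(ltW p1) ?(ltW p2) ?(ltW (M0 n))//.
  rewrite powRM ?(ltW p1) ?(ltW p2)// -!powRrM !divfK ?gt_eqF//.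
  rewrite powR_mulrn ?(ltW nR)// powR_mulrn ?(ltW (l0 n))// /delta_RQ -/(M n).
  have -> : (M n)^-1 `^ alpha = M n `^ (- alpha).
    by rewrite -powR_inv1 ?(ltW (M0 n))// -powRrM mulN1r.
  by field; rewrite gt_eqF.
have nbig : \forall n \near \oo, (0 < n)%N by exact: nbhs_infty_gt.
have rpos : \forall n \near \oo, 0 < r n by apply: filterS nbig => n /rE[].
rewrite -/r; split=> [d0|roo].
  apply/(gtr0_cvgV0 rpos).
  pose u n := `|(r n)^-1| `^ alpha.
  have u0 : u @ \oo --> (0 : R).
    apply: (@cvg0_near_le _ _ _ (c ^- 2) _ d0).
    apply: filterS nbig => n n0; have [rn ->] := rE n n0.
    have nR : 0 < n%:R :> R by rewrite ltr0n.
    rewrite ger0_norm ?powR_ge0// /u gtr0_norm ?invr_gt0//.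
    rewrite mulrA ler_peMl ?powR_ge0// mulrC ler_pdivlMr ?exprn_gt0// mul1r.
    have /andP[h _] := bn n n0.
    by rewrite lerXn2r ?nnegrE ?divr_ge0 ?(ltW cp) ?(ltW (b0 n))// ler_pdivlMr.
  have := @cvg0_powR _ u alpha^-1; rewrite invr_gt0 alpha0 => /(_ isT (fun n => powR_ge0 _ _) u0).
  have -> : (fun n => u n `^ alpha^-1) = (fun n => `|(r n)^-1|).
    by apply/funext => n; rewrite /u -powRrM divff ?gt_eqF// powRr1.
  by move/norm_cvg0P.
have rV0 : (fun n => (r n)^-1) @ \oo --> (0 : R) by apply/(gtr0_cvgV0 rpos).
have u0 : (fun n => `|(r n)^-1| `^ alpha) @ \oo --> (0 : R).
  by apply: cvg0_powR => //; exact/norm_cvg0P.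
apply: (@cvg0_near_le _ _ _ (C ^+ 2) _ u0).
apply: filterS nbig => n n0; have [rn ->] := rE n n0.
have nR : 0 < n%:R :> R by rewrite ltr0n.
rewrite ger0_norm; last by rewrite mulr_ge0 ?powR_ge0 ?sqr_ge0.
have -> : `|(r n)^-1| = (r n)^-1 by rewrite gtr0_norm ?invr_gt0.
rewrite ler_wpM2r ?powR_ge0//.
have /andP[_ h] := bn n n0.
by rewrite lerXn2r ?nnegrE ?divr_ge0 ?(ltW C0) ?(ltW (b0 n))// ler_pdivrMr.
Qed.

End asymptotic_regimes.

Unset Implicit Arguments.

Theorem corollary4p4 (R : realType) (S : model R) (K : nat) (hK : (2 <= K)%N)
    (D : block_rule S K) (B : nat -> nat) (hB0 : forall n, (0 < B n)%N)
    (hB : B @ \oo --> \oo) :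
  let M := fun n => (K * B n)%N in
  let Mr := fun n => (M n)%:R : R in
  let b := beta S in
  let tv0 := fun n => tv (uncorrected D (B n)) (@post_dens R S n) in
  let tv1 := fun n => tv (corrected D (B n)) (@post_dens R S n) in
  let mad := fun n (g : Theta S n -> R) =>
    post_mean (fun theta => `|g theta - post_mean g|) in
  (* MC-blocks *)
  (MC_blocks D -> MC_cgf_assumption D ->
    [/\ (fun n => b n ^+ 2 / Mr n) @ \oo --> (0 : R) ->
          (\forall n \near \oo, proper_weight (weight_u D (n := n) (B n))) /\
          tv0 = (fun n => b n ^+ 2 / (4 * Mr n) * mad n (sigma2 D (B n)))
            +o_\oo (fun n => b n ^+ 2 / Mr n),
        (fun n => b n ^+ 3 / Mr n ^+ 2) @ \oo --> (0 : R) ->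
          (\forall n \near \oo, proper_weight (weight_w D (n := n) (B n))) /\
          tv1 = (fun n => b n ^+ 3 / (6 * Mr n ^+ 2) * mad n (kappa D (B n) 3))
            +o_\oo (fun n => b n ^+ 3 / Mr n ^+ 2),
        order_n b -> (fun n => Mr n / n%:R ^+ 2) @ \oo --> +oo ->
          tv0 @ \oo --> (0 : R) &
        order_n b -> (fun n => Mr n / n%:R `^ (3 / 2)) @ \oo --> +oo ->
          tv1 @ \oo --> (0 : R)]) /\
  (* RQ-blocks *)
  (forall (C alpha : R) (d : nat), 0 < alpha -> (1 <= d)%N ->
    RQ_cgf_assumption D ->
    (forall n, (post_norm (block_var D (n := n) (B n)) <=
       (C * (B n)%:R `^ (- alpha) * ln (2 + (B n)%:R) ^+ d.-1)%:E)%E) ->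
    let delta := fun n => delta_RQ alpha d (b n) (M n) in
    [/\ delta @ \oo --> (0 : R) ->
          [/\ \forall n \near \oo, proper_weight (weight_u D (n := n) (B n)),
              tv0 = (fun n => b n ^+ 2 / (4 * K%:R) * mad n (block_var D (B n)))
                +O_\oo (fun n => delta n `^ (3 / 2)) &
              tv0 =O_\oo delta],
        delta @ \oo --> (0 : R) ->
          [/\ \forall n \near \oo, proper_weight (weight_w D (n := n) (B n)),
              tv1 = (fun n => b n ^+ 3 / (6 * K%:R ^+ 2) * mad n (chi D (B n) 3))
                +O_\oo (fun n => delta n ^+ 2) &
              tv1 =O_\oo (fun n => delta n `^ (3 / 2))] &
        order_n b ->
          (delta @ \oo --> (0 : R) <->
           (fun n => Mr n / (n%:R `^ (2 / alpha)
              * ln (2 + Mr n) `^ (d.-1%:R / alpha))) @ \oo --> +oo)]).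
Proof.
move=> M Mr b tv0 tv1 mad.
have K0 : 0 < K%:R :> R by rewrite ltr0n ltnW.
have b0 n : 0 < b n by exact: beta_gt0.
have M0 n : 0 < Mr n by rewrite /Mr /M ltr0n muln_gt0 hB0 andbT ltnW.
have x2 n : 0 <= b n ^+ 2 / Mr n by rewrite divr_ge0 ?exprn_ge0// ltW.
have x3 n : 0 <= b n ^+ 3 / Mr n ^+ 2 by rewrite divr_ge0 ?exprn_ge0// ltW.
split=> [mc cgf|C alpha d alpha0 d1 cgf hv delta].
  split.
  - move=> xc; have [pw [e [c [ec h1 h2]]]] := MC_uncorrected hK hB0 mc cgf xc.
    by split => //; exact: littleo_from_bound h1 ec.
  - move=> xc; have [pw [e [c [ec h1 h2]]]] := MC_corrected hK hB0 mc cgf xc.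
    by split => //; exact: littleo_from_bound h1 ec.
  - move=> ob Moo; have xc := order_n_sqr_cvg0 hK hB0 ob Moo.
    have [pw [e [c [ec h1 h2]]]] := MC_uncorrected hK hB0 mc cgf xc.
    exact: cvg0_from_bounds ec xc h1 h2.
  - move=> ob Moo; have xc := order_n_cube_cvg0 hK hB0 ob Moo.
    have [pw [e [c [ec h1 h2]]]] := MC_corrected hK hB0 mc cgf xc.
    exact: cvg0_from_bounds ec xc h1 h2.
have dn0 n : 0 <= delta n by exact: delta_RQ_ge0.
have d32 n : 0 <= delta n `^ (3 / 2) by exact: powR_ge0.
have d2 n : 0 <= delta n ^+ 2 by exact: exprn_ge0.
split.
- move=> dc; have [g h] := RQ_expansions hK hB0 cgf hv dc.
  split.
  + by apply: filterS h => n [[]].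
  + by apply: (bigO_from_bound (c := g) d32); apply: filterS h => n [[]].
  + by apply: (bigO0_from_bound (c := g) dn0); apply: filterS h => n [[]].
- move=> dc; have [g h] := RQ_expansions hK hB0 cgf hv dc.
  split.
  + by apply: filterS h => n [_ []].
  + by apply: (bigO_from_bound (c := g) d2); apply: filterS h => n [_ []].
  + by apply: (bigO0_from_bound (c := g) d32); apply: filterS h => n [_ []].
- by move=> ob; exact: delta_RQ_cvg0.
Qed.
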